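(* Let $N\ge1$ be an integer, $\sigma\in(-1,0)$ and $p,q>1$. Set $$N^*(\sigma,p,q)=2\left(\sigma+1+\frac{\alpha+1}{pq-1}\right),\qquad \alpha=\max\{p,q\},$$ $$d_1=\frac{N(pq-1)}{2(p+1)},\quad d_2=\frac{N(pq-1)}{2(q+1)},\quad k_1=\frac{N(pq-1)}{2[(pq-1)(1+\sigma)+p+1]},\quad k_2=\frac{N(pq-1)}{2[(pq-1)(1+\sigma)+q+1]},$$ and consider the problem $$u_t-\Delta u=|v|^p+t^\sigma w_1(x),\quad v_t-\Delta v=|u|^q+t^\sigma w_2(x)\quad (x\in\mathbb{R}^N,\ t>0),\qquad (u(0,x),v(0,x))=(u_0(x),v_0(x)).$$ Then the following holds: (i) If $u_0,v_0\in C_0(\mathbb{R}^N)$, $w_i\in C_0(\mathbb{R}^N)\cap L^1(\mathbb{R}^N)$, $\int_{\mathbb{R}^N}w_i(x)\,dx>0$ for $i=1,2$, and $N<N^*(\sigma,p,q)$, then the mild solution $(u,v)$ to this problem blows up in finite time. (ii) If $N\ge N^*(\sigma,p,q)$, then there exists $\varepsilon>0$ such that for all $u_0\in C_0(\mathbb{R}^N)\cap L^{d_1}(\mathbb{R}^N)$, $v_0\in C_0(\mathbb{R}^N)\cap L^{d_2}(\mathbb{R}^N)$, $w_i\in C_0(\mathbb{R}^N)\cap L^{k_i}(\mathbb{R}^N)$, $i=1,2$, with $$\|u_0\|_{L^{d_1}}+\|v_0\|_{L^{d_2}}+\|w_1\|_{L^{k_1}}+\|w_2\|_{L^{k_2}}\le\varepsilon,$$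 the mild solution $(u,v)$ to this problem exists globally.
   Context: $C_0(\mathbb{R}^N)$ denotes the set of all continuous (real-valued) functions on $\mathbb{R}^N$ decaying to zero at infinity, with the supremum norm. $S(t)=e^{t\Delta}$ is the heat semigroup on $\mathbb{R}^N$. Mild solution: for $T>0$, a pair $(u,v)\in C([0,T],C_0(\mathbb{R}^N)\times C_0(\mathbb{R}^N))$ is a mild solution to the problem (on $[0,T]$) if for all $0\le t\le T$ $$u(t)=S(t)u_0+\int_0^t S(t-s)|v(s)|^p\,ds+\int_0^t s^\sigma S(t-s)w_1\,ds,$$ $$v(t)=S(t)v_0+\int_0^t S(t-s)|u(s)|^q\,ds+\int_0^t s^\sigma S(t-s)w_2\,ds.$$ For data in $C_0(\mathbb{R}^N)$ the mild solution exists, is unique, and extends to a maximal interval $[0,T_{\max})$, where $T_{\max}\in(0,\infty]$ is the supremum of all $\tau>0$ such that a mild solution exists in $C([0,\tau],C_0(\mathbb{R}^N)\times C_0(\mathbb{R}^N))$. ''Blows up in finite time'' means $T_{\max}<\infty$, in which case $\lim_{t\to T_{\max}^-}\left(\|u\|_{L^\infty((0,t)\times\mathbb{R}^N)}+\|v\|_{L^\infty((0,t)\times\mathbb{R}^N)}\right)=\infty$. ''Exists globally'' means $T_{\max}=\infty$. *)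

(* Defs.v *)
From HB Require Import structures.
From mathcomp Require Import all_boot all_order all_algebra.
From mathcomp Require Import all_classical all_reals all_analysis.

Set Implicit Arguments.
Unset Strict Implicit.
Unset Printing Implicit Defensive.
Import Order.TTheory GRing.Theory Num.Theory.
Import numFieldNormedType.Exports.
Local Open Scope classical_set_scope.
Local Open Scope ring_scope.

(* The Borel sigma-algebra of R^n, generated by the n coordinate functions. *)
Definition rV_display : measure_display -> measure_display.
Proof. exact. Qed.

Section measurable_rV.
Context (R : realType) (n : nat).

Definition rV_coord (i : 'I_n) (x : 'rV[R]_n) : R := x ord0 i.

Let rV_set0 : g_sigma_preimage rV_coord set0.
Proof. exact: sigma_algebra0. Qed.

Let rV_setC A :
  g_sigma_preimage rV_coord A -> g_sigma_preimage rV_coord (~` A).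
Proof. exact: sigma_algebraC. Qed.

Let rV_bigcup (F : (set 'rV[R]_n)^nat) :
  (forall i, g_sigma_preimage rV_coord (F i)) ->
  g_sigma_preimage rV_coord (\bigcup_i (F i)).
Proof. exact: sigma_algebra_bigcup. Qed.

HB.instance Definition _ := @isMeasurable.Build (rV_display default_measure_display)
  'rV[R]_n (g_sigma_preimage rV_coord) rV_set0 rV_setC rV_bigcup.

Lemma measurable_rV_coord i : measurable_fun [set: 'rV[R]_n] (rV_coord i).
Proof.
move=> _ Y mY; rewrite setTI; apply: sub_sigma_algebra => /=.
rewrite -bigcup_seq/=; exists i => /=; first by rewrite mem_index_enum.
by exists Y => //; rewrite setTI.
Qed.

Lemma measurable_fun_rV d (T : measurableType d) (f : T -> 'rV[R]_n) :
  (forall i, measurable_fun [set: T] (rV_coord i \o f)) ->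
  measurable_fun [set: T] f.
Proof.
move=> mf.
have H : g_sigma_preimage (fun i => rV_coord i \o f) `<=` measurable.
  apply: smallest_sub; first exact: sigma_algebra_measurable.
  rewrite -bigcup_seq/=; apply: bigcup_sub => i _ A [B mB <-].
  exact: mf.
by move=> _ A mA; apply: H; rewrite g_sigma_preimage_comp; exists A.
Qed.

End measurable_rV.

Section lebesgue_rV.
Context (R : realType).

(* Prepends a coordinate: the identification R x R^n = R^(1 + n). *)
Definition rV_cons n (z : R * 'rV[R]_n) : 'rV[R]_n.+1 :=
  row_mx (const_mx z.1 : 'rV_1) z.2.

Definition rV_uncons n (x : 'rV[R]_n.+1) : R * 'rV[R]_n :=
  (x ord0 ord0, rsubmx (x : 'rV_(1 + n))).

Lemma rV_cons0 n (z : R * 'rV[R]_n) : rV_cons z ord0 ord0 = z.1.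
Proof.
transitivity (row_mx (const_mx z.1 : 'rV[R]_1) z.2 ord0 (lshift n ord0)).
  by congr (row_mx _ _ _ _); exact/val_inj.
by rewrite row_mxEl mxE.
Qed.

Lemma rV_consS n (z : R * 'rV[R]_n) (i : 'I_n) :
  rV_cons z ord0 (lift ord0 i) = z.2 ord0 i.
Proof.
rewrite -[RHS](row_mxEr (const_mx z.1 : 'rV[R]_1)).
by congr (row_mx _ _ _ _); exact/val_inj.
Qed.

Lemma rV_consK n : cancel (@rV_cons n) (@rV_uncons n).
Proof.
by move=> [a y]; congr pair; [exact: rV_cons0|exact: row_mxKr].
Qed.

Lemma measurable_rV_cons n :
  measurable_fun [set: measurableTypeR R * 'rV[R]_n] (@rV_cons n).
Proof.
apply: measurable_fun_rV => i; case: (unliftP ord0 i) => [j|] ->.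
  rewrite (_ : _ \o _ = rV_coord j \o snd); last first.
    by apply/funext => z; exact: rV_consS.
  exact: measurableT_comp (@measurable_rV_coord _ _ _) measurable_snd.
by rewrite (_ : _ \o _ = fst); [exact: measurable_fst|apply/funext => z; exact: rV_cons0].
Qed.

Lemma measurable_rV_uncons n :
  measurable_fun [set: 'rV[R]_n.+1]
    (@rV_uncons n : 'rV[R]_n.+1 -> measurableTypeR R * 'rV[R]_n).
Proof.
apply: measurable_fun_pair => /=; first exact: measurable_rV_coord.
apply: measurable_fun_rV => i.
rewrite (_ : _ \o _ = rV_coord (rshift 1 i)); first exact: measurable_rV_coord.
by apply/funext => z /=; rewrite /rV_coord mxE.
Qed.


Section step.
Context (n : nat) (mu : {sigma_finite_measure set 'rV[R]_n -> \bar R}).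

Definition lebesgue_rV_step :=
  pushforward ((@lebesgue_measure R) \x mu)%E (@rV_cons n).

Let step0 : lebesgue_rV_step set0 = 0%E.
Proof. by apply: measure0; exact: measurable_rV_cons. Qed.

Let step_ge0 A : (0 <= lebesgue_rV_step A)%E.
Proof. by apply: measure_ge0; exact: measurable_rV_cons. Qed.

Let step_sigma_additive : semi_sigma_additive lebesgue_rV_step.
Proof. by apply: measure_semi_sigma_additive; exact: measurable_rV_cons. Qed.

HB.instance Definition _ := isMeasure.Build _ _ _ lebesgue_rV_step
  step0 step_ge0 step_sigma_additive.

Let step_sigma_finite : sigma_finite setT lebesgue_rV_step.
Proof.
have /sigma_finiteP[F [TF ndF Foo]] := sigma_finiteT (@lebesgue_measure R).
have /sigma_finiteP[G [TG ndG Goo]] := sigma_finiteT mu.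
exists (fun k => @rV_uncons n @^-1` (F k `*` G k)).
  rewrite -preimage_bigcup; apply/esym; rewrite -subTset => z _.
  have : [set: measurableTypeR R] (rV_uncons z).1 by [].
  have : [set: 'rV[R]_n] (rV_uncons z).2 by [].
  rewrite {1}TF {1}TG => -[k _ Gk] [l _ Fl].
  exists (maxn k l) => //; split.
    by move: Fl; apply/subsetPset/ndF/leq_maxr.
  by move: Gk; apply/subsetPset/ndG/leq_maxl.
move=> k; have [mF Fk] := Foo k; have [mG Gk] := Goo k; split.
  rewrite -[X in measurable X]setTI; apply: measurable_rV_uncons => //.
  exact: measurableX.
rewrite /lebesgue_rV_step /pushforward -comp_preimage.
rewrite (_ : _ \o _ = id) ?preimage_id; last exact/funext/rV_consK.
by rewrite product_measure1E// lte_mul_pinfty// ge0_fin_numE.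
Qed.

HB.instance Definition _ := Measure_isSigmaFinite.Build _ _ _ lebesgue_rV_step
  step_sigma_finite.

End step.

(* Lebesgue measure on R^n: the image under rV_cons of the product of Lebesgue
   measure on R and Lebesgue measure on R^(n-1), starting from the unit mass on
   the one-point space R^0. *)
Fixpoint lebesgue_rV n : {sigma_finite_measure set 'rV[R]_n -> \bar R} :=
  if n is m.+1 then lebesgue_rV_step (lebesgue_rV m)
  else \d_(0 : 'rV[R]_0).

Lemma lebesgue_rV_box n (A : 'I_n -> set R) :
  (forall i, measurable (A i)) ->
  lebesgue_rV n [set x | forall i, A i (x ord0 i)] =
  (\prod_(i < n) (@lebesgue_measure R) (A i))%E.
Proof.
elim: n A => [|n IHn] A mA.
  rewrite big_ord0 /= diracE mem_set//; by case.
pose B := [set y : 'rV[R]_n | forall i, A (lift ord0 i) (y ord0 i)].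
have mB : measurable B.
  rewrite (_ : B =
      \bigcap_(i in [set: 'I_n]) (@rV_coord R n i @^-1` A (lift ord0 i))).
    apply: fin_bigcap_measurable => // i _.
    by rewrite -[X in measurable X]setTI; exact: measurable_rV_coord.
  by apply/seteqP; split=> x Bx i; [move=> _|]; exact: Bx.
rewrite big_ord_recl -(IHn (fun i => A (lift ord0 i)))//.
rewrite -product_measure1E//; last exact: mA.
rewrite /= /lebesgue_rV_step /pushforward.
congr (((@lebesgue_measure R) \x lebesgue_rV n)%E _).
apply/seteqP; split=> -[a y] /=.
  move=> Aay; split=> [|i]/=; first by have := Aay ord0; rewrite rV_cons0.
  by have := Aay (lift ord0 i); rewrite rV_consS.
move=> [Aa By] i; case: (unliftP ord0 i) => [j|] ->; last by rewrite rV_cons0.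
by rewrite rV_consS; exact: By.
Qed.

End lebesgue_rV.

Section heat.
Context (R : realType) (N : nat).
Implicit Types (f : 'rV[R]_N -> R) (t : R) (x y : 'rV[R]_N).

(* The norm on 'rV[R]_N is the max-norm, which is equivalent to the Euclidean
   one. *)
Definition C0 : set ('rV[R]_N -> R) :=
  [set f | continuous f /\
    forall e : R, 0 < e -> exists M : R, forall x, M <= `|x| -> `|f x| < e].

(* The squared norm in the Gaussian must be Euclidean, hence not `|x|. *)
Definition heat_kernel t x : R :=
  (4 * pi * t) `^ (- (N%:R / 2)) *
  expR (- (\sum_(i < N) x ord0 i ^+ 2) / (4 * t)).

Definition heat_semigroup t f x : R :=
  if t == 0 then f x
  else \int[lebesgue_rV R N]_y (heat_kernel t (x - y) * f y).

End heat.

Section mild_solution.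
Context (R : realType) (N : nat) (p q sigma : R).
Context (u0 v0 w1 w2 : 'rV[R]_N -> R).
Implicit Types (u v : R -> 'rV[R]_N -> R) (T : R).

(* The norm of C([0, T], C_0) being the supremum norm, continuity in time is
   stated for the topology of uniform convergence on R^N.  The integrals of
   C_0-valued functions are evaluated pointwise in x. *)
Definition is_mild_solution T u v : Prop :=
  [/\ forall t, 0 <= t <= T -> C0 (u t) /\ C0 (v t),
      {within `[0, T], continuous (u : R -> {uniform 'rV[R]_N -> R})},
      {within `[0, T], continuous (v : R -> {uniform 'rV[R]_N -> R})},
      forall t, 0 <= t <= T -> forall x,
        u t x = heat_semigroup t u0 x
          + \int[lebesgue_measure]_(s in `[0, t])
              heat_semigroup (t - s) (fun y => `|v s y| `^ p) x
          + \int[lebesgue_measure]_(s in `[0, t])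
              (s `^ sigma * heat_semigroup (t - s) w1 x) &
      forall t, 0 <= t <= T -> forall x,
        v t x = heat_semigroup t v0 x
          + \int[lebesgue_measure]_(s in `[0, t])
              heat_semigroup (t - s) (fun y => `|u s y| `^ q) x
          + \int[lebesgue_measure]_(s in `[0, t])
              (s `^ sigma * heat_semigroup (t - s) w2 x)].

Definition Tmax : \bar R :=
  ereal_sup [set tau%:E | tau in
    [set tau : R | 0 < tau /\ exists u v, is_mild_solution tau u v]].

(* The mild solution on [0, Tmax); the values of u and v at other times are
   irrelevant. *)
Definition is_maximal_mild_solution u v : Prop :=
  (0 < Tmax)%E /\
  forall tau : R, 0 < tau -> (tau%:E < Tmax)%E -> is_mild_solution tau u v.

Definition Linfty_norm (t : R) u : \bar R :=
  ('N[(@lebesgue_measure R) \x lebesgue_rV R N]_+oo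
    [(fun z => (u z.1 z.2)%:E) \_ (`]0%R, t[ `*` [set: 'rV[R]_N])])%E.

Definition blows_up_in_finite_time u v : Prop :=
  (Tmax < +oo)%E /\
  (Linfty_norm t u + Linfty_norm t v)%E @[t --> (fine Tmax)^'-] --> +oo%E.

Definition exists_globally : Prop := Tmax = +oo%E.

End mild_solution.

(* Main.v *)
Require Import Defs.
From HB Require Import structures.
From mathcomp Require Import all_boot all_order all_algebra.
From mathcomp Require Import all_classical all_reals all_analysis.
From mathcomp Require Import measurable_realfun normal_distribution ess_sup_inf ring lra.

Set Implicit Arguments.
Unset Strict Implicit.
Unset Printing Implicit Defensive.
Import Order.TTheory GRing.Theory Num.Theory.
Import numFieldNormedType.Exports.
Local Open Scope classical_set_scope.
Local Open Scope ring_scope.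

(** With a = (p + 1) / (p q - 1) and b = (q + 1) / (p q - 1), the unforced system
    is invariant under the scaling in which u has size t^(-a) and v has size
    t^(-b).  A forcing t^sigma w produces, near the origin and for large t, a
    contribution of at least the order t^(1 + sigma - N/2).  The condition N < N*
    says that for one of the two components this is larger than the critical
    size, and the nonlinearity then amplifies it without limit; when N >= N*,
    small data in the scale-invariant Lebesgue spaces stay small.

    Solutions.  The heat semigroup is the average of f (x + sqrt t z) against a
    fixed Gaussian density in z, which behaves uniformly as t tends to 0.  A
    continuous path in C_0 is handled through its uniform modulus and decay
    (C0_path).  Picard iterates that are bounded on [0, T] converge to a solution
    there (picard_limit); this gives continuation (mild_continuation) and, with
    uniqueness, a maximal solution and the blow-up alternative
    (exists_maximal_solution, maximal_solution_blow_up).  The latter reduces part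
    (i) to showing that existence times are bounded.

    Part (i).  For a solution on [0, T] let Y(t) = S(2 T - t) u(t) and
    Z(t) = S(2 T - t) v(t), both at the origin.  By the semigroup law and Jensen's
    inequality, Y' >= |Z|^p + c t^sigma T^(-N/2) and Z' >= |Y|^q in integrated
    form (backward_average_feedback), since S(r) w1 at the origin is at least of
    order r^(-N/2) for large r (heat_semigroup_origin_lower).  The forcing alone
    makes |Y| of order T^(1 + sigma - N/2) on an interval of length T / 3.  If
    |Y| >= L on an interval of length l, integrating the two inequalities one
    after the other gives another lower bound on an interval of length l / 9,
    and L l^a is raised to the power p q up to a constant.  Hence L l^a is bounded
    by a constant (feedback_bounded), and so is T^(1 + sigma - N/2 + a).  When
    q > p the roles of u and v are exchanged.

    Part (ii).  Write |f|_k for the L^k norm.  Iterates starting from 0 keep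
    the bounds |u_n(t)|_(q k2) <= E t^(sigma / q) and
    |v_n(t)|_(p k1) <= E t^(sigma / p):
    then |v_n|^p is of size t^sigma in L^(k1), exactly like the forcing
    t^sigma w1, and the L^(k1) - L^(q k2) smoothing of the semigroup has an
    integrable singularity that reproduces the power t^(sigma / q)
    (mild_map_mass).  The loop closes for small E and smaller data.
    Interpolating these norms with a sup bound |v_n| <= M^b makes the nonlinear
    term grow more slowly than M^a (duhamel_pow_sup), so for M large the bounds
    M^a and M^b persist along the iteration on any [0, T]. *)

(** * Borel sets and Lebesgue measure of R^n *)

Section lebesgue_rV_theory.
Context {R : realType}.
Implicit Types (n : nat) (c : R).

Lemma rV_norm_ltP n (x : 'rV[R]_n) (e : R) : 0 < e ->
  (forall i, `|x ord0 i| < e) -> `|x| < e.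
Proof.
move=> e0 xe; rewrite /Num.norm/= mx_normrE; apply/bigmax_ltP; split => // -[i j] _ /=.
by rewrite (ord1 i).
Qed.

Lemma rV_coord_le_norm n (x : 'rV[R]_n) i : `|x ord0 i| <= `|x|.
Proof.
by rewrite [leRHS]/Num.norm/= mx_normrE; apply/bigmax_geP; right => /=; exists (ord0, i).
Qed.

Lemma measurable_rV_ball n (a : 'rV[R]_n) (e : R) :
  measurable [set x : 'rV[R]_n | `|a - x| < e].
Proof.
have [e0|e0] := leP e 0.
  rewrite (_ : [set _ | _] = set0) //; apply/seteqP; split => // x /= xe.
  by have := le_lt_trans (normr_ge0 _) xe; rewrite ltNge e0.
rewrite (_ : [set _ | _] = \bigcap_(i in [set: 'I_n])
   (@rV_coord R n i @^-1` [set y | `|a ord0 i - y| < e])).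
  apply: fin_bigcap_measurable => // i _.
  rewrite -[X in measurable X]setTI; apply: measurable_rV_coord => //.
  have -> : [set y : R | `|a ord0 i - y| < e] = ball (a ord0 i) e by [].
  exact: measurable_ball.
apply/seteqP; split => x /=.
  move=> xe i _ /=; apply: le_lt_trans xe.
  by have := rV_coord_le_norm (a - x) i; rewrite !mxE.
by move=> xe; apply: rV_norm_ltP => // i; rewrite !mxE; exact: (xe i).
Qed.

(** R^n is second countable: an open set is the union of the countably many
    balls with rational centre and radius that it contains. *)
Lemma open_measurable_rV n (U : set 'rV[R]_n) : open U -> measurable U.
Proof.
move=> oU.
pose B (z : 'rV[rat]_n * nat) :=
  [set x : 'rV[R]_n | `|map_mx ratr z.1 - x| < z.2.+1%:R^-1 :> R].
pose F z := if pselect (B z `<=` U) then B z else set0.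
rewrite (_ : U = \bigcup_z F z).
  apply: countable_bigcupT_measurable => [|z]; first exact: countableP.
  rewrite /F; case: (pselect _) => ?.
    exact: measurable_rV_ball.
  exact: measurable0.
apply/seteqP; split => [x Ux|x [z _]]; last first.
  by rewrite /F; case: (pselect _) => // BU; exact: BU.
have /nbhs_ballP[e /= e0 eU] : nbhs x U by exact: open_nbhs_nbhs.
have [k ke] : exists k : nat, k.+1%:R^-1 < e / 2.
  near \oo => k; exists k; near: k.
  apply: near_infty_natSinv_lt (PosNum _).
  by rewrite divr_gt0.
have k0 : 0 < k.+1%:R^-1 :> R by rewrite invr_gt0.
have /choice [r rx] : forall i : 'I_n, exists r : rat,
    `|ratr r - x ord0 i| < k.+1%:R^-1 :> R.
  move=> i.
  have /rat_in_itvoo[r] : x ord0 i - k.+1%:R^-1 < x ord0 i + k.+1%:R^-1.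
    by rewrite ltrD2l gtrN.
  rewrite in_itv/= => /andP[r1 r2]; exists r.
  by rewrite ltr_distl r1.
exists (\row_i r i, k) => //=.
have Bx : B (\row_i r i, k) x.
  by rewrite /B/=; apply: rV_norm_ltP => // i; rewrite !mxE.
rewrite /F; case: (pselect _) => //= -[] y; rewrite /B/= => By; apply: eU.
rewrite -ball_normE /ball_/=.
apply: (@le_lt_trans _ _ (`|map_mx ratr (\row_i r i) - x| + `|map_mx ratr (\row_i r i) - y|)).
  by rewrite (_ : x - y = - (map_mx ratr (\row_i r i) - x) + (map_mx ratr (\row_i r i) - y));
    [rewrite (le_trans (ler_normD _ _))// normrN|rewrite opprB addrA subrK].
by rewrite (splitr e) ltrD// (lt_trans _ ke).
Unshelve. all: by end_near. Qed.

Lemma continuous_rVP n (f : 'rV[R]_n -> R) : continuous f <->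
  (forall (x : 'rV[R]_n) (e : R), 0 < e -> exists2 d : R, 0 < d &
     forall y : 'rV[R]_n, `|x - y| < d -> `|f x - f y| < e).
Proof.
split=> [cf x e e0|H x A /nbhs_ballP[e /= e0 eA]].
  have /nbhs_ballP[d /= d0 dH] := cf x _ (nbhsx_ballx (f x) e e0).
  by exists d => // y xy; apply: (dH y); rewrite -ball_normE.
have [d d0 dH] := H x e e0.
apply/nbhs_ballP; exists d => //= y; rewrite -ball_normE => xy.
by apply: eA; exact: dH.
Qed.

Lemma continuous_measurable_rV n (f : 'rV[R]_n -> R) :
  continuous f -> measurable_fun setT f.
Proof.
move=> /continuousP cf.
apply: (measurability _ (RGenOpens.measurableE R)).
move=> _ [_ [a [b ->] <-]]; rewrite setTI; apply: open_measurable_rV; apply: cf.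
exact: interval_open.
Qed.

(** R x R^n is identified with R^(1+n), whose Borel sets are generated by its
    open sets. *)
Lemma continuous_measurable_prod n (F : R -> 'rV[R]_n -> R) :
  (forall (s : R) (x : 'rV[R]_n) (e : R), 0 < e -> exists2 d : R, 0 < d &
     forall (s' : R) (x' : 'rV[R]_n),
     `|s - s'| < d -> `|x - x'| < d -> `|F s x - F s' x'| < e) ->
  measurable_fun setT (fun z : measurableTypeR R * 'rV[R]_n => F z.1 z.2).
Proof.
move=> cF.
pose G (z : 'rV[R]_n.+1) := F (rV_uncons z).1 (rV_uncons z).2.
have cG : continuous G.
  apply/continuous_rVP => z e e0.
  have [d d0 H] := cF (rV_uncons z).1 (rV_uncons z).2 e e0.
  exists d => // y zy; apply: H.
    apply: le_lt_trans zy; have := rV_coord_le_norm (z - y) ord0.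
    by rewrite !mxE.
  apply: rV_norm_ltP => // i; apply: le_lt_trans zy.
  have := rV_coord_le_norm (z - y) (rshift 1 i).
  by rewrite !mxE.
rewrite (_ : (fun z => _) = G \o @rV_cons R n).
  apply: measurableT_comp; first exact: continuous_measurable_rV.
  exact: measurable_rV_cons.
by apply/funext => z; rewrite /= /G rV_consK.
Qed.

(** Lebesgue measure is the only measure giving half-open intervals their
    length; c times its image under a + c * x also does. *)
Lemma ge0_integral_affine c (a : R) (f : R -> \bar R) : 0 < c ->
  measurable_fun setT f -> (forall x, 0 <= f x)%E ->
  (\int[@lebesgue_measure R]_x f x =
   c%:E * \int[@lebesgue_measure R]_x f (a + c * x)%R)%E.
Proof.
move=> c0 mf f0.
pose phi (x : measurableTypeR R) : measurableTypeR R := a + c * x.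
have mphi : measurable_fun setT phi.
  apply: continuous_measurable_fun => x; apply: cvgD; first exact: cvg_cst.
  by apply: cvgM; [exact: cvg_cst|exact: cvg_id].
have cc0 : 0 <= c by exact: ltW.
have [m mE0] : exists m : {measure set (measurableTypeR R) -> \bar R},
    forall f, measurable_fun [set: R] f -> (forall x, 0 <= f x)%E ->
    (\int[m]_x f x = c%:E * \int[lebesgue_measure]_x f (phi x))%E.
  unshelve eexists.
    refine (mscale (NngNum cc0) (pushforward lebesgue_measure phi)); exact: mphi.
  move=> h mh h0; rewrite ge0_integral_mscale//=; congr (_ * _)%E.
  by rewrite (ge0_integral_pushforward mphi).
have mE : forall A, measurable A -> lebesgue_measure A = m A.
  apply: lebesgue_measure_unique => _ [[u v] _ <-] /=.
  rewrite -[in RHS](setIT `]u, v]%classic) -integral_indic//= mE0; last 2 first.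
  - exact/measurable_EFinP/measurable_indic.
  - by move=> x; rewrite lee_fin.
  rewrite (_ : (fun x => _) = (fun x => (\1_(`](u - a) / c, (v - a) / c]%classic) x)%:E)); last first.
    apply/funext => x; rewrite !indicE; congr ((nat_of_bool _)%:R%:E).
    by rewrite !mem_setE !in_itv/= /phi ltr_pdivrMr// ler_pdivlMr// ltrBlDl lerBrDl mulrC.
  rewrite integral_indic// setIT.
  transitivity (c%:E * lebesgue_measure `]((u - a) / c)%R, ((v - a) / c)%R]%classic)%E => //.
  rewrite !lebesgue_measure_itv/= !lte_fin ltr_pM2r ?invr_gt0// ltrD2r.
  case: ifPn => _; last by rewrite mule0.
  by rewrite -!EFinB -EFinM; congr EFin; field; rewrite gt_eqF.
by rewrite (eq_measure_integral m) => [|A mA _]; [exact: mE0|exact: mE].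
Qed.

Lemma ge0_integral_rVS n (f : 'rV[R]_n.+1 -> \bar R) :
  measurable_fun setT f -> (forall x, 0 <= f x)%E ->
  (\int[lebesgue_rV R n.+1]_x f x =
   \int[@lebesgue_measure R]_a \int[lebesgue_rV R n]_y f (rV_cons (a, y)))%E.
Proof.
move=> mf f0; rewrite /= /lebesgue_rV_step.
rewrite (ge0_integral_pushforward (@measurable_rV_cons R n))// preimage_setT.
rewrite (@fubini_tonelli1 _ _ (measurableTypeR R) _ _ (@lebesgue_measure R) (lebesgue_rV R n) (f \o @rV_cons R n))//.
- by apply: measurableT_comp => //; exact: measurable_rV_cons.
- by move=> x /=.
Qed.

Lemma measurable_rV_affine n c (a : 'rV[R]_n) :
  measurable_fun setT (fun x : 'rV[R]_n => a + c *: x).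
Proof.
apply: measurable_fun_rV => i.
rewrite (_ : _ \o _ = (fun r => a ord0 i + c * r) \o @rV_coord R n i); last first.
  by apply/funext => x /=; rewrite /rV_coord !mxE.
apply: measurableT_comp; last exact: measurable_rV_coord.
apply: continuous_measurable_fun => x; apply: cvgD; first exact: cvg_cst.
by apply: cvgM; [exact: cvg_cst|exact: cvg_id].
Qed.

Lemma rV_cons_affine n c (z : 'rV[R]_n.+1) (a : R) (y : 'rV[R]_n) :
  z + c *: rV_cons (a, y) =
  rV_cons ((rV_uncons z).1 + c * a, (rV_uncons z).2 + c *: y).
Proof.
apply/rowP => i; rewrite 2!mxE.
case: (unliftP ord0 i) => [j|] ->; last by rewrite !rV_cons0.
by rewrite !rV_consS/= !mxE; congr (z _ _ + _); exact/val_inj.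
Qed.

(** Induction on the dimension: Tonelli isolates the first coordinate, on which
    the one-dimensional change of variable acts. *)
Lemma ge0_integral_rV_affine n c (a : 'rV[R]_n) (f : 'rV[R]_n -> \bar R) : 0 < c ->
  measurable_fun setT f -> (forall x, 0 <= f x)%E ->
  (\int[lebesgue_rV R n]_x f x =
   (c ^+ n)%:E * \int[lebesgue_rV R n]_x f (a + c *: x)%R)%E.
Proof.
move=> c0; elim: n => [|n IH] in a f *.
  move=> mf f0; rewrite expr0 mul1e; apply: eq_integral => x _; congr f.
  by apply/rowP; case.
move=> mf f0; rewrite !ge0_integral_rVS//; last first.
  by apply: measurableT_comp => //; exact: measurable_rV_affine.
under [in RHS]eq_integral => x _ do under eq_integral => y _ do rewrite rV_cons_affine.
have mfc : measurable_fun setT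
    (fun z : measurableTypeR R * 'rV[R]_n => f (rV_cons z)).
  by apply: measurableT_comp => //; exact: measurable_rV_cons.
pose g r := (\int[lebesgue_rV R n]_y f (rV_cons (r, y)))%E.
have mg : measurable_fun setT (g : measurableTypeR R -> _).
  exact: (measurable_fun_fubini_tonelli_F (fun z => f (rV_cons z))).
have g0 r : (0 <= g r)%E by apply: integral_ge0.
transitivity (c%:E * \int[lebesgue_measure]_x g ((rV_uncons a).1 + c * x)%R)%E.
  exact: ge0_integral_affine.
rewrite exprS EFinM -muleA; congr (_ * _)%E.
rewrite -ge0_integralZl//; first last.
- by rewrite lee_fin exprn_ge0// ltW.
- by move=> x _; apply: integral_ge0.
- pose h r := (\int[lebesgue_rV R n]_y f (rV_cons (r, (rV_uncons a).2 + c *: y)%R))%E.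
  have mh : measurable_fun setT (h : measurableTypeR R -> _).
    apply: (@measurable_fun_fubini_tonelli_F _ _ (measurableTypeR R) _ _ (lebesgue_rV R n)
      (fun z : measurableTypeR R * 'rV[R]_n =>
        f (rV_cons (z.1, ((rV_uncons a).2 + c *: z.2)%R)))) => //.
    apply: (measurableT_comp mfc) => /=; apply: measurable_fun_pair => //=.
    by apply: (measurableT_comp (measurable_rV_affine c _) measurable_snd).
  apply: (measurableT_comp mh) => /=.
  apply: continuous_measurable_fun => x; apply: cvgD; first exact: cvg_cst.
  by apply: cvgM; [exact: cvg_cst|exact: cvg_id].
apply: eq_integral => x _; rewrite /g; apply: IH => //.
by apply: (measurableT_comp mfc); exact: measurable_fun_pair.
Qed.

Lemma ge0_integral_rV_prod n (f : 'I_n -> R -> R) :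
  (forall i, measurable_fun setT (f i)) -> (forall i x, 0 <= f i x) ->
  (\int[lebesgue_rV R n]_x (\prod_i f i (x ord0 i))%:E =
   \prod_i \int[@lebesgue_measure R]_x (f i x)%:E)%E.
Proof.
elim: n f => [|n IH] f mf f0.
  rewrite big_ord0; under eq_integral do rewrite big_ord0.
  by rewrite /= integral_dirac// diracT mul1e.
have mprod m (g : 'I_m -> R -> R) : (forall i, measurable_fun setT (g i)) ->
    measurable_fun setT (fun x : 'rV[R]_m => (\prod_i g i (x ord0 i))%:E).
  move=> mg; apply/measurable_EFinP; apply: measurable_prod => i _.
  by apply: measurableT_comp => //; exact: measurable_rV_coord.
rewrite ge0_integral_rVS//; last 2 first.
- exact: mprod.
- by move=> x; rewrite lee_fin; apply: prodr_ge0.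
rewrite big_ord_recl.
under eq_integral => a _.
  under eq_integral => y _.
    rewrite big_ord_recl rV_cons0/= EFinM.
    under eq_bigr do rewrite rV_consS.
    over.
  rewrite ge0_integralZl//; first last.
  - by rewrite lee_fin.
  - by move=> x _; rewrite lee_fin; apply: prodr_ge0.
  - exact: (mprod _ (fun i => f (lift ord0 i))).
  rewrite (IH (fun i => f (lift ord0 i)))//.
  over.
rewrite ge0_integralZr//.
- by have /measurable_EFinP := mf ord0.
- by move=> x _; rewrite lee_fin.
- apply: prode_ge0 => i _; apply: integral_ge0 => x _; by rewrite lee_fin.
Qed.

End lebesgue_rV_theory.

(** * The heat kernel and Gaussian averages *)

Section heat_kernel_theory.
Context {R : realType}.
Implicit Types (N : nat) (t s : R).

Definition sqnorm N (x : 'rV[R]_N) : R := \sum_(i < N) x ord0 i ^+ 2.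

(** The heat kernel of the line, a normal density of variance 2 t: this is where
    its total mass comes from. *)
Definition heat_kernel1 t (x : R) : R :=
  (4 * pi * t) `^ (- (1 / 2)) * expR (- x ^+ 2 / (4 * t)).

Lemma heat_kernel1_normal t (x y : R) : 0 < t ->
  heat_kernel1 t (x - y) = normal_pdf x (Num.sqrt (2 * t)) y.
Proof.
move=> t0; have t2 : 0 < 2 * t by rewrite mulr_gt0.
have s0 : Num.sqrt (2 * t) != 0 by rewrite gt_eqF// sqrtr_gt0.
rewrite normal_pdfE// /normal_peak /normal_fun sqr_sqrtr ?ltW//.
rewrite /heat_kernel1 powRN div1r powR12_sqrt; last first.
  by rewrite !mulr_ge0 ?pi_ge0// ltW.
congr (_ * expR _).
  by congr (Num.sqrt _)^-1; rewrite -mulr_natr; ring.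
rewrite -(sqrrN (x - y)) opprB; congr (_ / _).
by rewrite -mulr_natr; ring.
Qed.

Lemma measurable_heat_kernel1 t (x : R) : 0 < t ->
  measurable_fun setT (fun y : R => heat_kernel1 t (x - y)).
Proof.
move=> t0; rewrite (_ : (fun y => _) = normal_pdf x (Num.sqrt (2 * t))).
  exact: measurable_normal_pdf.
by apply/funext => y; exact: heat_kernel1_normal.
Qed.

Lemma heat_kernel1_ge0 t (x : R) : 0 <= heat_kernel1 t x.
Proof. by rewrite mulr_ge0 ?powR_ge0 ?expR_ge0. Qed.

Lemma integral_heat_kernel1 t (x : R) : 0 < t ->
  (\int[lebesgue_measure]_y (heat_kernel1 t (x - y))%:E = 1)%E.
Proof.
move=> t0; rewrite -(@integral_normal_pdf R x (Num.sqrt (2 * t))).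
by apply: eq_integral => y _; rewrite heat_kernel1_normal.
Qed.

(** Completing the square in y. *)
Lemma heat_kernel1M t s (x y z : R) : 0 < t -> 0 < s ->
  heat_kernel1 t (x - y) * heat_kernel1 s (y - z) =
  heat_kernel1 (t + s) (x - z) *
    heat_kernel1 (t * s / (t + s)) ((s * x + t * z) / (t + s) - y).
Proof.
move=> t0 s0; rewrite /heat_kernel1.
have ts0 : 0 < t + s by rewrite addr_gt0.
have := pi_gt0 R; move: (pi : R) => P p0.
rewrite mulrACA [RHS]mulrACA -!expRD -!powRM ?mulr_ge0 ?addr_ge0 ?invr_ge0 ?addr_ge0 ?ltW//.
congr (_ `^ _ * expR _).
  by field; rewrite gt_eqF.
by field; rewrite !gt_eqF.
Qed.

Lemma heat_kernel_prod N t (x : 'rV[R]_N) : 0 <= t ->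
  heat_kernel t x = \prod_(i < N) heat_kernel1 t (x ord0 i).
Proof.
move=> t0; rewrite /heat_kernel1 big_split/= prodr_const card_ord -expR_sum.
rewrite -powR_mulrn ?powR_ge0// -powRrM; congr (_ `^ _ * expR _).
  by rewrite mulNr div1r mulrC.
by rewrite -mulr_suml; congr (_ / _); rewrite -sumrN.
Qed.

Lemma heat_kernel_ge0 N t (x : 'rV[R]_N) : 0 <= heat_kernel t x.
Proof. by rewrite mulr_ge0 ?powR_ge0 ?expR_ge0. Qed.

Lemma measurable_sqnorm N : measurable_fun setT (@sqnorm N).
Proof.
apply: measurable_sum => i; apply: measurable_funX; exact: measurable_rV_coord.
Qed.

Lemma measurable_heat_kernel N t :
  measurable_fun setT (fun x : 'rV[R]_N => heat_kernel t x).
Proof.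
apply: measurable_funM => //; apply: measurableT_comp => //.
apply: measurable_funM => //; apply: measurableT_comp => //.
exact: measurable_sqnorm.
Qed.

Lemma measurable_rV_sub N (x : 'rV[R]_N) : measurable_fun setT (fun y : 'rV[R]_N => x - y).
Proof.
rewrite (_ : (fun y => _) = (fun y => x + (-1) *: y)); last first.
  by apply/funext => y; rewrite scaleN1r.
exact: measurable_rV_affine.
Qed.

Lemma measurable_heat_kernel_sub N t :
  measurable_fun setT (fun z : 'rV[R]_N * 'rV[R]_N => heat_kernel t (z.1 - z.2)).
Proof.
apply: measurableT_comp; first exact: measurable_heat_kernel.
apply: measurable_fun_rV => i.
rewrite (_ : _ \o _ = (fun z : 'rV[R]_N * 'rV[R]_N => rV_coord i z.1 - rV_coord i z.2)); last first.
  by apply/funext => z /=; rewrite /rV_coord !mxE.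
by apply: measurable_funB; apply: measurableT_comp (@measurable_rV_coord _ _ i) _;
  [exact: measurable_fst|exact: measurable_snd].
Qed.

Lemma integral_heat_kernel N t (x : 'rV[R]_N) : 0 < t ->
  (\int[lebesgue_rV R N]_y (heat_kernel t (x - y))%:E = 1)%E.
Proof.
move=> t0.
under eq_integral => y _.
  rewrite heat_kernel_prod ?ltW//.
  under eq_bigr do rewrite !mxE.
  over.
rewrite (@ge0_integral_rV_prod R N (fun i r => heat_kernel1 t (x ord0 i - r))).
- by apply: big1 => i _; exact: integral_heat_kernel1.
- by move=> i; exact: measurable_heat_kernel1.
- by move=> i r; exact: heat_kernel1_ge0.
Qed.

(** Coordinatewise, heat_kernel1M splits off the kernel at time t + s; what is
    left is again a heat kernel in y, of mass one. *)
Lemma chapman_kolmogorov N t s (x z : 'rV[R]_N) : 0 < t -> 0 < s ->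
  (\int[lebesgue_rV R N]_y (heat_kernel t (x - y) * heat_kernel s (y - z))%:E =
   (heat_kernel (t + s) (x - z))%:E)%E.
Proof.
move=> t0 s0; have ts0 : 0 < t + s by rewrite addr_gt0.
have r0 : 0 < t * s / (t + s) by rewrite divr_gt0// mulr_gt0.
under eq_integral => y _.
  rewrite !heat_kernel_prod ?ltW// -big_split/=.
  under eq_bigr do rewrite !mxE heat_kernel1M//.
  rewrite big_split/=.
  rewrite (_ : \prod_i heat_kernel1 (t + s) _ = heat_kernel (t + s) (x - z)); last first.
    by rewrite heat_kernel_prod ?ltW//; apply: eq_bigr => i _; rewrite !mxE.
  rewrite EFinM.
  over.
pose m i := (s * x ord0 i + t * z ord0 i) / (t + s).
pose g i r := heat_kernel1 (t * s / (t + s)) (m i - r).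
have mg i : measurable_fun setT (g i) by exact: measurable_heat_kernel1.
have g0 i r : 0 <= g i r by exact: heat_kernel1_ge0.
rewrite ge0_integralZl//.
- rewrite (@ge0_integral_rV_prod R N g)// big1 ?mule1// => i _.
  exact: integral_heat_kernel1.
- apply/measurable_EFinP; apply: measurable_prod => i _.
  by apply: (measurableT_comp (mg i)); exact: measurable_rV_coord.
- by move=> y _; rewrite lee_fin; apply: prodr_ge0 => i _; exact: heat_kernel1_ge0.
- by rewrite lee_fin heat_kernel_ge0.
Qed.

Lemma sqnorm_ge0 N (x : 'rV[R]_N) : 0 <= sqnorm x.
Proof. by apply: sumr_ge0 => i _; exact: sqr_ge0. Qed.

Lemma sqnormZ N c (x : 'rV[R]_N) : sqnorm (c *: x) = c ^+ 2 * sqnorm x.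
Proof.
by rewrite /sqnorm mulr_sumr; apply: eq_bigr => i _; rewrite mxE exprMn.
Qed.

Lemma norm_le_sqnorm N (x : 'rV[R]_N) : `|x| ^+ 2 <= sqnorm x.
Proof.
have s0 := sqnorm_ge0 x.
rewrite -(@ler_sqrt R)// sqrtr_sqr ger0_norm//.
rewrite [leLHS]/Num.norm/= mx_normrE; apply/bigmax_leP; split => [|[i j] _] /=.
  exact: sqrtr_ge0.
rewrite (ord1 i) -sqrtr_sqr ler_sqrt// /sqnorm (bigD1 j)//= lerDl.
by apply: sumr_ge0 => k _; exact: sqr_ge0.
Qed.

Lemma heat_kernel_le N t (x : 'rV[R]_N) : 0 <= t ->
  heat_kernel t x <= (4 * pi * t) `^ (- (N%:R / 2)).
Proof.
move=> t0; rewrite /heat_kernel ler_piMr ?powR_ge0// -expR0 ler_expR.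
by rewrite mulNr oppr_le0 divr_ge0 ?mulr_ge0 ?sqnorm_ge0.
Qed.

Lemma heat_kernel_scale N t (z : 'rV[R]_N) : 0 < t ->
  Num.sqrt t ^+ N * heat_kernel t (Num.sqrt t *: z) = heat_kernel 1 z.
Proof.
move=> t0; rewrite /heat_kernel -!/(sqnorm _) sqnormZ sqr_sqrtr ?ltW// mulrA.
congr (_ * expR _); last by field; rewrite gt_eqF.
rewrite mulr1 powRM ?mulr_ge0 ?pi_ge0 ?ltW// mulrCA -[RHS]mulr1; congr (_ * _).
rewrite -powR12_sqrt ?ltW// -powR_mulrn ?powR_ge0// -powRrM -powRD; last first.
  by rewrite (gt_eqF t0) implybT.
by rewrite mulrC subrr powRr0.
Qed.

(** Positive and negative parts are transported separately, so that both sides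
    make sense, and agree, even when f is not integrable. *)
Lemma integral_rV_affine N (c : R) (a : 'rV[R]_N) (f : 'rV[R]_N -> R) : 0 < c ->
  measurable_fun setT f ->
  (\int[lebesgue_rV R N]_x (f x)%:E =
   \int[lebesgue_rV R N]_x (c ^+ N * f (a + c *: x)%R)%:E)%E.
Proof.
move=> c0 mf.
have cN : 0 <= c ^+ N by rewrite exprn_ge0// ltW.
have mfc : measurable_fun setT (fun x : 'rV[R]_N => f (a + c *: x)).
  by apply: measurableT_comp => //; exact: measurable_rV_affine.
rewrite integralE [RHS]integralE.
have E (g : 'rV[R]_N -> R) : measurable_fun setT g -> (forall x, 0 <= g x) ->
    (\int[lebesgue_rV R N]_x (g x)%:E =
     \int[lebesgue_rV R N]_x (c ^+ N * g (a + c *: x)%R)%:E)%E.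
  move=> mg g0; rewrite (@ge0_integral_rV_affine R N c a)//.
  - under [RHS]eq_integral do rewrite EFinM.
    rewrite ge0_integralZl//.
    + apply/measurable_EFinP; apply: measurableT_comp => //.
      exact: measurable_rV_affine.
    + by move=> x _; rewrite lee_fin.
  - exact/measurable_EFinP.
congr (_ - _)%E.
- under eq_integral do rewrite funeposE -EFin_max.
  under [RHS]eq_integral do rewrite funeposE -EFin_max -[X in Num.max _ X](mulr0 (c ^+ N)) -maxr_pMr//.
  apply: (E (fun x => Num.max (f x) 0)); last by move=> x; rewrite le_max lexx orbT.
  exact: measurable_maxr.
- under eq_integral do rewrite funenegE -EFinN -EFin_max.
  under [RHS]eq_integral do rewrite funenegE -EFinN -EFin_max -mulrN -[X in Num.max _ X](mulr0 (c ^+ N)) -maxr_pMr//.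
  apply: (E (fun x => Num.max (- f x) 0)); last by move=> x; rewrite le_max lexx orbT.
  by apply: measurable_maxr => //; exact: measurableT_comp.
Qed.

Lemma heat_kernelN N t (z : 'rV[R]_N) : heat_kernel t (- z) = heat_kernel t z.
Proof.
have E : \sum_(i < N) (- z) ord0 i ^+ 2 = \sum_(i < N) z ord0 i ^+ 2.
  by apply: eq_bigr => i _; rewrite mxE sqrrN.
by rewrite /heat_kernel E.
Qed.

Lemma integral_heat_kernel0 N t : 0 < t ->
  (\int[lebesgue_rV R N]_z (heat_kernel t z)%:E = 1)%E.
Proof.
move=> t0; rewrite -(@integral_heat_kernel N t 0 t0); apply: eq_integral => z _.
by rewrite sub0r heat_kernelN.
Qed.

Lemma integrable_heat_kernel0 N t : 0 < t ->
  (lebesgue_rV R N).-integrable setT (EFin \o heat_kernel t).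
Proof.
move=> t0; apply/integrableP; split.
  by apply/measurable_EFinP; exact: measurable_heat_kernel.
under eq_integral => z _ do rewrite /= ger0_norm ?heat_kernel_ge0//.
by rewrite integral_heat_kernel0// ltry.
Qed.

(** The substitution y = x + sqrt t z turns the kernel at time t into the kernel
    at time 1; in this form t = 0 is no longer a special case. *)
Lemma heat_semigroupE N t (f : 'rV[R]_N -> R) (x : 'rV[R]_N) : 0 <= t ->
  measurable_fun setT f ->
  heat_semigroup t f x =
  \int[lebesgue_rV R N]_z (heat_kernel 1 z * f (x + Num.sqrt t *: z)).
Proof.
move=> t0 mf; rewrite /heat_semigroup; case: eqVneq => [->|tn0].
  rewrite sqrtr0; under eq_Rintegral do rewrite scale0r addr0.
  rewrite RintegralZr//; last exact: integrable_heat_kernel0.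
  by rewrite /Rintegral integral_heat_kernel0// mul1r.
have {tn0}t0 : 0 < t by rewrite lt_neqAle eq_sym tn0.
congr fine; rewrite (@integral_rV_affine N (Num.sqrt t) x) ?sqrtr_gt0//.
  apply: eq_integral => z _; rewrite opprD addNKr -(heat_kernel_scale z t0).
  by rewrite mulrA heat_kernelN.
apply: measurable_funM => //.
apply: measurableT_comp (measurable_rV_sub x); exact: measurable_heat_kernel.
Qed.


(** Since s <= expR s, the factor |z|^2 / 8 is absorbed by passing to the wider
    Gaussian of time 2; hence the second moment is finite. *)
Lemma heat_kernel_sqnorm N (z : 'rV[R]_N) :
  heat_kernel 1 z * sqnorm z <=
  (4 * pi * 1) `^ (- (N%:R / 2)) / (4 * pi * 2) `^ (- (N%:R / 2)) * 8 * heat_kernel 2 z.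
Proof.
rewrite /heat_kernel -/(sqnorm z); set A := _ `^ _; set B := _ `^ _.
have A0 : 0 < A by rewrite powR_gt0// !mulr_gt0// pi_gt0.
have B0 : 0 < B by rewrite powR_gt0// !mulr_gt0// pi_gt0.
set x := sqnorm z.
rewrite -!mulrA ler_pM2l// (mulrCA _ B) !mulKf ?gt_eqF//.
rewrite (_ : - x / (4 * 1) = - x / (4 * 2) + - (x / 8)); last by field.
rewrite expRD -mulrA (mulrC 8) ler_pM2l ?expR_gt0//.
rewrite expRN ler_pdivrMl ?expR_gt0// -ler_pdivrMr//.
by rewrite (le_trans _ (expR_ge1Dx _))// lerDr.
Qed.

(** Gaussian averages: the heat semigroup acts by averaging f (x + sqrt t z)
    against the fixed density heat_kernel 1, uniformly down to t = 0. *)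
Definition gauss_avg N (h : 'rV[R]_N -> R) : R :=
  \int[lebesgue_rV R N]_z (heat_kernel 1 z * h z).

Definition gauss_integrable N (h : 'rV[R]_N -> R) :=
  (lebesgue_rV R N).-integrable setT (fun z => (heat_kernel 1 z * h z)%:E).

Lemma gauss_integrable_sqnorm N : gauss_integrable (@sqnorm N).
Proof.
have mh : measurable_fun setT (fun z : 'rV[R]_N => (heat_kernel 1 z * sqnorm z)).
  by apply: measurable_funM; [exact: measurable_heat_kernel|exact: measurable_sqnorm].
apply: (@le_integrable _ _ _ _ _ _ _ (fun z => (
  (4 * pi * 1) `^ (- (N%:R / 2)) / (4 * pi * 2) `^ (- (N%:R / 2)) * 8)%:E *
   (heat_kernel 2 z)%:E)%E) => //.
- exact/measurable_EFinP.
- move=> z _; rewrite -EFinM /= lee_fin.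
  have h0 : 0 <= heat_kernel 1 z * sqnorm z by rewrite mulr_ge0 ?heat_kernel_ge0 ?sqnorm_ge0.
  rewrite (ger0_norm h0); exact: le_trans (heat_kernel_sqnorm z) (ler_norm _).
- by apply: integrableZl => //; exact: integrable_heat_kernel0.
Qed.

Lemma gauss_integrable_bound N (h : 'rV[R]_N -> R) (A B : R) :
  measurable_fun setT h -> 0 <= A -> 0 <= B ->
  (forall z, `|h z| <= A + B * sqnorm z) -> gauss_integrable h.
Proof.
move=> mh A0 B0 hAB.
have iAB : (lebesgue_rV R N).-integrable setT
    (fun z => A%:E * (heat_kernel 1 z)%:E + B%:E * (heat_kernel 1 z * sqnorm z)%:E)%E.
  apply: integrableD => //; apply: integrableZl => //.
  - exact: integrable_heat_kernel0.
  - exact: gauss_integrable_sqnorm.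
apply: le_integrable iAB => //.
  by apply/measurable_EFinP; apply: measurable_funM => //; exact: measurable_heat_kernel.
move=> z _; rewrite -!EFinM -EFinD /= lee_fin normrM ger0_norm ?heat_kernel_ge0//.
rewrite (_ : A * _ + _ = heat_kernel 1 z * (A + B * sqnorm z)); last by ring.
rewrite [leRHS]ger0_norm; last first.
  by rewrite mulr_ge0 ?heat_kernel_ge0 ?addr_ge0 ?mulr_ge0 ?sqnorm_ge0.
by rewrite ler_wpM2l ?heat_kernel_ge0.
Qed.

Lemma gauss_integrable_bounded N (h : 'rV[R]_N -> R) (A : R) :
  measurable_fun setT h -> (forall z, `|h z| <= A) -> gauss_integrable h.
Proof.
move=> mh hA.
have A0 : 0 <= A by exact: le_trans (normr_ge0 _) (hA 0).
by apply: (@gauss_integrable_bound _ h A 0) => // z; rewrite mul0r addr0.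
Qed.

Definition gauss_moment2 N := gauss_avg (@sqnorm N).

Lemma gauss_moment2_ge0 N : 0 <= gauss_moment2 N.
Proof.
by apply: Rintegral_ge0 => z _; rewrite mulr_ge0 ?heat_kernel_ge0 ?sqnorm_ge0.
Qed.

Lemma gauss_avg_cst N (A : R) : gauss_avg (fun _ : 'rV[R]_N => A) = A.
Proof.
rewrite /gauss_avg RintegralZr//; last exact: integrable_heat_kernel0.
by rewrite /Rintegral integral_heat_kernel0// mul1r.
Qed.

Lemma gauss_avgB N (h k : 'rV[R]_N -> R) : gauss_integrable h -> gauss_integrable k ->
  gauss_avg h - gauss_avg k = gauss_avg (fun z => h z - k z).
Proof.
move=> ih ik; rewrite /gauss_avg -RintegralB//.
by apply: eq_Rintegral => z _; rewrite mulrBr.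
Qed.

Lemma gauss_avgD N (h k : 'rV[R]_N -> R) : gauss_integrable h -> gauss_integrable k ->
  gauss_avg h + gauss_avg k = gauss_avg (fun z => h z + k z).
Proof.
move=> ih ik; rewrite /gauss_avg -RintegralD//.
by apply: eq_Rintegral => z _; rewrite mulrDr.
Qed.

Lemma gauss_avg_le N (h k : 'rV[R]_N -> R) : gauss_integrable h -> gauss_integrable k ->
  (forall z, h z <= k z) -> gauss_avg h <= gauss_avg k.
Proof.
move=> ih ik hk; apply: le_Rintegral => // z _.
by rewrite ler_wpM2l// heat_kernel_ge0.
Qed.

Lemma gauss_avg_bound N (h : 'rV[R]_N -> R) (A B : R) :
  measurable_fun setT h -> 0 <= A -> 0 <= B ->
  (forall z, `|h z| <= A + B * sqnorm z) ->
  `|gauss_avg h| <= A + B * gauss_moment2 N.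
Proof.
move=> mh A0 B0 hAB.
have ih := gauss_integrable_bound mh A0 B0 hAB.
apply: (le_trans (le_normr_Rintegral _ ih)) => //.
have iA : gauss_integrable (fun _ : 'rV[R]_N => A).
  exact: (@gauss_integrable_bounded _ _ `|A|).
have iB : gauss_integrable (fun z : 'rV[R]_N => B * sqnorm z).
  have := integrableZl measurableT B (gauss_integrable_sqnorm N).
  by apply: eq_integrable => // z _; rewrite -EFinM mulrCA.
rewrite -[X in X + _](gauss_avg_cst N A).
rewrite [X in _ + X](_ : _ = gauss_avg (fun z : 'rV[R]_N => B * sqnorm z)).
  rewrite gauss_avgD//; apply: le_Rintegral => //.
  - by have := integrable_norm ih.
  - by apply: (@gauss_integrable_bound _ _ A B) => //;
      [apply: measurable_funD => //; apply: measurable_funM => //; exact: measurable_sqnorm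
      |move=> z; rewrite ger0_norm// addr_ge0 ?mulr_ge0 ?sqnorm_ge0].
  - move=> z _; rewrite normrM ger0_norm ?heat_kernel_ge0//.
    by rewrite ler_wpM2l ?heat_kernel_ge0.
rewrite /gauss_moment2 /gauss_avg -RintegralZl//; last exact: gauss_integrable_sqnorm.
by apply: eq_Rintegral => z _; rewrite mulrCA.
Qed.

Lemma measurable_gauss_shift N (f : 'rV[R]_N -> R) (x : 'rV[R]_N) (c : R) : measurable_fun setT f ->
  measurable_fun setT (fun z : 'rV[R]_N => f (x + c *: z)).
Proof. by move=> mf; apply: measurableT_comp => //; exact: measurable_rV_affine. Qed.

Lemma gauss_integrable_shift N (f : 'rV[R]_N -> R) (x : 'rV[R]_N) (c M : R) : measurable_fun setT f ->
  (forall y, `|f y| <= M) -> gauss_integrable (fun z : 'rV[R]_N => f (x + c *: z)).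
Proof.
move=> mf fM; apply: (@gauss_integrable_bounded _ _ M) => //.
exact: measurable_gauss_shift.
Qed.

Lemma heat_semigroup_avg N t (f : 'rV[R]_N -> R) (x : 'rV[R]_N) : 0 <= t ->
  measurable_fun setT f ->
  heat_semigroup t f x = gauss_avg (fun z : 'rV[R]_N => f (x + Num.sqrt t *: z)).
Proof. exact: heat_semigroupE. Qed.

Lemma heat_semigroup_bound N t (f : 'rV[R]_N -> R) (M : R) (x : 'rV[R]_N) : 0 <= t ->
  measurable_fun setT f -> (forall y, `|f y| <= M) -> `|heat_semigroup t f x| <= M.
Proof.
move=> t0 mf fM; have M0 : 0 <= M by exact: le_trans (normr_ge0 _) (fM 0).
rewrite heat_semigroup_avg//.
apply: le_trans (gauss_avg_bound (A:=M) (B:=0) _ _ _ _) _ => //.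
- exact: measurable_gauss_shift.
- by move=> z; rewrite mul0r addr0.
- by rewrite mul0r addr0.
Qed.

Lemma heat_semigroupB N t (f g : 'rV[R]_N -> R) (M : R) (x : 'rV[R]_N) : 0 <= t ->
  measurable_fun setT f -> (forall y, `|f y| <= M) ->
  measurable_fun setT g -> (forall y, `|g y| <= M) ->
  heat_semigroup t f x - heat_semigroup t g x = heat_semigroup t (fun y => f y - g y) x.
Proof.
move=> t0 mf fM mg gM; rewrite !heat_semigroup_avg//; last exact: measurable_funB.
by rewrite gauss_avgB//; exact: (@gauss_integrable_shift _ _ _ _ M).
Qed.

Lemma heat_semigroup_ge0 N t (f : 'rV[R]_N -> R) (x : 'rV[R]_N) : 0 <= t ->
  measurable_fun setT f -> (forall y, 0 <= f y) -> 0 <= heat_semigroup t f x.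
Proof.
move=> t0 mf f0; rewrite heat_semigroup_avg//; apply: Rintegral_ge0 => z _.
by rewrite mulr_ge0 ?heat_kernel_ge0.
Qed.

Lemma sqrtrB_sqr_le (a b : R) : 0 <= a -> 0 <= b ->
  (Num.sqrt a - Num.sqrt b) ^+ 2 <= `|a - b|.
Proof.
move=> a0 b0; wlog ba : a b a0 b0 / b <= a => [H|].
  have [ba|/ltW ab] := leP b a; first exact: H.
  by rewrite -sqrrN opprB distrC; exact: H.
have sba : Num.sqrt b <= Num.sqrt a by exact: ler_wsqrtr.
rewrite ger0_norm ?subr_ge0// -[X in _ <= X - _](sqr_sqrtr a0) -[X in _ <= _ - X](sqr_sqrtr b0).
rewrite subr_sqr expr2; apply: ler_wpM2l; first by rewrite subr_ge0.
by have := sqrtr_ge0 b; lra.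
Qed.

(** If x + sqrt a z and y + sqrt b z are not d-close, then |z| is at least
    d / (2 |sqrt a - sqrt b|), an event controlled by the second Gaussian
    moment. *)
Lemma heat_semigroup_modulus N (a b : R) (f g : 'rV[R]_N -> R) (x y : 'rV[R]_N) (M e d : R) :
  0 <= a -> 0 <= b -> measurable_fun setT f -> measurable_fun setT g ->
  (forall z, `|f z| <= M) -> (forall z, `|g z| <= M) -> 0 <= e -> 0 < d ->
  (forall x' y' : 'rV[R]_N, `|x' - y'| < d -> `|f x' - g y'| <= e) ->
  `|x - y| < d / 2 ->
  `|heat_semigroup a f x - heat_semigroup b g y| <=
    e + 8 * M * `|a - b| / d ^+ 2 * gauss_moment2 N.
Proof.
move=> a0 b0 mf mg fM gM e0 d0 fg xy.
have M0 : 0 <= M by exact: le_trans (normr_ge0 _) (fM 0).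
rewrite !heat_semigroup_avg// gauss_avgB; [|exact: (gauss_integrable_shift _ _ mf fM)|
  exact: (gauss_integrable_shift _ _ mg gM)].
apply: gauss_avg_bound => //.
- by apply: measurable_funB; exact: measurable_gauss_shift.
- by rewrite !mulr_ge0// invr_ge0 sqr_ge0.
move=> z; set p := x + _; set q := y + _.
have [pq|pq] := ltP `|p - q| d.
  rewrite (le_trans (fg _ _ pq))// lerDl.
  by rewrite !mulr_ge0 ?sqnorm_ge0// invr_ge0 sqr_ge0.
have h1 : d / 2 <= `|Num.sqrt a - Num.sqrt b| * `|z|.
  rewrite -normrZ.
  have : `|p - q| <= `|x - y| + `|(Num.sqrt a - Num.sqrt b) *: z|.
    by rewrite (_ : p - q = (x - y) + (Num.sqrt a - Num.sqrt b) *: z) ?ler_normD//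
      /p /q opprD addrACA scalerBl.
  by move: xy pq; lra.
have h2 : d ^+ 2 / 4 <= `|a - b| * sqnorm z.
  apply: (@le_trans _ _ ((`|Num.sqrt a - Num.sqrt b| * `|z|) ^+ 2)).
    rewrite (_ : d ^+ 2 / 4 = (d / 2) ^+ 2); last by field.
    have d20 : 0 <= d / 2 by rewrite divr_ge0// ltW.
    by rewrite ler_sqr ?nnegrE// mulr_ge0.
  rewrite exprMn ler_pM ?sqr_ge0 ?norm_le_sqnorm// real_normK ?num_real//.
  exact: sqrtrB_sqr_le.
have h3 : 1 <= 4 * `|a - b| / d ^+ 2 * sqnorm z.
  rewrite mulrAC ler_pdivlMr ?exprn_gt0// mul1r -mulrA.
  by rewrite -ler_pdivrMl// mulrC.
apply: (@le_trans _ _ (2 * M * 1)).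
  by rewrite mulr1 mulrDl mul1r (le_trans (ler_normB _ _))// lerD.
apply: (@le_trans _ _ (2 * M * (4 * `|a - b| / d ^+ 2 * sqnorm z))).
  by rewrite ler_wpM2l// mulr_ge0.
rewrite (_ : 2 * M * (4 * `|a - b| / d ^+ 2 * sqnorm z) =
  8 * M * `|a - b| / d ^+ 2 * sqnorm z); last by field; rewrite gt_eqF.
by rewrite lerDr.
Qed.

(** Far from the origin, either x + sqrt t z is still far, where f is small, or
    |z| >= |x| / (2 sqrt t), which the second moment makes rare. *)
Lemma heat_semigroup_decay N t (f : 'rV[R]_N -> R) (x : 'rV[R]_N) (M e r : R) :
  0 <= t -> measurable_fun setT f -> (forall z, `|f z| <= M) -> 0 <= e -> 0 < r ->
  (forall z : 'rV[R]_N, r <= `|z| -> `|f z| <= e) -> 2 * r <= `|x| ->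
  `|heat_semigroup t f x| <= e + 4 * M * t / `|x| ^+ 2 * gauss_moment2 N.
Proof.
move=> t0 mf fM e0 r0 fe xr.
have M0 : 0 <= M by exact: le_trans (normr_ge0 _) (fM 0).
have x0 : 0 < `|x| by apply: lt_le_trans xr; rewrite mulr_gt0.
rewrite heat_semigroup_avg//; apply: gauss_avg_bound => //.
- exact: measurable_gauss_shift.
- by rewrite !mulr_ge0// invr_ge0 sqr_ge0.
move=> z; have [zr|zr] := leP r `|x + Num.sqrt t *: z|.
  rewrite (le_trans (fe _ zr))// lerDl.
  by rewrite !mulr_ge0 ?sqnorm_ge0// invr_ge0 sqr_ge0.
have h1 : `|x| / 2 <= Num.sqrt t * `|z|.
  rewrite -(ger0_norm (sqrtr_ge0 t)) -normrZ.
  have : `|x| <= `|x + Num.sqrt t *: z| + `|Num.sqrt t *: z|.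
    by rewrite -{1}(addrK (Num.sqrt t *: z) x) ler_normB.
  by move: zr xr; lra.
have h2 : `|x| ^+ 2 / 4 <= t * sqnorm z.
  apply: (@le_trans _ _ ((Num.sqrt t * `|z|) ^+ 2)).
    rewrite (_ : `|x| ^+ 2 / 4 = (`|x| / 2) ^+ 2); last by field.
    by rewrite ler_sqr ?nnegrE// ?divr_ge0// mulr_ge0// sqrtr_ge0.
  by rewrite exprMn sqr_sqrtr// ler_wpM2l// norm_le_sqnorm.
apply: (@le_trans _ _ (M * 1)); first by rewrite mulr1.
apply: (@le_trans _ _ (M * (4 * t / `|x| ^+ 2 * sqnorm z))).
  rewrite ler_wpM2l// mulrAC ler_pdivlMr ?exprn_gt0// mul1r -mulrA.
  by rewrite -ler_pdivrMl// mulrC.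
rewrite (_ : M * (4 * t / `|x| ^+ 2 * sqnorm z) =
  4 * M * t / `|x| ^+ 2 * sqnorm z); last by field; rewrite normr_eq0 -normr_gt0.
by rewrite lerDr.
Qed.

End heat_kernel_theory.

(** * Continuous paths with values in C_0 *)

Section C0_path_theory.
Context {R : realType} {N : nat}.
Implicit Types (T : R) (g : R -> 'rV[R]_N -> R).

(** A continuous path [0, T] -> C_0(R^N), unfolded into the two uniform
    estimates that are preserved by all the operations on solutions. *)
Definition C0_path T g : Prop :=
  (forall e : R, 0 < e -> exists2 d : R, 0 < d &
     forall s t : R, 0 <= s <= T -> 0 <= t <= T -> `|s - t| < d ->
     forall x y : 'rV[R]_N, `|x - y| < d -> `|g s x - g t y| < e) /\
  (forall e : R, 0 < e -> exists2 M : R, 0 < M &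
     forall s : R, 0 <= s <= T -> forall x : 'rV[R]_N, M <= `|x| -> `|g s x| < e).

(** Lebesgue-number argument: local scales at the points of a compact set admit
    a common one. *)
Lemma compact_uniform (X : pseudoMetricType R) (K : set X) (P : X -> R -> Prop) :
  compact K ->
  (forall x, K x -> exists2 d : R, 0 < d &
     forall y, ball x d y -> K y -> forall i, 0 < i < d -> P y i) ->
  exists2 d : R, 0 < d & forall x, K x -> forall i, 0 < i < d -> P x i.
Proof.
move=> /compact_near_coveringP/near_covering_withinP cK H.
have : \forall i \near (0:R)^'+, K `<=` (fun x => P x i).
  apply: cK => x Kx; have [d d0 dH] := H x Kx.
  exists (ball x d, [set i | 0 < i < d]) => /=.
    split; first exact: nbhsx_ballx.
    near=> i; apply/andP; split; near: i; first exact: nbhs_right_gt.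
    exact: nbhs_right_lt.
  by move=> [y i] /= [xy id] Ky; exact: (dH y).
move=> [d /= d0 dH]; exists d => // x Kx i /andP[i0 id].
apply: (dH i) => //=; first by rewrite sub0r normrN gtr0_norm.
Unshelve. all: end_near. Qed.

Lemma compact_rV_ball (r : R) : compact [set x : 'rV[R]_N | `|x| <= r].
Proof.
have [r0|r0] := ltP r 0.
  rewrite (_ : [set _ | _] = set0); first exact: compact0.
  by apply/seteqP; split => // x /= /(le_trans (normr_ge0 _)); rewrite leNgt r0.
rewrite (_ : [set _ | _] =
    [set v : 'rV[R]_N | forall i, `[-r, r]%classic (v ord0 i)]).
  apply: (@rV_compact _ _ (fun=> `[-r, r]%classic)) => i; exact: segment_compact.
apply/seteqP; split => x /=.
  by move=> xr i; rewrite in_itv/= -ler_norml (le_trans (rV_coord_le_norm _ _)).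
move=> xr; rewrite /Num.norm/= mx_normrE; apply/bigmax_leP; split => // -[i j] _ /=.
by rewrite (ord1 i) ler_norml; have := xr j; rewrite in_itv.
Qed.

Lemma C0_unif_cont (f : 'rV[R]_N -> R) : C0 f ->
  forall e : R, 0 < e -> exists2 d : R, 0 < d &
    forall x y : 'rV[R]_N, `|x - y| < d -> `|f x - f y| < e.
Proof.
move=> [/continuous_rVP cf decay] e e0.
have [M HM] := decay (e / 2) (divr_gt0 e0 (ltr0n _ 2)).
have [d d0 dH] : exists2 d : R, 0 < d &
    forall x : 'rV[R]_N, [set x : 'rV[R]_N | `|x| <= M + 1] x -> forall i, 0 < i < d ->
    forall y, `|x - y| < i -> `|f x - f y| < e.
  apply: (@compact_uniform _ _ (fun x i => forall y, `|x - y| < i -> `|f x - f y| < e)).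
    exact: compact_rV_ball.
  move=> x _; have [d d0 dH] := cf x (e / 2) (divr_gt0 e0 (ltr0n _ 2)).
  exists (d / 2); first by rewrite divr_gt0.
  move=> y; rewrite -ball_normE /= => xy _ i /andP[i0 id] z yz.
  have xz : `|x - z| < d.
    by rewrite (splitr d) (le_lt_trans (ler_distD y _ _))// ltrD// (lt_trans yz).
  have xyd : `|x - y| < d by rewrite (lt_trans xy)// gtr_pMr// invf_lt1// ltr1n.
  rewrite (splitr e) (le_lt_trans (ler_distD (f x) _ _))// ltrD//; last exact: dH.
  by rewrite distrC; exact: dH.
exists (Num.min 1 (d / 2)); first by rewrite lt_min ltr01 divr_gt0.
move=> x y; rewrite lt_min => /andP[xy1 xyd].
have [xM|xM] := leP `|x| (M + 1).
  by apply: (dH x xM (d / 2)) => //; rewrite divr_gt0//= gtr_pMr// invf_lt1// ltr1n.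
rewrite (splitr e) (le_lt_trans (ler_normB _ _))// ltrD// HM//.
  by rewrite (le_trans _ (ltW xM))// lerDl.
have : `|x| <= `|y| + `|x - y| by rewrite -{1}(subrKC y x) ler_normD.
lra.
Qed.

(** Compactness of [0, T] upgrades continuity in time, for the sup norm, to
    estimates uniform in time. *)
Lemma C0_pathP T g : 0 <= T ->
  C0_path T g <->
  ((forall t, 0 <= t <= T -> C0 (g t)) /\
   (forall (t e : R), 0 <= t <= T -> 0 < e -> exists2 d : R, 0 < d &
      forall s : R, 0 <= s <= T -> `|t - s| < d -> forall x, `|g t x - g s x| < e)).
Proof.
move=> T0; split=> [[cg dg]|[C0g tg]].
  split=> [t tT|t e tT e0].
    split.
      apply/continuous_rVP => x e e0; have [d d0 H] := cg e e0.
      by exists d => // y xy; apply: H => //; rewrite subrr normr0.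
    by move=> e e0; have [M M0 H] := dg e e0; exists M => x; exact: H.
  have [d d0 H] := cg e e0; exists d => // s sT ts x; apply: H => //.
  by rewrite subrr normr0.
have cT := @segment_compact R 0 T.
split=> e e0; have e2 : 0 < e / 2 by rewrite divr_gt0.
- have [d1 d10 H1] : exists2 d : R, 0 < d & forall t : R, `[0, T]%classic t ->
      forall i, 0 < i < d -> forall s, 0 <= s <= T -> `|t - s| < i ->
      forall x, `|g t x - g s x| < e / 2.
    apply: (@compact_uniform _ _ (fun t i => forall s, 0 <= s <= T -> `|t - s| < i ->
      forall x, `|g t x - g s x| < e / 2)) => //.
    move=> t /=; rewrite in_itv/= => tT.
    have [d d0 H] := tg t (e / 2 / 2) tT (divr_gt0 e2 (ltr0n _ 2)).
    exists (d / 2); first by rewrite divr_gt0.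
    move=> r; rewrite -ball_normE /= => tr; rewrite in_itv/= => rT i /andP[i0 id] s sT rs x.
    have ts : `|t - s| < d.
      by rewrite (splitr d) (le_lt_trans (ler_distD r _ _))// ltrD// (lt_trans rs).
    have trd : `|t - r| < d by rewrite (lt_trans tr)// gtr_pMr// invf_lt1// ltr1n.
    rewrite (splitr (e / 2)) (le_lt_trans (ler_distD (g t x) _ _))// ltrD//; last exact: H.
    by rewrite distrC; exact: H.
  have [d2 d20 H2] : exists2 d : R, 0 < d & forall t : R, `[0, T]%classic t ->
      forall i, 0 < i < d -> forall x y, `|x - y| < i -> `|g t x - g t y| < e / 2.
    apply: (@compact_uniform _ _ (fun t i => forall x y, `|x - y| < i ->
      `|g t x - g t y| < e / 2)) => //.
    move=> t /=; rewrite in_itv/= => tT.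
    have e6 : 0 < e / 6 by rewrite divr_gt0.
    have [d d0 H] := tg t (e / 6) tT e6.
    have [d' d'0 H'] := C0_unif_cont (C0g t tT) e6.
    exists (Num.min d d'); first by rewrite lt_min d0.
    move=> r; rewrite -ball_normE /= lt_min => /andP[tr _]; rewrite in_itv/= => rT i /andP[i0].
    rewrite lt_min => /andP[_ id] x y xy.
    have A := H r rT tr x; have B := H r rT tr y.
    have C := H' x y (lt_trans xy id).
    rewrite distrC in A.
    rewrite (_ : g r x - g r y = (g r x - g t x) + (g t x - g t y) + (g t y - g r y)); last by ring.
    apply: (le_lt_trans (ler_normD _ _)).
    apply: (le_lt_trans (lerD (ler_normD _ _) (lexx _))); lra.
  exists (Num.min d1 d2 / 2); first by rewrite divr_gt0// lt_min d10.
  have dd : 0 < Num.min d1 d2 / 2 < Num.min d1 d2.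
    have m0 : 0 < Num.min d1 d2 by rewrite lt_min d10.
    by rewrite divr_gt0//= gtr_pMr// invf_lt1// ltr1n.
  move: dd; rewrite lt_min => /andP[dd0 /andP[dd1 dd2]] s t sT tT st x y xy.
  rewrite (splitr e) (le_lt_trans (ler_distD (g t x) _ _))// ltrD//.
    by apply: (H1 s _ (Num.min d1 d2 / 2)) => //=; rewrite ?in_itv//= ?dd0.
  by apply: (H2 t _ (Num.min d1 d2 / 2)) => //=; rewrite ?in_itv//= ?dd0.
- have [d d0 H] : exists2 d : R, 0 < d & forall t : R, `[0, T]%classic t ->
      forall i, 0 < i < d -> forall x : 'rV[R]_N, i^-1 <= `|x| -> `|g t x| < e.
    apply: (@compact_uniform _ _ (fun t i => forall x : 'rV[R]_N, i^-1 <= `|x| -> `|g t x| < e)) => //.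
    move=> t /=; rewrite in_itv/= => tT.
    have [d d0 H] := tg t (e / 2) tT e2.
    have [M HM] := (C0g t tT).2 (e / 2) e2.
    have M0 : 0 < Num.max M 1 by rewrite lt_max ltr01 orbT.
    exists (Num.min d (Num.max M 1)^-1); first by rewrite lt_min d0 invr_gt0.
    move=> r; rewrite -ball_normE /= lt_min => /andP[tr _]; rewrite in_itv/= => rT i /andP[i0].
    rewrite lt_min => /andP[_ iM] x ix.
    have A := H r rT tr x.
    have B : `|g t x| < e / 2.
      apply: HM; apply: le_trans ix.
      rewrite -[M]invrK; apply: (@le_trans _ _ (Num.max M 1)).
        by rewrite invrK le_max lexx.
      by rewrite -[leLHS]invrK lef_pV2 ?posrE ?invr_gt0// ltW.
    rewrite (_ : g r x = g t x - (g t x - g r x)); last by ring.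
    by rewrite (splitr e) (le_lt_trans (ler_normB _ _))// ltrD.
  exists (d / 2)^-1; first by rewrite invr_gt0 divr_gt0.
  move=> s sT x xd; apply: (H s _ (d / 2)) => //=.
  by rewrite divr_gt0//= gtr_pMr// invf_lt1// ltr1n.
Qed.

(** Outside a large ball the path is below 1; inside, (s, x) is joined to the
    origin by K steps shorter than the modulus of continuity for 1. *)
Lemma C0_path_bounded T g : 0 <= T -> C0_path T g ->
  exists2 M : R, 0 < M & forall s, 0 <= s <= T -> forall x, `|g s x| <= M.
Proof.
move=> T0 [cg dg].
have [d d0 H] := cg 1 ltr01; have [r r0 Hr] := dg 1 ltr01.
pose K := (Num.truncn ((T + r) / d)).+1.
have Kd : (T + r) / K%:R < d.
  rewrite ltr_pdivrMr ?ltr0n// -ltr_pdivrMl// mulrC.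
  exact: truncnS_gt.
have K0 : 0 < K%:R :> R by rewrite ltr0n.
have B0 : 0 < `|g 0 0| + K%:R + 1.
  by rewrite addr_gt0// ltr_wpDl.
exists (`|g 0 0| + K%:R + 1) => // s /andP[s0 sT] x.
have [rx|xr] := leP r `|x|.
  have := Hr s _ x rx; rewrite s0 sT => /(_ isT) gsx.
  by rewrite (le_trans (ltW gsx))// lerDr addr_ge0.
(* (0, 0) is joined to (s, x) by the points (k / K s, k / K x) *)
suff step k : (k <= K)%N -> `|g (k%:R / K%:R * s) ((k%:R / K%:R) *: x)| <= `|g 0 0| + k%:R.
  have := step K (leqnn _); rewrite divff ?gt_eqF// mul1r scale1r => /le_trans; apply.
  by rewrite lerDl.
have in01 j : (j <= K)%N -> 0 <= j%:R / K%:R * s <= T.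
  move=> jK; rewrite mulr_ge0 ?divr_ge0//=; apply: le_trans sT.
  by rewrite ler_piMl// ler_pdivrMr// mul1r ler_nat.
have diff j : (j.+1%:R / K%:R - j%:R / K%:R) = K%:R^-1 :> R.
  by rewrite -mulrBl -natrB// subSnn mul1r.
have sxd : (s + `|x|) / K%:R < d.
  by rewrite (le_lt_trans _ Kd)// ler_pM2r ?invr_gt0// lerD// ltW.
elim: k => [_|k IH kK].
  by rewrite !mul0r scale0r addr0.
have h1 : `|k.+1%:R / K%:R * s - k%:R / K%:R * s| < d.
  rewrite -(mulrBl s) diff ger0_norm ?mulr_ge0 ?invr_ge0//.
  by rewrite mulrC (le_lt_trans _ sxd)// ler_pM2r ?invr_gt0// lerDl.
have h2 : `|(k.+1%:R / K%:R) *: x - (k%:R / K%:R) *: x| < d.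
  rewrite -scalerBl diff normrZ ger0_norm ?invr_ge0//.
  by rewrite mulrC (le_lt_trans _ sxd)// ler_pM2r ?invr_gt0// lerDr.
have gd := H _ _ (in01 _ kK) (in01 _ (ltnW kK)) h1 _ _ h2.
have := IH (ltnW kK).
set A := g _ _ in gd *; set B := g _ _ in gd *.
have : `|A| <= `|A - B| + `|B| by rewrite -{1}(subrK B A) ler_normD.
by rewrite -natr1; lra.
Qed.

Lemma C0_path_le T T' g : T' <= T -> C0_path T g -> C0_path T' g.
Proof.
move=> TT [cg dg]; have sub s : 0 <= s <= T' -> 0 <= s <= T.
  by move=> /andP[-> /le_trans]; exact.
split=> e e0.
  have [d d0 H] := cg e e0; exists d => // s t /sub sT /sub tT; exact: H.
by have [M M0 H] := dg e e0; exists M => // s /sub sT; exact: H.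
Qed.

Lemma eq_C0_path T g h : (forall s, 0 <= s <= T -> forall x, g s x = h s x) ->
  C0_path T g -> C0_path T h.
Proof.
move=> gh [cg dg]; split=> e e0.
  have [d d0 H] := cg e e0; exists d => // s t sT tT st x y xy.
  by rewrite -!gh//; exact: H.
by have [M M0 H] := dg e e0; exists M => // s sT x; rewrite -gh//; exact: H.
Qed.

Lemma C0_path_cst T f : 0 <= T -> C0 f -> C0_path T (fun=> f).
Proof.
move=> T0 Cf; apply/C0_pathP => //; split => // t e _ e0.
by exists 1 => // s _ _ x; rewrite subrr normr0.
Qed.

Lemma C0_path0 T : C0_path T (fun _ _ => 0).
Proof. by split=> e e0; exists 1 => // *; rewrite ?subrr normr0. Qed.

Lemma C0_pathD T g h : C0_path T g -> C0_path T h ->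
  C0_path T (fun t x => g t x + h t x).
Proof.
move=> [cg dg] [ch dh]; split=> e e0; have e2 : 0 < e / 2 by rewrite divr_gt0.
  have [d d0 H] := cg _ e2; have [d' d'0 H'] := ch _ e2.
  exists (Num.min d d'); first by rewrite lt_min d0.
  move=> s t sT tT; rewrite lt_min => /andP[st st'] x y; rewrite lt_min => /andP[xy xy'].
  rewrite opprD addrACA (splitr e) (le_lt_trans (ler_normD _ _))// ltrD//.
    exact: H.
  exact: H'.
have [M M0 H] := dg _ e2; have [M' M'0 H'] := dh _ e2.
exists (Num.max M M'); first by rewrite lt_max M0.
move=> s sT x; rewrite ge_max => /andP[xM xM'].
by rewrite (splitr e) (le_lt_trans (ler_normD _ _))// ltrD//; [exact: H|exact: H'].
Qed.

Lemma C0_path_limit T g :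
  (forall e : R, 0 < e -> exists2 h, C0_path T h &
    forall s, 0 <= s <= T -> forall x, `|g s x - h s x| < e) -> C0_path T g.
Proof.
move=> gh; split=> e e0; have e3 : 0 < e / 3 by rewrite divr_gt0.
  have [h [ch _] H] := gh _ e3; have [d d0 dH] := ch _ e3.
  exists d => // s t sT tT st x y xy.
  have A := H s sT x; have B := H t tT y; have C := dH _ _ sT tT st _ _ xy.
  rewrite distrC in B.
  rewrite (_ : g s x - g t y = (g s x - h s x) + (h s x - h t y) + (h t y - g t y)); last by ring.
  apply: (le_lt_trans (ler_normD _ _)).
  apply: (le_lt_trans (lerD (ler_normD _ _) (lexx _))); lra.
have [h [_ dh] H] := gh _ e3; have [M M0 dH] := dh _ e3.
exists M => // s sT x Mx; have A := H s sT x; have B := dH _ sT _ Mx.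
rewrite (_ : g s x = (g s x - h s x) + h s x); last by ring.
by apply: (le_lt_trans (ler_normD _ _)); lra.
Qed.

Lemma C0_path_measurable T g t : C0_path T g -> 0 <= t <= T ->
  measurable_fun setT (g t).
Proof.
move=> [cg _] tT; apply: continuous_measurable_rV; apply/continuous_rVP => x e e0.
have [d d0 H] := cg e e0; exists d => // y xy; apply: H => //.
by rewrite subrr normr0.
Qed.

(** Freezing a path outside [0, T] makes it a path for all times, so that joint
    measurability can be obtained from continuity on the whole of R x R^N. *)
Definition clamp T (s : R) : R := Num.max 0 (Num.min s T).

Lemma clamp_itv T s : 0 <= T -> 0 <= clamp T s <= T.
Proof. by move=> T0; rewrite /clamp le_max lexx ge_max T0 ge_min lexx orbT. Qed.

Lemma clamp_id T s : 0 <= s <= T -> clamp T s = s.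
Proof. by move=> /andP[s0 sT]; rewrite /clamp (min_idPl sT) (max_idPr s0). Qed.

Lemma clamp_lip T s t : `|clamp T s - clamp T t| <= `|s - t|.
Proof.
wlog st : s t / t <= s => [H|].
  have [ts|/ltW st] := leP t s; first exact: H.
  by rewrite distrC (distrC s); exact: H.
have cst : clamp T t <= clamp T s.
  rewrite /clamp ge_max le_max lexx/= le_max; apply/orP; right.
  by rewrite le_min ge_min st ge_min lexx orbT.
rewrite !ger0_norm ?subr_ge0//.
rewrite /clamp /Num.max /Num.min /Order.max /Order.min; do ?case: ifPn => //; rewrite -?leNgt; lra.
Qed.

Lemma C0_path_clamp T g : 0 <= T -> C0_path T g ->
  forall T', C0_path T' (fun s => g (clamp T s)).
Proof.
move=> T0 [cg dg] T'; split=> e e0.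
  have [d d0 H] := cg e e0; exists d => // s t _ _ st; apply: H.
  - exact: clamp_itv.
  - exact: clamp_itv.
  - exact: le_lt_trans (clamp_lip _ _ _) st.
by have [M M0 H] := dg e e0; exists M => // s _; apply: H; exact: clamp_itv.
Qed.

End C0_path_theory.

(** * Singular time integrals *)

Section time_integrals.
Context {R : realType}.
Local Notation mu := (@lebesgue_measure R).

Lemma integral_powR_itv (k a b : R) : -1 < k -> 0 < a -> a < b ->
  (\int[mu]_(s in `[a, b]) (s `^ k)%:E = ((b `^ (k + 1) - a `^ (k + 1)) / (k + 1))%:E)%E.
Proof.
move=> k1 a0 ab; have k10 : 0 < k + 1 by lra.
have pos (x : R) : a <= x -> 0 < x by exact: lt_le_trans.
have dF (x : R) : 0 < x -> is_derive x 1 (fun s => (k + 1)^-1 * s `^ (k + 1)) (x `^ k).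
  move=> x0; have := is_deriveZ (k + 1)^-1 (is_derive1_powR (k + 1) x0).
  by rewrite addrK /GRing.scale/= mulrA mulVf ?gt_eqF// mul1r.
have cF (x : R) : 0 < x -> {for x, continuous (fun s => (k + 1)^-1 * s `^ (k + 1))}.
  move=> x0; apply: differentiable_continuous; apply/derivable1_diffP.
  by have [] := dF x x0.
rewrite (@continuous_FTC2 _ _ (fun s => (k + 1)^-1 * s `^ (k + 1)) a b ab).
- by rewrite -EFinB -mulrBr mulrC.
- apply/subspace_continuousP => x; rewrite /= in_itv/= => /andP[ax xb].
  apply: cvg_within_filter; apply: differentiable_continuous; apply/derivable1_diffP.
  by have [] := is_derive1_powR k (pos x ax).
- split.
  + by move=> x; rewrite in_itv/= => /andP[/ltW ax _]; have [] := dF x (pos x ax).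
  + by apply: cvg_at_right_filter; exact: cF.
  + by apply: cvg_at_left_filter; apply: cF; exact: lt_trans ab.
- move=> x; rewrite in_itv/= => /andP[/ltW ax _]; rewrite derive1E.
  by have [_] := dF x (pos x ax).
Qed.

Lemma measurable_powRn k : measurable_fun setT (fun s : measurableTypeR R => (s `^ k)%:E).
Proof. by apply/measurable_EFinP; exact: measurable_powR. Qed.

(** The singularity at 0 is integrable: exhaust ]0, t] by compact intervals. *)
Lemma integral_powR_le (k t : R) : -1 < k -> 0 <= t ->
  (\int[mu]_(s in `[0%R, t]) (s `^ k)%:E <= (t `^ (k + 1) / (k + 1))%:E)%E.
Proof.
move=> k1 t0; have k10 : 0 < k + 1 by lra.
have nn : 0 <= t `^ (k + 1) / (k + 1) by rewrite divr_ge0 ?powR_ge0// ltW.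
have [t00|tn0] := eqVneq t 0.
  by rewrite {1}t00 set_itv1 integral_set1 lee_fin.
have {tn0}tp : 0 < t by rewrite lt_neqAle eq_sym tn0.
rewrite -integral_itv_obnd_cbnd; last first.
  by apply: measurable_funTS; exact: measurable_powRn.
pose F n := `[t / n.+2%:R, t]%classic.
have FE : `]0, t]%classic = \bigcup_n F n.
  apply/seteqP; split => [x /=|x [n _]]; rewrite ?/F/= !in_itv/=; last first.
    by move=> /andP[nx ->]; rewrite andbT (lt_le_trans _ nx)// divr_gt0.
  move=> /andP[x0 xt]; exists (Num.truncn (t / x)) => //=; rewrite in_itv/= xt andbT.
  rewrite ler_pdivrMr// -ler_pdivrMl// mulrC.
  by rewrite ltW// (lt_trans (truncnS_gt _))// ltr_nat.
have ndF : nondecreasing_seq F.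
  apply/nondecreasing_seqP => n; rewrite subsetEset => x; rewrite /F/= !in_itv/= => /andP[nx ->].
  rewrite andbT (le_trans _ nx)// ler_pM2l// lef_pV2 ?posrE//.
  by rewrite ler_nat.
have := @ge0_nondecreasing_set_cvg_integral _ (measurableTypeR R) R F (fun s => (s `^ k)%:E) mu ndF.
rewrite -FE => cv.
have {}cv : (\int[mu]_(s in F n) (s `^ k)%:E)%E @[n --> \oo] --> (\int[mu]_(s in `]0%R, t]) (s `^ k)%:E)%E.
  apply: cv => //.
  - by move=> n; exact: measurable_itv.
  - by move=> n; apply: measurable_funTS; exact: measurable_powRn.
  - by move=> n x _; rewrite lee_fin powR_ge0.
rewrite -(cvg_lim _ cv)//; apply: lime_le; first by apply/cvg_ex; eexists; exact: cv.
apply: nearW => n; rewrite /F integral_powR_itv//.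
- by rewrite lee_fin ler_pM2r ?invr_gt0// gerBl powR_ge0.
- by rewrite divr_gt0.
- by rewrite ltr_pdivrMr// ltr_pMr// ltr1n.
Qed.

Lemma ge0_integral_itv_affine (c a t : R) (f : R -> R) : 0 < c -> 
  measurable_fun setT f -> (forall s, 0 <= f s) ->
  (\int[mu]_(s in `[a, (a + c * t)%R]) (f s)%:E = 
   c%:E * \int[mu]_(s in `[0%R, t]) (f (a + c * s)%R)%:E)%E.
Proof.
move=> c0 mf f0; rewrite integral_mkcond (@ge0_integral_affine _ c a)//.
- rewrite [in RHS]integral_mkcond; congr (_ * _)%E; apply: eq_integral => s _.
  rewrite !patchE; congr (if _ then _ else _).
  by apply/idP/idP; rewrite !inE/= !in_itv/= lerDl lerD2l pmulr_rge0// ler_pM2l.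
- apply/(measurable_restrictT _ _).1 => //.
  by apply/measurable_EFinP; exact: measurable_funTS.
- by move=> x; rewrite patchE; case: ifPn => // _; rewrite lee_fin.
Qed.

Lemma ge0_integral_oppr (f : R -> \bar R) : measurable_fun setT f ->
  (forall s, 0 <= f s)%E ->
  (\int[mu]_s f s = \int[mu]_s f (- s)%R)%E.
Proof.
move=> mf f0.
have mN : measurable_fun setT (-%R : measurableTypeR R -> measurableTypeR R).
  by apply: continuous_measurable_fun => x; apply: cvgN; exact: cvg_id.
transitivity (\int[pushforward mu (-%R : _ -> measurableTypeR R)]_s f s)%E.
  by apply: eq_measure_integral => A mA _; rewrite -[LHS]lebesgue_measureN.
by rewrite (ge0_integral_pushforward mN).
Qed.

Lemma ge0_integral_itv_reverse (t : R) (f : R -> R) :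
  measurable_fun setT f -> (forall s, 0 <= f s) ->
  (\int[mu]_(s in `[0%R, t]) (f (t - s)%R)%:E = \int[mu]_(s in `[0%R, t]) (f s)%:E)%E.
Proof.
move=> mf f0; rewrite [RHS]integral_mkcond [LHS]integral_mkcond.
have mfr (A : set R) : measurable A -> measurable_fun setT ((fun s => (f s)%:E) \_ A).
  move=> mA; apply/(measurable_restrictT _ _).1 => //.
  by apply/measurable_EFinP; exact: measurable_funTS.
have fr0 (A : set R) s : (0 <= ((fun s => (f s)%:E) \_ A) s)%E.
  by rewrite patchE; case: ifPn => // _; rewrite lee_fin.
rewrite [RHS](@ge0_integral_affine _ 1 t)//; last exact: mfr.
rewrite mul1e ge0_integral_oppr//.
- apply: eq_integral => s _; rewrite !patchE mul1r; congr (if _ then _ else _).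
  by apply/idP/idP; rewrite !inE/= !in_itv/= => /andP[A B]; apply/andP; split; lra.
- apply: (measurableT_comp (mfr _ (measurable_itv `[0, t]))).
  apply: continuous_measurable_fun => x; apply: cvgD; first exact: cvg_cst.
  by apply: cvgM; [exact: cvg_cst|exact: cvg_id].
Qed.

Lemma measurable_powR_shift (k a : R) :
  measurable_fun setT (fun s : measurableTypeR R => ((a + 1 * s) `^ k)%:E).
Proof.
apply/measurable_EFinP; apply: (measurableT_comp (measurable_powR k)).
apply: continuous_measurable_fun => x; apply: cvgD; first exact: cvg_cst.
by apply: cvgM; [exact: cvg_cst|exact: cvg_id].
Qed.

(** Among the intervals of a given length the one starting at 0 carries the most
    mass, since s ^ k decreases. *)
Lemma integral_powR_sub_le (k a b : R) : -1 < k <= 0 -> 0 <= a <= b ->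
  (\int[mu]_(s in `[a, b]) (s `^ k)%:E <= ((b - a) `^ (k + 1) / (k + 1))%:E)%E.
Proof.
move=> /andP[k1 k0] /andP[a0 ab].
have ba0 : 0 <= b - a by rewrite subr_ge0.
apply: le_trans (integral_powR_le k1 ba0).
rewrite {1}(_ : b = a + 1 * (b - a)); last by ring.
rewrite (@ge0_integral_itv_affine 1 a (b - a) (fun s => s `^ k))//; last first.
  by move=> s; exact: powR_ge0.
rewrite mul1e -!integral_itv_obnd_cbnd; first last.
- by apply: measurable_funTS; exact: measurable_powR_shift.
- by apply: measurable_funTS; exact: measurable_powRn.
apply: ge0_le_integral => //.
- by move=> x _; rewrite lee_fin powR_ge0.
- by apply: measurable_funTS; exact: measurable_powR_shift.
- by apply: measurable_funTS; exact: measurable_powRn.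
- move=> s; rewrite /= in_itv/= => /andP[s0 _]; rewrite lee_fin mul1r.
  rewrite -(opprK k) !(powRN _ (- k)) lef_pV2 ?posrE ?powR_gt0//; last by rewrite ltr_wpDl.
  by rewrite ge0_ler_powR ?nnegrE ?oppr_ge0 ?lerDr// ?addr_ge0// ltW.
Qed.

Lemma integral_expR_le (l t : R) : 0 < l -> 0 <= t ->
  (\int[mu]_(s in `[0%R, t]) (expR (l * s))%:E <= (expR (l * t) / l)%:E)%E.
Proof.
move=> l0 t0.
have nn : 0 <= expR (l * t) / l by rewrite divr_ge0 ?expR_ge0// ltW.
have [t00|tn0] := eqVneq t 0.
  by rewrite {1}t00 set_itv1 integral_set1 lee_fin.
have {tn0}tp : 0 < t by rewrite lt_neqAle eq_sym tn0.
have dF (x : R) : is_derive x 1 (fun s => l^-1 * expR (l * s)) (expR (l * x)).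
  have h : is_derive x 1 (fun s : R => l * s) l.
    have := is_deriveZ l (is_derive_id x (1:R)).
    by rewrite /GRing.scale/= mulr1.
  have h2 := is_derive1_comp (is_derive_expR (l * x)) h.
  have := is_deriveZ l^-1 h2.
  by rewrite /GRing.scale/= mulrCA mulVf ?gt_eqF// mulr1.
have cF (x : R) : {for x, continuous (fun s => l^-1 * expR (l * s))}.
  apply: differentiable_continuous; apply/derivable1_diffP.
  by have [] := dF x.
rewrite (@continuous_FTC2 _ _ (fun s => l^-1 * expR (l * s)) 0 t tp).
- by rewrite -EFinB lee_fin mulrC gerBl mulr0 expR0 mulr1 invr_ge0 ltW.
- apply: continuous_subspaceT => x; apply: (continuous_comp (f := fun s : R => l * s)).
    by apply: cvgM; [exact: cvg_cst|exact: cvg_id].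
  exact: continuous_expR.
- split.
  + by move=> x _; have [] := dF x.
  + by apply: cvg_at_right_filter; exact: cF.
  + by apply: cvg_at_left_filter; exact: cF.
- by move=> x _; rewrite derive1E; have [_] := dF x.
Qed.

End time_integrals.

(** * Duhamel integrals *)

Section duhamel.
Context {R : realType} {N : nat}.
Implicit Types (T t : R) (g : R -> 'rV[R]_N -> R).
Local Notation mu := (@lebesgue_measure R).

Lemma heat_path_modulus T g : 0 <= T -> C0_path T g ->
  forall e : R, 0 < e -> exists2 d : R, 0 < d &
    forall s s' a b : R, 0 <= s <= T -> 0 <= s' <= T -> 0 <= a -> 0 <= b ->
      `|s - s'| < d -> `|a - b| < d -> forall x y : 'rV[R]_N, `|x - y| < d ->
      `|heat_semigroup a (g s) x - heat_semigroup b (g s') y| < e.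
Proof.
move=> T0 gT e e0; have [M M0 gM] := C0_path_bounded T0 gT.
have e2 : 0 < e / 2 by rewrite divr_gt0.
have [d d0 H] := gT.1 _ e2.
pose C := 8 * M / d ^+ 2 * @gauss_moment2 R N.
have C0 : 0 <= C.
  rewrite mulr_ge0 ?gauss_moment2_ge0// mulr_ge0 ?invr_ge0 ?sqr_ge0//.
  by rewrite mulr_ge0 ?ltW.
have C1 : 0 < C + 1 by rewrite ltr_wpDl.
exists (Num.min (d / 2) (e / 2 / (C + 1))).
  by rewrite lt_min !divr_gt0.
move=> s s' a b sT s'T a0 b0; rewrite !lt_min => /andP[ss _] /andP[_ ab] x y; rewrite !lt_min => /andP[xy _].
apply: (@le_lt_trans _ _ (e / 2 + 8 * M * `|a - b| / d ^+ 2 * @gauss_moment2 R N)).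
  apply: heat_semigroup_modulus => //.
  - exact: (C0_path_measurable gT).
  - exact: (C0_path_measurable gT).
  - by move=> z; exact: gM.
  - by move=> z; exact: gM.
  - exact: ltW.
  - move=> x' y' xy'; apply/ltW/H => //.
    by rewrite (lt_trans ss)// gtr_pMr// invf_lt1// ltr1n.
rewrite (_ : 8 * M * `|a - b| / d ^+ 2 * @gauss_moment2 R N = C * `|a - b|); last by rewrite /C; ring.
rewrite [ltRHS]splitr ltrD2l; move: ab; rewrite ltr_pdivlMr// => ab.
by rewrite (le_lt_trans _ ab)// mulrC ler_wpM2l// lerDl.
Qed.

Lemma heat_path_decay T A g : 0 <= T -> 0 <= A -> C0_path T g ->
  forall e : R, 0 < e -> exists2 r : R, 0 < r &
    forall s a : R, 0 <= s <= T -> 0 <= a <= A -> forall x : 'rV[R]_N, r <= `|x| ->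
      `|heat_semigroup a (g s) x| < e.
Proof.
move=> T0 A0 gT e e0; have [M M0 gM] := C0_path_bounded T0 gT.
have e2 : 0 < e / 2 by rewrite divr_gt0.
have [r r0 H] := gT.2 _ e2.
pose C := 4 * M * A * @gauss_moment2 R N.
have C0 : 0 <= C by rewrite !mulr_ge0 ?gauss_moment2_ge0// ltW.
have C1 : 0 < C + 1 by rewrite ltr_wpDl.
pose r' := (C + 1) / (e / 2) + 1.
have r'1 : 1 <= r' by rewrite /r' lerDr divr_ge0// ltW.
exists (Num.max (2 * r) r'); first by rewrite lt_max mulr_gt0.
move=> s a sT /andP[a0 aA] x; rewrite ge_max => /andP[rx r'x].
have x1 : 1 <= `|x| by exact: le_trans r'x.
have x0 : 0 < `|x| by exact: lt_le_trans x1.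
apply: (@le_lt_trans _ _ (e / 2 + 4 * M * a / `|x| ^+ 2 * @gauss_moment2 R N)).
  apply: (@heat_semigroup_decay _ _ _ _ _ _ _ r) => //.
  - exact: (C0_path_measurable gT).
  - by move=> z; exact: gM.
  - exact: ltW.
  - by move=> z rz; apply/ltW/H.
rewrite [ltRHS]splitr ltrD2l.
rewrite (_ : 4 * M * a / `|x| ^+ 2 * @gauss_moment2 R N =
  (4 * M * a * @gauss_moment2 R N) / `|x| ^+ 2); last by ring.
rewrite ltr_pdivrMr ?exprn_gt0//.
have aC : 4 * M * a * @gauss_moment2 R N <= C.
  by rewrite /C ler_wpM2r ?gauss_moment2_ge0// ler_wpM2l// mulr_ge0// ltW.
have xx : `|x| <= `|x| ^+ 2 by rewrite expr2 ler_peMr.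
have : C + 1 < e / 2 * `|x|.
  by rewrite -ltr_pdivrMl// mulrC (lt_le_trans _ r'x)// /r' ltrDl.
have : e / 2 * `|x| <= e / 2 * `|x| ^+ 2 by rewrite ler_wpM2l// ltW.
lra.
Qed.

Lemma heat_path_bound T g M a s x : C0_path T g -> 0 <= s <= T -> 0 <= a ->
  (forall s, 0 <= s <= T -> forall x, `|g s x| <= M) ->
  `|heat_semigroup a (g s) x| <= M.
Proof.
move=> gT sT a0 gM; apply: heat_semigroup_bound => //.
  exact: (C0_path_measurable gT).
by move=> y; exact: gM.
Qed.

Lemma heat_semigroup_C0_path T (f : 'rV[R]_N -> R) : 0 <= T -> C0 f ->
  C0_path T (fun t => heat_semigroup t f).
Proof.
move=> T0 Cf; have fT := C0_path_cst T0 Cf.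
split=> e e0.
  have [d d0 H] := heat_path_modulus T0 fT e0; exists d => // s t /andP[s0 sT] /andP[t0 tT] st x y xy.
  by apply: (H 0 0) => //; rewrite ?lexx ?T0// subrr normr0.
have [r r0 H] := heat_path_decay T0 T0 fT e0; exists r => // s sT x rx.
by apply: (H 0) => //; rewrite ?lexx.
Qed.

(** The integrand of Duhamel's formula, frozen outside [0, t], is jointly
    continuous, hence jointly measurable. *)
Lemma heat_path_measurable2 T g (t a : R) : C0_path T g -> 0 <= t <= T -> t <= a ->
  measurable_fun setT (fun z : measurableTypeR R * 'rV[R]_N =>
    heat_semigroup (a - clamp t z.1) (g (clamp t z.1)) z.2).
Proof.
move=> gT /andP[t0 tT] ta.
apply: (@continuous_measurable_prod _ _ (fun s => heat_semigroup (a - clamp t s) (g (clamp t s)))).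
move=> s x e e0.
have [d d0 H] := heat_path_modulus t0 (C0_path_le tT gT) e0; exists d => // s' x' ss xx.
have /andP[? ?] := clamp_itv s t0; have /andP[? ?] := clamp_itv s' t0.
apply: H => //; [exact: clamp_itv|exact: clamp_itv| | | | ].
- by lra.
- by lra.
- exact: le_lt_trans (clamp_lip _ _ _) ss.
- rewrite (_ : _ - _ = clamp t s' - clamp t s); last by ring.
  by rewrite distrC; exact: le_lt_trans (clamp_lip _ _ _) ss.
Qed.

Lemma heat_path_measurable T g (t a : R) x : C0_path T g -> 0 <= t <= T -> t <= a ->
  measurable_fun `[0, t] (fun s : measurableTypeR R => heat_semigroup (a - s) (g s) x).
Proof.
move=> gT tT ta.
have m : measurable_fun setT (fun s : measurableTypeR R =>
    heat_semigroup (a - clamp t s) (g (clamp t s)) x).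
  exact: (measurableT_comp (heat_path_measurable2 gT tT ta)
    (measurable_pair2 x)).
apply: (eq_measurable_fun (fun s => heat_semigroup (a - clamp t s) (g (clamp t s)) x)).
  by move=> s; rewrite inE/= in_itv/= => st; rewrite clamp_id.
exact: measurable_funTS.
Qed.

(** The time integrals use the measurable structure of the Borel copy of R, which
    the segment lemmas fix once and for all. *)
Lemma measurable_segment (a b : R) : measurable (`[a, b]%classic : set (measurableTypeR R)).
Proof. exact: measurable_itv. Qed.

Lemma segment_le_integrable (a b : R) (f h : R -> R) :
  measurable_fun `[a, b] f -> (forall s, a <= s <= b -> `|f s| <= h s) ->
  mu.-integrable `[a, b] (fun s => (h s)%:E) ->
  mu.-integrable `[a, b] (fun s => (f s)%:E).
Proof.
move=> mf fh; apply: (le_integrable (measurable_segment a b)).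
  exact/measurable_EFinP.
move=> s; rewrite /= in_itv/= => sab; rewrite lee_fin.
by rewrite (le_trans (fh s sab))// ler_norm.
Qed.

Lemma segment_integrableZl (a b c : R) (f : R -> R) :
  mu.-integrable `[a, b] (fun s => (f s)%:E) ->
  mu.-integrable `[a, b] (fun s => (c * f s)%:E).
Proof.
exact: (integrableZl (measurable_segment a b) c).
Qed.

Lemma segment_integrableB (a b : R) (f h : R -> R) :
  mu.-integrable `[a, b] (fun s => (f s)%:E) ->
  mu.-integrable `[a, b] (fun s => (h s)%:E) ->
  mu.-integrable `[a, b] (fun s => (f s - h s)%:E).
Proof.
move=> fi hi; exact: (integrableB (measurable_segment a b) fi hi).
Qed.

Lemma integrable_powR (k t : R) : -1 < k -> 0 <= t ->
  mu.-integrable `[0, t] (fun s => (s `^ k)%:E).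
Proof.
move=> k1 t0; apply/integrableP; split.
  by apply: measurable_funTS; exact: measurable_powRn.
apply: le_lt_trans (ltry (t `^ (k + 1) / (k + 1))).
apply: le_trans (integral_powR_le k1 t0).
by under eq_integral do rewrite /= ger0_norm ?powR_ge0//.
Qed.

Lemma integrable_powRM (k t M : R) (h : R -> R) : -1 < k -> 0 <= t ->
  measurable_fun `[0, t] h -> (forall s, 0 <= s <= t -> `|h s| <= M) ->
  mu.-integrable `[0, t] (fun s => (s `^ k * h s)%:E).
Proof.
move=> k1 t0 mh hM.
have M0 : 0 <= M by rewrite (le_trans (normr_ge0 (h 0)))// hM// lexx.
apply: (@segment_le_integrable _ _ _ (fun s => M * s `^ k)).
- apply: measurable_funM => //.
  by apply: measurable_funTS; exact: measurable_powR.
- move=> s st; rewrite normrM mulrC (ger0_norm (powR_ge0 _ _)).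
  by rewrite ler_wpM2r ?powR_ge0// hM.
- by apply: segment_integrableZl; exact: integrable_powR.
Qed.

(** Weighted Duhamel integrals: k = 0 gives the nonlinear term and k = sigma
    the forcing term. *)
Definition duhamel (k : R) g (t : R) (x : 'rV[R]_N) : R :=
  \int[mu]_(s in `[0, t]) (s `^ k * heat_semigroup (t - s) (g s) x).

Lemma integrable_duhamel T (k t a : R) g x : -1 < k -> C0_path T g -> 0 <= t <= T -> t <= a ->
  mu.-integrable `[0, t] (fun s => (s `^ k * heat_semigroup (a - s) (g s) x)%:E).
Proof.
move=> k1 gT tT ta; have /andP[t0 tT'] := tT; have T0 := le_trans t0 tT'.
have [M M0 gM] := C0_path_bounded T0 gT.
apply: (@integrable_powRM _ _ M) => //; first exact: (heat_path_measurable _ gT).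
move=> s /andP[s0 st]; apply: (heat_path_bound _ gT) => //.
  by rewrite s0 (le_trans st).
by rewrite subr_ge0 (le_trans st).
Qed.

Lemma Rintegral_powR_bound (k a b M : R) (h : R -> R) : -1 < k -> 0 <= a -> a <= b -> 0 <= M ->
  mu.-integrable `[a, b] (fun s => (s `^ k * h s)%:E) ->
  (forall s, a <= s <= b -> `|h s| <= M) ->
  `|\int[mu]_(s in `[a, b]) (s `^ k * h s)| <= M * \int[mu]_(s in `[a, b]) (s `^ k).
Proof.
move=> k1 a0 ab M0 ih hM.
have ik : mu.-integrable `[a, b] (fun s => (s `^ k)%:E).
  apply: integrableS (integrable_powR k1 (le_trans a0 ab)) => //.
  by move=> s /=; rewrite !in_itv/= => /andP[/(le_trans a0) -> ->].
apply: (le_trans (le_normr_Rintegral _ ih)) => //.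
rewrite -RintegralZl//; apply: le_Rintegral => //.
- exact: integrable_norm ih.
- exact: segment_integrableZl ik.
- move=> s; rewrite /= in_itv/= => sab; rewrite normrM mulrC (ger0_norm (powR_ge0 _ _)).
  by rewrite ler_wpM2r ?powR_ge0// hM.
Qed.

Lemma Rintegral_powR_le (k t : R) : -1 < k -> 0 <= t ->
  \int[mu]_(s in `[0, t]) (s `^ k) <= t `^ (k + 1) / (k + 1).
Proof.
move=> k1 t0; rewrite /Rintegral -lee_fin fineK ?integral_powR_le//.
by apply: integrable_fin_num => //; exact: integrable_powR.
Qed.

Lemma Rintegral_powR_sub_le (k a b : R) : -1 < k <= 0 -> 0 <= a <= b ->
  \int[mu]_(s in `[a, b]) (s `^ k) <= (b - a) `^ (k + 1) / (k + 1).
Proof.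
move=> k10 ab0; have /andP[k1 _] := k10; have /andP[a0 ab] := ab0.
rewrite /Rintegral -lee_fin fineK ?integral_powR_sub_le//.
apply: integrable_fin_num => //.
apply: integrableS (integrable_powR k1 (le_trans a0 ab)) => //.
by move=> s /=; rewrite !in_itv/= => /andP[/(le_trans a0) -> ->].
Qed.

Lemma Rintegral_itv_split (a b c : R) (h : R -> R) : a <= b -> b <= c ->
  mu.-integrable `[a, c] (EFin \o h) ->
  \int[mu]_(s in `[a, c]) h s =
  \int[mu]_(s in `[a, b]) h s + \int[mu]_(s in `[b, c]) h s.
Proof.
move=> ab bc ih.
rewrite -(@Rintegral_itv_obnd_cbnd _ b (BRight c)); last first.
  apply: integrableS ih => // s; rewrite /= !in_itv/= => /andP[bs ->].
  by rewrite (le_trans ab)// ltW.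
rewrite -Rintegral_setU//.
- congr Rintegral; apply/seteqP; split => s /=; rewrite !in_itv/=.
    by move=> /andP[as_ sc]; have [sb|sb] := leP s b; [left; rewrite as_|right].
  move=> [/andP[-> /le_trans->//]|/andP[bs ->]].
  by rewrite (le_trans ab)// ltW.
- apply: integrableS ih => //; first exact: measurableU.
  move=> s /= [|]; rewrite !in_itv/=; first by move=> /andP[-> /le_trans->].
  by move=> /andP[bs ->]; rewrite (le_trans ab)// ltW.
- rewrite disj_set2E; apply/eqP; rewrite -subset0 => s/= [].
  by rewrite !in_itv/= => /andP[_ sb] /andP[]; rewrite ltNge sb.
Qed.

Lemma duhamel_bound T (k t M : R) g x : -1 < k -> C0_path T g -> 0 <= t <= T -> 0 <= M ->
  (forall s, 0 <= s <= t -> forall x, `|g s x| <= M) ->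
  `|duhamel k g t x| <= M * (t `^ (k + 1) / (k + 1)).
Proof.
move=> k1 gT tT M0 gM; have /andP[t0 tT'] := tT.
apply: (le_trans (Rintegral_powR_bound (M := M) k1 (lexx _) t0 _ _ _)) => //.
- exact: (integrable_duhamel _ k1 gT).
- move=> s /andP[s0 st]; apply: (heat_path_bound _ (C0_path_le tT' gT)) => //.
    by rewrite s0.
  by rewrite subr_ge0.
- by rewrite ler_wpM2l// Rintegral_powR_le.
Qed.

(** Between times s <= t the common part [0, s] is compared through the modulus
    of heat_path_modulus, and the part [s, t] is short. *)
Lemma duhamel_C0_path T (k : R) g : -1 < k <= 0 -> 0 <= T -> C0_path T g ->
  C0_path T (duhamel k g).
Proof.
move=> k10 T0 gT; have /andP[k1 k0] := k10.
have kp : 0 < k + 1 by lra.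
have [M M0 gM] := C0_path_bounded T0 gT.
pose W := T `^ (k + 1) / (k + 1) + 1.
have W0 : 0 < W by rewrite ltr_wpDl// divr_ge0 ?powR_ge0// ltW.
have Wt t : 0 <= t <= T -> \int[mu]_(s in `[0, t]) (s `^ k) <= W.
  move=> /andP[t0 tT]; apply: (le_trans (Rintegral_powR_le k1 t0)).
  rewrite /W ler_wpDr// ler_pM2r ?invr_gt0// ge0_ler_powR ?nnegrE// ltW//.
split=> e e0; have e2 : 0 < e / 2 by rewrite divr_gt0.
- have [d d0 H] := heat_path_modulus T0 gT (divr_gt0 e2 W0).
  (* the solution of M d' ^ (k + 1) / (k + 1) = e / 2, so that [s, t] contributes
     less than e / 2 *)
  pose d' := (e / 2 * (k + 1) / M) `^ ((k + 1)^-1).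
  have q0 : 0 < e / 2 * (k + 1) / M by rewrite !divr_gt0 ?mulr_gt0.
  have d'0 : 0 < d' by exact: powR_gt0.
  exists (Num.min d d'); first by rewrite lt_min d0.
  have main s t (x y : 'rV[R]_N) : 0 <= s <= T -> 0 <= t <= T -> s <= t ->
      `|s - t| < Num.min d d' -> `|x - y| < Num.min d d' ->
      `|duhamel k g s x - duhamel k g t y| < e.
    move=> sT tT st; rewrite !lt_min => /andP[std std'] /andP[xy _].
    have /andP[s0 sT'] := sT; have /andP[t0 tT'] := tT.
    have it := integrable_duhamel y k1 gT tT (lexx t).
    rewrite /duhamel (Rintegral_itv_split s0 st it) opprD addrA.
    have is1 := integrable_duhamel x k1 gT sT (lexx s).
    have is2 := integrable_duhamel y k1 gT sT st.
    rewrite -RintegralB//.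
    rewrite (_ : \int[_]_(x0 in _) _ = \int[mu]_(r in `[0, s]) (r `^ k *
      (heat_semigroup (s - r) (g r) x - heat_semigroup (t - r) (g r) y))); last first.
      by apply: eq_Rintegral => r _; rewrite mulrBr.
    rewrite (splitr e) (le_lt_trans (ler_normB _ _))// ler_ltD//.
      apply: (le_trans (Rintegral_powR_bound (M := e / 2 / W) k1 (lexx _) s0 _ _ _)) => //.
      + by rewrite divr_ge0// ltW.
      + have := segment_integrableB is1 is2; congr (integrable _ _ _).
        by apply/funext => r; rewrite mulrBr.
      + move=> r /andP[r0 rs]; apply/ltW/H => //.
        * by rewrite r0 (le_trans rs).
        * by rewrite r0 (le_trans rs).
        * by rewrite subr_ge0.
        * by rewrite subr_ge0 (le_trans rs).
        * by rewrite subrr normr0.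
        * by rewrite (_ : _ - _ = s - t)//; ring.
      + apply: (le_trans (ler_wpM2l _ (Wt s sT))); first by rewrite divr_ge0// ltW.
        by rewrite divfK// gt_eqF.
    apply: (@le_lt_trans _ _ (M * ((t - s) `^ (k + 1) / (k + 1)))).
      apply: (le_trans (Rintegral_powR_bound (M := M) k1 s0 st _ _ _)) => //.
      + exact: ltW.
      + apply: integrableS it => // r /=; rewrite !in_itv/= => /andP[sr ->].
        by rewrite (le_trans s0).
      + move=> r /andP[sr rt]; apply: (heat_path_bound _ gT) => //.
          by rewrite (le_trans s0)//= (le_trans rt).
        by rewrite subr_ge0.
      + by rewrite ler_wpM2l ?(ltW M0)// Rintegral_powR_sub_le// s0.
    rewrite mulrA ltr_pdivrMr// mulrC -ltr_pdivlMr//.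
    have -> : e / 2 * (k + 1) / M = d' `^ (k + 1).
      by rewrite /d' -powRrM mulVf ?gt_eqF// powRr1// ltW.
    rewrite gt0_ltr_powR ?nnegrE ?subr_ge0// ?(ltW d'0)//.
    by move: std'; rewrite distrC ger0_norm// subr_ge0.
  move=> s t sT tT st x y xy; have [le|/ltW le] := leP s t; first exact: main.
  by rewrite distrC; apply: main => //; rewrite distrC.
- have [r r0 H] := heat_path_decay T0 T0 gT (divr_gt0 e2 W0).
  exists r => // t tT x rx; have /andP[t0 tT'] := tT.
  apply: (@le_lt_trans _ _ (e / 2)); last by rewrite gtr_pMr// invf_lt1// ltr1n.
  apply: (le_trans (Rintegral_powR_bound (M := e / 2 / W) k1 (lexx _) t0 _ _ _)) => //.
  + by rewrite divr_ge0// ltW.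
  + exact: (integrable_duhamel _ k1 gT).
  + move=> s /andP[s0 st]; apply/ltW/H => //.
      by rewrite s0 (le_trans st).
    by rewrite subr_ge0 st (le_trans _ tT')// gerBl.
  + apply: (le_trans (ler_wpM2l _ (Wt t tT))); first by rewrite divr_ge0// ltW.
    by rewrite divfK// gt_eqF.
Qed.

End duhamel.

(** * Powers and geometric convergence *)

Section powers.
Context {R : realType}.

(** Convexity of the power, as Young's inequality for b and a ^ (p - 1). *)
Lemma powR_tangent (p a b : R) : 1 < p -> 0 <= a -> 0 <= b ->
  a `^ p + p * a `^ (p - 1) * (b - a) <= b `^ p.
Proof.
move=> p1 a0 b0; have p0 : 0 < p by lra.
have pm : 0 < p - 1 by lra.
have q0 : 0 < p / (p - 1) by rewrite divr_gt0.
have pq : p^-1 + (p / (p - 1))^-1 = 1 by field; rewrite !gt_eqF.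
have := conjugate_powR b0 (powR_ge0 a (p - 1)) p0 q0 pq.
rewrite -powRrM (_ : (p - 1) * (p / (p - 1)) = p); last by field; rewrite gt_eqF.
rewrite -(ler_pM2l p0) mulrDr mulrC.
rewrite (_ : p * (b `^ p / p) = b `^ p); last by field; rewrite gt_eqF.
rewrite (_ : p * (a `^ p / (p / (p - 1))) = (p - 1) * a `^ p); last by field; rewrite !gt_eqF.
have := mulr_powRB1 a0 p0; set A := a `^ (p - 1) => <-.
lra.
Qed.

Lemma powR_lipschitz (p a b M : R) : 1 < p -> 0 <= a <= M -> 0 <= b <= M ->
  `|a `^ p - b `^ p| <= p * M `^ (p - 1) * `|a - b|.
Proof.
move=> p1; wlog ba : a b / b <= a => [H aM bM|/andP[a0 aM] /andP[b0 bM]].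
  have [ba|/ltW ab] := leP b a; first exact: H.
  by rewrite distrC (distrC a); exact: H.
have p0 : 0 < p by lra.
rewrite !ger0_norm ?subr_ge0//; last by rewrite ge0_ler_powR ?nnegrE// ltW.
have := powR_tangent p1 a0 b0.
have h : a `^ (p - 1) <= M `^ (p - 1).
  have pm : 0 <= p - 1 by lra.
  by rewrite ge0_ler_powR// nnegrE// (le_trans a0).
have : p * a `^ (p - 1) * (a - b) <= p * M `^ (p - 1) * (a - b).
  by rewrite ler_wpM2r ?subr_ge0// ler_wpM2l// ltW.
lra.
Qed.

Lemma powRV (x r : R) : 0 <= x -> x^-1 `^ r = (x `^ r)^-1.
Proof. by move=> x0; rewrite -(powR_inv1 x0) powRAC (powR_inv1 (powR_ge0 x r)). Qed.

Lemma powRD_gt0 (x r s : R) : 0 < x -> x `^ (r + s) = x `^ r * x `^ s.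
Proof. by move=> x0; rewrite powRD// (gt_eqF x0) implybT. Qed.

Lemma mulB1_gt0 (p q : R) : 1 < p -> 1 < q -> 0 < p * q - 1.
Proof. by move=> p1 q1; rewrite subr_gt0 -[ltLHS]mulr1 ltr_pM. Qed.

(** The sequences a_n - 2 C 2^(-n) and a_n + 2 C 2^(-n) are monotone and enclose the
    limit. *)
Lemma geometric_cvg (a : R^nat) (C : R) :
  (forall n, `|a n.+1 - a n| <= C * 2^-1 ^+ n) ->
  (a @ \oo --> limn a) /\ forall n, `|a n - limn a| <= 2 * C * 2^-1 ^+ n.
Proof.
move=> aC.
have C0 : 0 <= C by have := le_trans (normr_ge0 _) (aC 0%N); rewrite expr0 mulr1.
pose r n : R := 2 * C * 2^-1 ^+ n.
have r0 n : 0 <= r n by rewrite !mulr_ge0// exprn_ge0// invr_ge0.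
have rS n : r n.+1 = C * 2^-1 ^+ n by rewrite /r exprS; field.
have rr n : r n = 2 * (C * 2^-1 ^+ n) by rewrite /r mulrA.
have ndb : nondecreasing_seq (fun n => a n - r n).
  apply/nondecreasing_seqP => n; have := aC n; rewrite ler_norml => /andP[h _].
  by rewrite rS (rr n); lra.
have nic : nonincreasing_seq (fun n => a n + r n).
  apply/nonincreasing_seqP => n; have := aC n; rewrite ler_norml => /andP[_ h].
  by rewrite rS (rr n); lra.
have ub n : a n - r n <= a 0%N + r 0%N.
  by have := nic 0%N n (leq0n n); have := r0 n; lra.
have lb n : a 0%N - r 0%N <= a n + r n.
  by have := ndb 0%N n (leq0n n); have := r0 n; lra.
have cr : r @ \oo --> (0 : R).
  rewrite -[X in _ --> X](mulr0 (2 * C)); apply: cvgMr.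
  by apply: cvg_expr; rewrite ger0_norm ?invr_ge0// invf_lt1// ltr1n.
have cb : cvgn (fun n => a n - r n).
  by apply: nondecreasing_is_cvgn => //; exists (a 0%N + r 0%N) => _ [n _ <-].
have cvb := cb; move/cvg_ex : cvb => [l cl].
have ca : a @ \oo --> l.
  rewrite -[X in _ --> X]addr0 (_ : a = (fun n => (a n - r n) + r n)); first exact: cvgD.
  by apply/funext => n; rewrite subrK.
have -> : limn a = l by apply/cvg_lim.
split=> // n; rewrite -/(r n).
have cac : (fun n => a n + r n) @ \oo --> l.
  by rewrite -[X in _ --> X]addr0; exact: cvgD.
have h1 : a n - r n <= l.
  have := nondecreasing_cvgn_le ndb cb n; by rewrite (cvg_lim _ cl).
have h2 : l <= a n + r n.
  have : cvgn (fun n => a n + r n) by apply/cvg_ex; exists l.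
  by move=> /(nonincreasing_cvgn_ge nic)/(_ n); rewrite (cvg_lim _ cac).
by rewrite ler_norml; lra.
Qed.

End powers.

(** * Picard iteration *)

Section picard.
Context {R : realType} {N : nat}.
Implicit Types (T t : R) (g u v F : R -> 'rV[R]_N -> R).
Local Notation mu := (@lebesgue_measure R).

Definition pow_path (p : R) v : R -> 'rV[R]_N -> R := fun s y => `|v s y| `^ p.

Lemma pow_path_lipschitz (p M : R) u v s x : 1 < p -> `|u s x| <= M -> `|v s x| <= M ->
  `|pow_path p u s x - pow_path p v s x| <= p * M `^ (p - 1) * `|u s x - v s x|.
Proof.
move=> p1 uM vM.
have M0 : 0 <= M by exact: le_trans (normr_ge0 _) uM.
apply: (le_trans (powR_lipschitz (M := M) p1 _ _)); rewrite ?normr_ge0//.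
by rewrite ler_wpM2l ?ler_dist_dist// mulr_ge0 ?powR_ge0//; lra.
Qed.

Lemma pow_path_bound (p M : R) v s x : 1 < p -> `|v s x| <= M ->
  `|pow_path p v s x| <= M `^ p.
Proof.
move=> p1 vM; rewrite ger0_norm ?powR_ge0//.
rewrite ge0_ler_powR ?nnegrE//; first by lra.
exact: le_trans vM.
Qed.

Lemma C0_path_pow T (p : R) v : 0 <= T -> 1 < p -> C0_path T v ->
  C0_path T (pow_path p v).
Proof.
move=> T0 p1 vT; have [M M0 vM] := C0_path_bounded T0 vT; split=> e e0.
  have L0 : 0 < p * M `^ (p - 1) by rewrite mulr_gt0 ?powR_gt0//; lra.
  have [d d0 H] := vT.1 (e / (p * M `^ (p - 1))) (divr_gt0 e0 L0).
  exists d => // s t sT tT st x y xy.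
  have vsM := vM s sT x; have vtM := vM t tT y.
  apply: (@le_lt_trans _ _ (p * M `^ (p - 1) * `|v s x - v t y|)).
    apply: (le_trans (powR_lipschitz (M := M) p1 _ _)); rewrite ?normr_ge0//.
    by rewrite ler_wpM2l ?ler_dist_dist// ltW.
  by rewrite mulrC -ltr_pdivlMr//; exact: H.
have m0 : 0 < Num.min 1 e by rewrite lt_min ltr01.
have [r r0 H] := vT.2 _ m0; exists r => // s sT x rx.
have := H s sT x rx; rewrite lt_min => /andP[v1 ve].
apply: le_lt_trans ve; rewrite ger0_norm ?powR_ge0//.
have pn0 : p != 0 by rewrite gt_eqF//; lra.
rewrite /pow_path; have [->|vn0] := eqVneq `|v s x| 0; first by rewrite powR0.
by apply: ge1r_powR; rewrite ?(ltW v1) ?andbT ?(ltW p1)// lt_neqAle eq_sym vn0 normr_ge0.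
Qed.

Lemma segment_integrable_expR (l t : R) : 0 < l -> 0 <= t ->
  mu.-integrable `[0, t] (fun s => (expR (l * s))%:E).
Proof.
move=> l0 t0; apply/integrableP; split.
  apply: measurable_funTS; apply/measurable_EFinP; apply: (measurableT_comp (@measurable_expR R)).
  by apply: continuous_measurable_fun => x; apply: cvgM; [exact: cvg_cst|exact: cvg_id].
apply: le_lt_trans (ltry (expR (l * t) / l)).
apply: le_trans (integral_expR_le l0 t0).
by under eq_integral do rewrite /= ger0_norm ?expR_ge0//.
Qed.

(** In the norm weighted by expR (l t), integrating in time gains a factor 1 / l,
    and the heat semigroup does not increase sup norms. *)
Lemma duhamel_diff T g h (l A t : R) x : C0_path T g -> C0_path T h -> 0 < l ->
  0 <= t <= T ->
  (forall s, 0 <= s <= t -> forall y, `|g s y - h s y| <= A * expR (l * s)) ->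
  `|duhamel 0 g t x - duhamel 0 h t x| <= A * expR (l * t) / l.
Proof.
move=> gT hT l0 tT gh; have /andP[t0 tT'] := tT; have T0 := le_trans t0 tT'.
have A0 : 0 <= A.
  by have := le_trans (normr_ge0 _) (gh 0 _ 0); rewrite lexx t0 mulr0 expR0 mulr1; exact.
have m1 : -1 < 0 :> R by lra.
have ig := integrable_duhamel x m1 gT tT (lexx t).
have ih := integrable_duhamel x m1 hT tT (lexx t).
have igh := segment_integrableB ig ih.
rewrite /duhamel -RintegralB//.
apply: (le_trans (le_normr_Rintegral (measurable_segment 0 t) igh)).
have iA := segment_integrableZl A (segment_integrable_expR l0 t0).
have [M M0 gM] := C0_path_bounded T0 gT; have [M' M'0 hM'] := C0_path_bounded T0 hT.
apply: (@le_trans _ _ (\int[mu]_(s in `[0, t]) (A * expR (l * s)))).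
  apply: le_Rintegral => //; first exact: (integrable_norm igh).
  move=> s; rewrite /= in_itv/= => /andP[s0 st].
  have sT : 0 <= s <= T by rewrite s0 (le_trans st).
  rewrite powRr0 !mul1r (@heat_semigroupB _ _ _ _ _ (Num.max M M')) ?subr_ge0//.
  - apply: heat_semigroup_bound; rewrite ?subr_ge0//.
      by apply: measurable_funB; [exact: (C0_path_measurable gT)|exact: (C0_path_measurable hT)].
    by move=> y; apply: gh; rewrite s0.
  - exact: (C0_path_measurable gT).
  - by move=> y; rewrite le_max gM.
  - exact: (C0_path_measurable hT).
  - by move=> y; rewrite le_max hM' ?orbT.
rewrite RintegralZl//; last exact: segment_integrable_expR.
rewrite -mulrA ler_wpM2l// /Rintegral -lee_fin fineK ?integral_expR_le//.
by apply: integrable_fin_num => //; exact: segment_integrable_expR.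
Qed.

Lemma eq_duhamel (k : R) g h t : (forall s, 0 <= s <= t -> g s = h s) ->
  forall x, duhamel k g t x = duhamel k h t x.
Proof.
move=> gh x; apply: eq_Rintegral => s; rewrite inE/= in_itv/= => st.
by rewrite gh.
Qed.

Definition mild_map (p : R) F v : R -> 'rV[R]_N -> R :=
  fun t x => F t x + duhamel 0 (pow_path p v) t x.

(** Mild solutions with the data and forcing terms gathered into F1 and F2. *)
Definition mild_solution_on (p q : R) F1 F2 T u v : Prop :=
  [/\ C0_path T u, C0_path T v &
      forall t, 0 <= t <= T -> forall x,
        u t x = mild_map p F1 v t x /\ v t x = mild_map q F2 u t x].

Lemma mild_map_C0_path T p F v : 0 <= T -> 1 < p -> C0_path T F -> C0_path T v ->
  C0_path T (mild_map p F v).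
Proof.
move=> T0 p1 FT vT; apply: C0_pathD => //; apply: duhamel_C0_path => //.
  by rewrite lexx andbT; lra.
exact: C0_path_pow.
Qed.

Lemma mild_map_diff T p F v v' (M L l A t : R) x : 0 <= T -> 1 < p ->
  C0_path T v -> C0_path T v' -> 0 < l -> 0 <= t <= T ->
  p * M `^ (p - 1) <= L ->
  (forall s, 0 <= s <= t -> forall y, `|v s y| <= M) ->
  (forall s, 0 <= s <= t -> forall y, `|v' s y| <= M) ->
  (forall s, 0 <= s <= t -> forall y, `|v s y - v' s y| <= A * expR (l * s)) ->
  `|mild_map p F v t x - mild_map p F v' t x| <= L * A * expR (l * t) / l.
Proof.
move=> T0 p1 vT v'T l0 tT pL vM v'M vv.
rewrite /mild_map opprD addrACA subrr add0r.
apply: (@duhamel_diff T) => //; [exact: C0_path_pow|exact: C0_path_pow|].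
move=> s st y; apply: (le_trans (pow_path_lipschitz p1 (vM s st y) (v'M s st y))).
have pM0 : 0 <= p * M `^ (p - 1) by rewrite mulr_ge0 ?powR_ge0//; lra.
by rewrite -[leRHS]mulrA; apply: ler_pM => //; exact: vv.
Qed.

Definition picard (p q : R) F1 F2 u0 v0 (n : nat) :=
  iter n (fun w => (mild_map p F1 w.2, mild_map q F2 w.1)) (u0, v0).

Lemma picardS p q F1 F2 u0 v0 n : picard p q F1 F2 u0 v0 n.+1 =
  (mild_map p F1 (picard p q F1 F2 u0 v0 n).2, mild_map q F2 (picard p q F1 F2 u0 v0 n).1).
Proof. by []. Qed.

Lemma picard_C0_path T p q F1 F2 u0 v0 n : 0 <= T -> 1 < p -> 1 < q ->
  C0_path T F1 -> C0_path T F2 -> C0_path T u0 -> C0_path T v0 ->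
  C0_path T (picard p q F1 F2 u0 v0 n).1 /\ C0_path T (picard p q F1 F2 u0 v0 n).2.
Proof.
move=> T0 p1 q1 F1T F2T u0T v0T; elim: n => [//|n [IHu IHv]].
by rewrite picardS; split; exact: mild_map_C0_path.
Qed.

(** On paths bounded by M the nonlinearity is Lipschitz, so for l large enough
    mild_map halves distances in the norm weighted by expR (l t), and the
    iterates converge geometrically. *)
Theorem picard_limit T p q F1 F2 u0 v0 (M : R) : 0 <= T -> 1 < p -> 1 < q ->
  C0_path T F1 -> C0_path T F2 -> C0_path T u0 -> C0_path T v0 ->
  (forall n t, 0 <= t <= T -> forall x,
     `|(picard p q F1 F2 u0 v0 n).1 t x| <= M /\ `|(picard p q F1 F2 u0 v0 n).2 t x| <= M) ->
  mild_solution_on p q F1 F2 T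
    (fun t x => limn (fun n => (picard p q F1 F2 u0 v0 n).1 t x))
    (fun t x => limn (fun n => (picard p q F1 F2 u0 v0 n).2 t x)).
Proof.
move=> T0 p1 q1 F1T F2T u0T v0T PM.
set P := picard p q F1 F2 u0 v0 in PM *.
set u := fun t x => _; set v := fun t x => _.
have PT n : C0_path T (P n).1 /\ C0_path T (P n).2 by exact: picard_C0_path.
have PS n : P n.+1 = (mild_map p F1 (P n).2, mild_map q F2 (P n).1) by [].
rewrite {}/u {}/v; clearbody P; set u := fun t x => _; set v := fun t x => _.
have M0 : 0 <= M.
  have T00 : (0 : R) <= 0 <= T by apply/andP; split.
  by have [+ _] := PM 0%N 0 T00 0; exact: le_trans.
pose L := p * M `^ (p - 1) + q * M `^ (q - 1) + 1.
have Lp0 : 0 <= p * M `^ (p - 1) by rewrite mulr_ge0 ?powR_ge0//; lra.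
have Lq0 : 0 <= q * M `^ (q - 1) by rewrite mulr_ge0 ?powR_ge0//; lra.
have L0 : 0 < L by rewrite /L; lra.
have pL : p * M `^ (p - 1) <= L by rewrite /L; lra.
have qL : q * M `^ (q - 1) <= L by rewrite /L; lra.
(* with this weight the Lipschitz constant L becomes L / l = 1 / 2 *)
pose l := 2 * L; have l0 : 0 < l by rewrite mulr_gt0.
have sub s t : 0 <= t <= T -> 0 <= s <= t -> 0 <= s <= T.
  by move=> /andP[_ tT] /andP[-> /le_trans]; exact.
have half A e : L * A * e / l = A / 2 * e by rewrite /l; field; rewrite gt_eqF.
have step n : forall t, 0 <= t <= T -> forall x,
    `|(P n.+1).1 t x - (P n).1 t x| <= 2 * M * 2^-1 ^+ n * expR (l * t) /\
    `|(P n.+1).2 t x - (P n).2 t x| <= 2 * M * 2^-1 ^+ n * expR (l * t).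
  elim: n => [|n IH] t tT x.
    have [h1 h2] := PM 0%N t tT x; have [h3 h4] := PM 1%N t tT x.
    have e1 : 1 <= expR (l * t).
      by rewrite -expR0 ler_expR mulr_ge0 ?(ltW l0)//; case/andP: tT.
    have e2 : 2 * M <= 2 * M * 2^-1 ^+ 0 * expR (l * t).
      by rewrite expr0 mulr1 ler_peMr// mulr_ge0.
    by split; apply: le_trans e2; apply: (le_trans (ler_normB _ _)); rewrite (_ : 2 * M = M + M) ?lerD//; ring.
  have E : 2 * M * 2^-1 ^+ n.+1 * expR (l * t) =
      L * (2 * M * 2^-1 ^+ n) * expR (l * t) / l.
    by rewrite half exprS; field.
  have [PTu PTv] := PT n; have [PTu' PTv'] := PT n.+1.
  split; rewrite E [in X in X - _]PS [in X in _ - X]PS /=.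
    apply: (@mild_map_diff T p F1 _ _ M) => //.
    + by move=> s /(sub _ _ tT) sT y; have [_] := PM n.+1 s sT y.
    + by move=> s /(sub _ _ tT) sT y; have [_] := PM n s sT y.
    + by move=> s /(sub _ _ tT) sT y; have [_] := IH s sT y.
  apply: (@mild_map_diff T q F2 _ _ M) => //.
  + by move=> s /(sub _ _ tT) sT y; have [] := PM n.+1 s sT y.
  + by move=> s /(sub _ _ tT) sT y; have [] := PM n s sT y.
  + by move=> s /(sub _ _ tT) sT y; have [] := IH s sT y.
have cvu t x : 0 <= t <= T -> (fun n => (P n).1 t x) @ \oo --> u t x /\
    forall n, `|(P n).1 t x - u t x| <= 2 * (2 * M * expR (l * t)) * 2^-1 ^+ n.
  move=> tT; apply: geometric_cvg => n.
  by have [+ _] := step n t tT x; rewrite [X in _ <= X -> _]mulrAC.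
have cvv t x : 0 <= t <= T -> (fun n => (P n).2 t x) @ \oo --> v t x /\
    forall n, `|(P n).2 t x - v t x| <= 2 * (2 * M * expR (l * t)) * 2^-1 ^+ n.
  move=> tT; apply: geometric_cvg => n.
  by have [_] := step n t tT x; rewrite [X in _ <= X -> _]mulrAC.
clearbody u v; pose C := 4 * M * expR (l * T).
have C0 : 0 <= C by rewrite !mulr_ge0 ?expR_ge0.
have tail t n : 0 <= t <= T -> 2 * (2 * M * expR (l * t)) * 2^-1 ^+ n <= C * 2^-1 ^+ n.
  move=> /andP[t0 tT]; rewrite ler_wpM2r ?exprn_ge0 ?invr_ge0//.
  rewrite mulrA (_ : 2 * (2 * M) = 4 * M); last by ring.
  by rewrite ler_wpM2l ?mulr_ge0// ler_expR ler_wpM2l// ltW.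
have small e : 0 < e -> exists n, C * 2^-1 ^+ n < e.
  move=> e0; have : (fun n => C * 2^-1 ^+ n) @ \oo --> (0 : R).
    rewrite -[X in _ --> X](mulr0 C); apply: cvgMr.
    by apply: cvg_expr; rewrite ger0_norm ?invr_ge0// invf_lt1// ltr1n.
  move=> /cvgrPdist_lt/(_ e e0) [n _ /(_ n (leqnn n))] /=.
  rewrite sub0r normrN ger0_norm; last by rewrite mulr_ge0// exprn_ge0// invr_ge0.
  by exists n.
have uT : C0_path T u.
  apply: C0_path_limit => e e0; have [n Cn] := small e e0; exists (P n).1.
    by have [] := PT n.
  move=> s sT x; rewrite distrC (le_lt_trans _ Cn)//.
  by apply: le_trans (tail s n sT); exact: (cvu s x sT).2.
have vT : C0_path T v.
  apply: C0_path_limit => e e0; have [n Cn] := small e e0; exists (P n).2.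
    by have [] := PT n.
  move=> s sT x; rewrite distrC (le_lt_trans _ Cn)//.
  by apply: le_trans (tail s n sT); exact: (cvv s x sT).2.
have uM t x : 0 <= t <= T -> `|u t x| <= M.
  move=> tT; have [cv _] := cvu t x tT.
  have cn : (fun n => `|(P n).1 t x|) @ \oo --> `|u t x| by apply: cvg_norm.
  rewrite -(cvg_lim _ cn)//; apply: limr_le; first by apply/cvg_ex; eexists; exact: cn.
  by apply: nearW => n; have [] := PM n t tT x.
have vM t x : 0 <= t <= T -> `|v t x| <= M.
  move=> tT; have [cv _] := cvv t x tT.
  have cn : (fun n => `|(P n).2 t x|) @ \oo --> `|v t x| by apply: cvg_norm.
  rewrite -(cvg_lim _ cn)//; apply: limr_le; first by apply/cvg_ex; eexists; exact: cn.
  by apply: nearW => n; have [] := PM n t tT x.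
have tri (a b c : R) : `|a - b| <= `|c - a| + `|c - b|.
  by rewrite (distrC c a) ler_distD.
have zero (y : R) : (forall e, 0 < e -> `|y| <= e) -> y = 0.
  move=> H; apply/eqP; rewrite -normr_le0; apply/ler_addgt0Pr => e e0.
  by rewrite add0r H.
have tail1 s t n : 0 <= t <= T -> 0 <= s <= t ->
    2 * (2 * M * expR (l * s)) * 2^-1 ^+ n <= C * 2^-1 ^+ n * expR (l * s).
  move=> tT st; have sT := sub _ _ tT st.
  have s0 : 0 <= s by case/andP: st.
  apply: (le_trans (tail s n sT)); rewrite ler_peMr//.
    by rewrite mulr_ge0// exprn_ge0// invr_ge0.
  by rewrite -expR0 ler_expR mulr_ge0// ltW.
pose D := 1 + L * expR (l * T) / l.
have D0 : 0 < D by rewrite ltr_wpDr// divr_ge0 ?mulr_ge0 ?expR_ge0// ltW.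
have final t n : 0 <= t <= T -> C * 2^-1 ^+ n.+1 + L * (C * 2^-1 ^+ n) * expR (l * t) / l <=
    C * 2^-1 ^+ n * D.
  move=> /andP[t0 tT]; set c := C * 2^-1 ^+ n.
  have c0 : 0 <= c by rewrite mulr_ge0// exprn_ge0// invr_ge0.
  have -> : C * 2^-1 ^+ n.+1 = c / 2 by rewrite /c exprS; ring.
  have : expR (l * t) <= expR (l * T) by rewrite ler_expR ler_pM2l.
  move=> h; rewrite /D mulrDr mulr1 lerD//; first by lra.
  rewrite (_ : c * (L * _ / l) = L * c * expR (l * T) / l); last by ring.
  rewrite ler_pM2r ?invr_gt0//; apply: ler_wpM2l => //.
  by rewrite mulr_ge0// ltW.
split=> // t tT x.
have small2 e : 0 < e -> exists n, C * 2^-1 ^+ n * D < e.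
  move=> e0; have [n Cn] := small (e / D) (divr_gt0 e0 D0); exists n.
  by rewrite -ltr_pdivlMr.
split; apply/eqP; rewrite -subr_eq0; apply/eqP; apply: zero => e e0;
  have [n Cn] := small2 e e0; apply: le_trans (ltW Cn); apply: le_trans (final t n tT);
  [have := (cvu t x tT).2 n.+1|have := (cvv t x tT).2 n.+1]; rewrite PS /= => h1.
  apply: (le_trans (tri _ _ (mild_map p F1 (P n).2 t x))); rewrite lerD//.
    exact: le_trans h1 (tail _ _ tT).
  apply: (@mild_map_diff T p F1 _ _ M) => //; first by have [] := PT n.
  + by move=> s /(sub _ _ tT) sT y; have [] := PM n s sT y.
  + by move=> s /(sub _ _ tT) sT y; exact: vM.
  + move=> s st y; apply: le_trans (tail1 _ _ n tT st).
    exact: (cvv s y (sub _ _ tT st)).2.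
apply: (le_trans (tri _ _ (mild_map q F2 (P n).1 t x))); rewrite lerD//.
  exact: le_trans h1 (tail _ _ tT).
apply: (@mild_map_diff T q F2 _ _ M) => //; first by have [] := PT n.
+ by move=> s /(sub _ _ tT) sT y; have [] := PM n s sT y.
+ by move=> s /(sub _ _ tT) sT y; exact: uM.
+ move=> s st y; apply: le_trans (tail1 _ _ n tT st).
  exact: (cvu s y (sub _ _ tT st)).2.
Qed.

End picard.

(** * Uniqueness, continuation and the maximal solution *)

Section uniqueness_continuation.
Context {R : realType} {N : nat}.
Implicit Types (T t : R) (u v F : R -> 'rV[R]_N -> R).
Local Notation mu := (@lebesgue_measure R).

Lemma eq_mild_map p F g h t x : (forall s, 0 <= s <= t -> g s = h s) ->
  mild_map p F g t x = mild_map p F h t x.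
Proof.
move=> gh; have E : duhamel 0 (pow_path p g) t x = duhamel 0 (pow_path p h) t x.
  by apply: eq_duhamel => s st; rewrite /pow_path (gh s st).
by rewrite /mild_map E.
Qed.

Lemma mild_map0 p F g x : mild_map p F g 0 x = F 0 x.
Proof.
have E : duhamel 0 (pow_path p g) 0 x = 0 :> R.
  by rewrite /duhamel set_itv1 Rintegral_set1.
by rewrite /mild_map E addr0.
Qed.

(** Solutions are fixed points of a map that halves distances in the weighted norm
    of duhamel_diff, so two of them differ by at most 2 M 2^(-n) expR (l t) for
    every n. *)
Theorem mild_solution_unique T p q F1 F2 u v u' v' : 0 <= T -> 1 < p -> 1 < q ->
  mild_solution_on p q F1 F2 T u v -> mild_solution_on p q F1 F2 T u' v' ->
  forall t, 0 <= t <= T -> forall x, u t x = u' t x /\ v t x = v' t x.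
Proof.
move=> T0 p1 q1 [uT vT E] [u'T v'T E'].
have [M1 M10 uM] := C0_path_bounded T0 uT; have [M2 M20 vM] := C0_path_bounded T0 vT.
have [M3 M30 u'M] := C0_path_bounded T0 u'T; have [M4 M40 v'M] := C0_path_bounded T0 v'T.
pose M := M1 + M2 + M3 + M4.
have M0 : 0 < M by rewrite /M !addr_gt0.
have le1 : M1 <= M by rewrite /M; lra.
have le2 : M2 <= M by rewrite /M; lra.
have le3 : M3 <= M by rewrite /M; lra.
have le4 : M4 <= M by rewrite /M; lra.
have {le1}uM s y : 0 <= s <= T -> `|u s y| <= M by move=> sT; exact: le_trans (uM s sT y) le1.
have {le2}vM s y : 0 <= s <= T -> `|v s y| <= M by move=> sT; exact: le_trans (vM s sT y) le2.
have {le3}u'M s y : 0 <= s <= T -> `|u' s y| <= M by move=> sT; exact: le_trans (u'M s sT y) le3.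
have {le4}v'M s y : 0 <= s <= T -> `|v' s y| <= M by move=> sT; exact: le_trans (v'M s sT y) le4.
clearbody M.
pose L := p * M `^ (p - 1) + q * M `^ (q - 1) + 1.
have Lp0 : 0 <= p * M `^ (p - 1) by rewrite mulr_ge0 ?powR_ge0//; lra.
have Lq0 : 0 <= q * M `^ (q - 1) by rewrite mulr_ge0 ?powR_ge0//; lra.
have L0 : 0 < L by rewrite /L; lra.
have pL : p * M `^ (p - 1) <= L by rewrite /L; lra.
have qL : q * M `^ (q - 1) <= L by rewrite /L; lra.
clearbody L.
pose l := 2 * L; have l0 : 0 < l by rewrite mulr_gt0.
have half A e : L * A * e / l = A / 2 * e by rewrite /l; field; rewrite gt_eqF.
have sub s t : 0 <= t <= T -> 0 <= s <= t -> 0 <= s <= T.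
  by move=> /andP[_ tT] /andP[-> /le_trans]; exact.
have step n : forall t, 0 <= t <= T -> forall x,
    `|u t x - u' t x| <= 2 * M * 2^-1 ^+ n * expR (l * t) /\
    `|v t x - v' t x| <= 2 * M * 2^-1 ^+ n * expR (l * t).
  elim: n => [|n IH] t tT x.
    have e1 : 1 <= expR (l * t).
      by rewrite -expR0 ler_expR mulr_ge0 ?(ltW l0)//; case/andP: tT.
    have e2 : 2 * M <= 2 * M * 2^-1 ^+ 0 * expR (l * t).
      by rewrite expr0 mulr1 ler_peMr// mulr_ge0// ltW.
    by split; apply: le_trans e2; apply: (le_trans (ler_normB _ _));
      rewrite (_ : 2 * M = M + M) ?lerD//; [exact: uM|exact: u'M|ring|exact: vM|exact: v'M|ring].
  have -> : 2 * M * 2^-1 ^+ n.+1 * expR (l * t) = L * (2 * M * 2^-1 ^+ n) * expR (l * t) / l.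
    by rewrite half exprS; field.
  have [-> ->] := E t tT x; have [-> ->] := E' t tT x; split.
    apply: (@mild_map_diff _ _ T p F1 _ _ M) => //.
    + by move=> s /(sub _ _ tT) sT y; exact: vM.
    + by move=> s /(sub _ _ tT) sT y; exact: v'M.
    + by move=> s /(sub _ _ tT) sT y; have [_] := IH s sT y.
  apply: (@mild_map_diff _ _ T q F2 _ _ M) => //.
  + by move=> s /(sub _ _ tT) sT y; exact: uM.
  + by move=> s /(sub _ _ tT) sT y; exact: u'M.
  + by move=> s /(sub _ _ tT) sT y; have [] := IH s sT y.
have zero (y C : R) : (forall n, `|y| <= C * 2^-1 ^+ n) -> y = 0.
  move=> H; apply/eqP; rewrite -normr_le0.
  have cC : (fun n => C * 2^-1 ^+ n) @ \oo --> (0 : R).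
    rewrite -[X in _ --> X](mulr0 C); apply: cvgMr.
    by apply: cvg_expr; rewrite ger0_norm ?invr_ge0// invf_lt1// ltr1n.
  rewrite -(cvg_lim _ cC)//; apply: limr_ge; first by apply/cvg_ex; eexists; exact: cC.
  exact: nearW.
move=> t tT x; split; apply/eqP; rewrite -subr_eq0; apply/eqP;
  apply: (zero _ (2 * M * expR (l * t))) => n;
  have [h1 h2] := step n t tT x; by rewrite mulrAC.
Qed.

Lemma Rintegral_powR0_bound (a b M : R) (h : R -> R) : 0 <= a -> a <= b -> 0 <= M ->
  mu.-integrable `[a, b] (fun s => (s `^ 0 * h s)%:E) ->
  (forall s, a <= s <= b -> `|h s| <= M) ->
  `|\int[mu]_(s in `[a, b]) (s `^ 0 * h s)| <= M * (b - a).
Proof.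
move=> a0 ab M0 ih hM; have m1 : -1 < 0 :> R by lra.
apply: (le_trans (Rintegral_powR_bound m1 a0 ab M0 ih hM)).
rewrite ler_wpM2l//.
have m1' : -1 < (0:R) <= 0 by rewrite m1 lexx.
have ab' : 0 <= a <= b by rewrite a0.
apply: (le_trans (Rintegral_powR_sub_le m1' ab')).
by rewrite add0r divr1 powRr1// subr_ge0.
Qed.

Lemma duhamel0_split_bound T g (t s M M' : R) (x : 'rV[R]_N) : C0_path T g ->
  0 <= t -> t <= s -> s <= T -> 0 <= M -> 0 <= M' ->
  (forall r, 0 <= r <= t -> forall y, `|g r y| <= M) ->
  (forall r, t <= r <= s -> forall y, `|g r y| <= M') ->
  `|duhamel 0 g s x| <= M * t + M' * (s - t).
Proof.
move=> gT t0 ts sT M0 M'0 gM gM'.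
have m1 : -1 < 0 :> R by lra.
have s0 : 0 <= s by exact: le_trans ts.
have sT' : 0 <= s <= T by rewrite s0.
have is_ := integrable_duhamel x m1 gT sT' (lexx s).
have sub r : 0 <= r <= s -> 0 <= r <= T by move=> /andP[-> /le_trans]; exact.
have meas r : 0 <= r <= s -> measurable_fun setT (g r).
  by move=> /sub; exact: C0_path_measurable.
rewrite /duhamel (Rintegral_itv_split t0 ts is_) (le_trans (ler_normD _ _))// lerD//.
- rewrite -[X in M * X]subr0; apply: Rintegral_powR0_bound => //.
    apply: integrableS is_ => // r /=; rewrite !in_itv/= => /andP[-> rt].
    exact: le_trans ts.
  move=> r /andP[r0 rt].
  have rs : r <= s by exact: le_trans ts.
  apply: heat_semigroup_bound; rewrite ?subr_ge0//; first by apply: meas; rewrite r0.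
  by move=> y; apply: gM; rewrite r0.
- apply: Rintegral_powR0_bound => //.
    apply: integrableS is_ => // r /=; rewrite !in_itv/= => /andP[tr ->].
    by rewrite (le_trans t0).
  move=> r /andP[tr rs].
  have r0 : 0 <= r by exact: le_trans tr.
  apply: heat_semigroup_bound; rewrite ?subr_ge0//; first by apply: meas; rewrite r0.
  by move=> y; apply: gM'; rewrite tr.
Qed.

(** A solution bounded by M on [0, T1] extends by a time that depends only on
    the bounds: run the Picard iteration from the solution frozen after T1; the
    iterates never change on [0, T1]. *)
Theorem mild_continuation T1 T2 p q F1 F2 u v (K M M' : R) :
  0 <= T1 -> T1 <= T2 -> 1 < p -> 1 < q -> C0_path T2 F1 -> C0_path T2 F2 ->
  mild_solution_on p q F1 F2 T1 u v ->
  (forall t, 0 <= t <= T2 -> forall x, `|F1 t x| <= K /\ `|F2 t x| <= K) ->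
  (forall t, 0 <= t <= T1 -> forall x, `|u t x| <= M /\ `|v t x| <= M) ->
  K + T1 * (M `^ p + M `^ q) + 1 <= M' -> M <= M' ->
  (T2 - T1) * (M' `^ p + M' `^ q) <= 1 ->
  exists u' v', mild_solution_on p q F1 F2 T2 u' v'.
Proof.
move=> T10 T12 p1 q1 F1T F2T [uT vT E] FK uvM KM' MM' TM'.
have T20 : 0 <= T2 by exact: le_trans T12.
pose u0 t := u (clamp T1 t); pose v0 t := v (clamp T1 t).
have u0T : C0_path T2 u0 by exact: C0_path_clamp.
have v0T : C0_path T2 v0 by exact: C0_path_clamp.
have [P PD] : exists P, P = picard p q F1 F2 u0 v0 by eexists.
have T00 : (0 : R) <= 0 <= T1 by apply/andP; split.
have M0 : 0 <= M by have [h _] := uvM 0 T00 0; exact: le_trans h.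
have M'0 : 0 <= M' by exact: le_trans MM'.
have p0 : 0 <= p by lra.
have q0 : 0 <= q by lra.
have PT n : C0_path T2 (P n).1 /\ C0_path T2 (P n).2 by rewrite PD; exact: picard_C0_path.
have PS n : P n.+1 = (mild_map p F1 (P n).2, mild_map q F2 (P n).1) by rewrite PD.
have P0 : P 0%N = (u0, v0) by rewrite PD.
have PE n : forall t, 0 <= t <= T1 -> (P n).1 t = u t /\ (P n).2 t = v t.
  elim: n => [|n IH] t tT; first by rewrite P0/= /u0 /v0 clamp_id.
  have /andP[t0 tT'] := tT.
  have sub s : 0 <= s <= t -> 0 <= s <= T1 by move=> /andP[-> /le_trans]; exact.
  rewrite PS /=; split; apply/funext => x.
    rewrite (E t tT x).1; apply: eq_mild_map => s /sub sT; exact: (IH s sT).2.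
  rewrite (E t tT x).2; apply: eq_mild_map => s /sub sT; exact: (IH s sT).1.
have PM n : forall t, 0 <= t <= T2 -> forall x, `|(P n).1 t x| <= M' /\ `|(P n).2 t x| <= M'.
  elim: n => [|n IH] t tT x.
    have [h1 h2] := uvM _ (clamp_itv t T10) x.
    by rewrite P0; split; exact: le_trans MM'.
  have /andP[t0 tT'] := tT.
  have [tT1|/ltW T1t] := leP t T1.
    have [-> ->] : (P n.+1).1 t = u t /\ (P n.+1).2 t = v t by apply: PE; rewrite t0.
    have [h1 h2] := uvM t (introT andP (conj t0 tT1)) x.
    by split; exact: le_trans MM'.
  have [F1K F2K] := FK t tT x.
  have Mp0 := powR_ge0 M p; have Mq0 := powR_ge0 M q.
  have M'p0 := powR_ge0 M' p; have M'q0 := powR_ge0 M' q.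
  have [hp hq] : M `^ p * T1 + M' `^ p * (t - T1) <= T1 * (M `^ p + M `^ q) + 1 /\
      M `^ q * T1 + M' `^ q * (t - T1) <= T1 * (M `^ p + M `^ q) + 1.
    have h1 : (t - T1) * (M' `^ p + M' `^ q) <= (T2 - T1) * (M' `^ p + M' `^ q).
      by rewrite ler_wpM2r ?addr_ge0// lerD2r.
    have h2 : 0 <= M' `^ p * (t - T1) by rewrite mulr_ge0 ?subr_ge0.
    have h3 : 0 <= M' `^ q * (t - T1) by rewrite mulr_ge0 ?subr_ge0.
    have h4 : 0 <= M `^ p * T1 by rewrite mulr_ge0.
    have h5 : 0 <= M `^ q * T1 by rewrite mulr_ge0.
    clear - TM' h1 h2 h3 h4 h5; split; lra.
  rewrite PS /= /mild_map; split; apply: (le_trans (ler_normD _ _)).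
  + apply: (@le_trans _ _ (K + (M `^ p * T1 + M' `^ p * (t - T1)))); last by lra.
    apply: lerD => //; have [_ PnT] := PT n.
    apply: (@duhamel0_split_bound T2) => //; first exact: C0_path_pow.
    * move=> r rT y; apply: pow_path_bound => //; have [_ ->] := PE n r rT.
      by have [] := uvM r rT y.
    * move=> r /andP[Tr rt] y; apply: pow_path_bound => //.
      have rT : 0 <= r <= T2 by rewrite (le_trans T10)//= (le_trans rt).
      by have [] := IH r rT y.
  + apply: (@le_trans _ _ (K + (M `^ q * T1 + M' `^ q * (t - T1)))); last by lra.
    apply: lerD => //; have [PnT _] := PT n.
    apply: (@duhamel0_split_bound T2) => //; first exact: C0_path_pow.
    * move=> r rT y; apply: pow_path_bound => //; have [-> _] := PE n r rT.
      by have [] := uvM r rT y.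
    * move=> r /andP[Tr rt] y; apply: pow_path_bound => //.
      have rT : 0 <= r <= T2 by rewrite (le_trans T10)//= (le_trans rt).
      by have [] := IH r rT y.
rewrite PD in PM; eexists; eexists; apply: (@picard_limit _ _ T2 p q F1 F2 u0 v0 M') => //.
Qed.

Lemma mild_solution_on_le T T' p q F1 F2 u v : T' <= T ->
  mild_solution_on p q F1 F2 T u v -> mild_solution_on p q F1 F2 T' u v.
Proof.
move=> TT [uT vT E]; split; [exact: C0_path_le uT|exact: C0_path_le vT|].
move=> t /andP[t0 tT] x; apply: E; by rewrite t0 (le_trans tT).
Qed.

Lemma eq_mild_solution_on T p q F1 F2 u v u' v' :
  (forall t, 0 <= t <= T -> u t = u' t /\ v t = v' t) ->
  mild_solution_on p q F1 F2 T u v -> mild_solution_on p q F1 F2 T u' v'.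
Proof.
move=> uu [uT vT E]; split.
- by apply: eq_C0_path uT => s sT x; have [->] := uu s sT.
- by apply: eq_C0_path vT => s sT x; have [_ ->] := uu s sT.
move=> t tT x; have /andP[t0 tT'] := tT.
have sub s : 0 <= s <= t -> 0 <= s <= T by move=> /andP[-> /le_trans]; exact.
rewrite -(uu t tT).1 -(uu t tT).2 (E t tT x).1 (E t tT x).2.
by split; apply: eq_mild_map => s /sub/uu[].
Qed.

End uniqueness_continuation.

Section Linfty.
Context {R : realType} {N : nat}.
Local Notation mu := (@lebesgue_measure R).

Lemma lebesgue_rV_ball_gt0 (x : 'rV[R]_N) (d : R) : 0 < d ->
  (0 < lebesgue_rV R N [set y | forall i, ball (x ord0 i) d (y ord0 i)])%E.
Proof.
move=> d0; rewrite (@lebesgue_rV_box R N (fun i => ball (x ord0 i) d)).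
  apply: (big_ind (fun a : \bar R => (0 < a)%E)) => [|a b a0 b0|i _].
  - exact: lte01.
  - exact: mule_gt0.
  rewrite lebesgue_measure_ball ?(ltW d0)// lte_fin.
  by rewrite mulrn_wgt0.
by move=> i; exact: measurable_ball.
Qed.

(** Boxes have positive measure, so a continuous function that exceeds A at one
    point exceeds it on a non-negligible set. *)
Lemma Linfty_norm_ub (u : R -> 'rV[R]_N -> R) (T t A : R) : t <= T -> 
  (forall t', 0 < t' < T -> C0_path t' u) ->
  (Linfty_norm t u <= A%:E)%E -> forall s x, 0 < s < t -> `|u s x| <= A.
Proof.
move=> tT uT uA s x /andP[s0 st]; rewrite leNgt; apply/negP => Au.
pose t' := (s + t) / 2.
have st' : s < t' by rewrite /t'; lra.
have t't : t' < t by rewrite /t'; lra.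
have t'T : 0 < t' < T by rewrite (lt_trans s0)//= (lt_le_trans t't).
have Au' : 0 < `|u s x| - A by rewrite subr_gt0.
have [d d0 dH] := (uT t' t'T).1 _ Au'.
pose r := Num.min d (Num.min s (t' - s)).
have r0 : 0 < r by rewrite !lt_min d0 s0 subr_gt0.
have [rd [rs rt]] : r <= d /\ r <= s /\ r <= t' - s.
  by split; [|split]; rewrite /r !ge_min lexx ?orbT.
pose B : set (measurableTypeR R * 'rV[R]_N) :=
  (ball s r : set R) `*` [set y : 'rV[R]_N | forall i, ball (x ord0 i) r (y ord0 i)].
have mbr : measurable [set y : 'rV[R]_N | forall i, ball (x ord0 i) r (y ord0 i)].
  rewrite (_ : [set _ | _] = [set y | `|x - y| < r]); first exact: measurable_rV_ball.
  apply/seteqP; split => y /= h; last first.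
    move=> i; rewrite -ball_normE /=; apply: le_lt_trans h.
    by have := rV_coord_le_norm (x - y) i; rewrite !mxE.
  by apply: rV_norm_ltP => // i; rewrite !mxE; have := h i; rewrite -ball_normE.
have mB : measurable B by apply: measurableX => //; exact: measurable_ball.
have muB : (0 < ((@lebesgue_measure R) \x lebesgue_rV R N) B)%E.
  rewrite product_measure1E//; last exact: measurable_ball.
  rewrite mule_gt0//; last exact: lebesgue_rV_ball_gt0.
  have := lebesgue_measure_ball s (ltW r0); rewrite /= => ->.
  by rewrite lte_fin mulrn_wgt0.
have muT : (0 < ((@lebesgue_measure R) \x lebesgue_rV R N) setT)%E.
  by apply: (lt_le_trans muB); apply: le_measure; rewrite ?inE.
move: uA; rewrite /Linfty_norm unlock muT => /ess_supP[Z [mZ Z0 ZH]].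
suff BZ : B `<=` Z.
  have h : (((@lebesgue_measure R) \x lebesgue_rV R N) B <= 0)%E.
    by rewrite -Z0; apply: le_measure; rewrite ?inE.
  by have := lt_le_trans muB h; rewrite ltxx.
move=> [s' x'] [/= ss' xx']; apply: ZH => /=.
have s't : s - r < s' < s + r.
  by move: ss'; rewrite -ball_normE /= ltr_distlC.
have /andP[h1 h2] := s't.
have s'I : 0 < s' < t by lra.
rewrite patchE mem_set; last by split => //=; rewrite in_itv/=.
rewrite /= lee_fin => us'A.
have : `|u s x - u s' x'| < `|u s x| - A.
  apply: dH.
  - by rewrite (ltW s0) ltW.
  - by rewrite (ltW (andP s'I).1) ltW//; lra.
  - by apply: lt_le_trans rd; move: ss'; rewrite -ball_normE.
  - apply: rV_norm_ltP => // i; rewrite !mxE; apply: lt_le_trans rd.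
    by have := xx' i; rewrite -ball_normE.
by have := ler_dist_dist (u s x) (u s' x'); have := ler_norm (`|u s x| - `|u s' x'|); lra.
Qed.

End Linfty.

Section maximal_solution.
Context {R : realType} {N : nat}.
Variables (p q sigma : R) (u0 v0 w1 w2 : 'rV[R]_N -> R).
Hypotheses (p1 : 1 < p) (q1 : 1 < q) (sigma0 : -1 < sigma < 0).
Hypotheses (Cu0 : C0 u0) (Cv0 : C0 v0) (Cw1 : C0 w1) (Cw2 : C0 w2).

(** The terms of the mild formulation that do not involve the unknowns. *)
Definition free_part (f w : 'rV[R]_N -> R) : R -> 'rV[R]_N -> R :=
  fun t x => heat_semigroup t f x + duhamel sigma (fun=> w) t x.

Lemma free_part_C0_path T f w : 0 <= T -> C0 f -> C0 w -> C0_path T (free_part f w).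
Proof.
move=> T0 Cf Cw; apply: C0_pathD; first exact: heat_semigroup_C0_path.
apply: duhamel_C0_path => //; last exact: C0_path_cst.
by case/andP: sigma0 => -> /ltW.
Qed.

Local Notation mild := (mild_solution_on p q (free_part u0 w1) (free_part v0 w2)).

Lemma continuous_uniformP T (g : R -> 'rV[R]_N -> R) :
  {within `[0, T], continuous (g : R -> {uniform 'rV[R]_N -> R})} <->
  (forall (t e : R), 0 <= t <= T -> 0 < e -> exists2 d : R, 0 < d &
      forall s : R, 0 <= s <= T -> `|t - s| < d -> forall x, `|g t x - g s x| < e).
Proof.
split=> [/subspace_continuousP cg t e tT e0|H].
  have : `[0, T]%classic t by rewrite /= in_itv.
  move=> /cg/(_ [set h : 'rV[R]_N -> R | forall x, `|g t x - h x| < e]).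
  case.
    apply/uniform_nbhs; exists [set xy | ball xy.1 e xy.2]; split.
      by rewrite -entourage_ballE; exists e.
    by move=> h /= hH x; apply: (hH x).
  move=> d /= d0 H; exists d => // s sT ts x.
  by apply: (H s) => //=; rewrite in_itv.
apply/subspace_continuousP => t; rewrite /= in_itv/= => tT P /uniform_nbhs[E [entE EP]].
move: entE; rewrite -entourage_ballE => -[e /= e0 eE].
have [d d0 dH] := H t e tT e0.
exists d => //= s ts; rewrite in_itv/= => sT; apply: EP => x _; apply: eE => /=.
exact: dH.
Qed.

Lemma is_mild_solutionP T u v : 0 <= T ->
  is_mild_solution p q sigma u0 v0 w1 w2 T u v <-> mild T u v.
Proof.
move=> T0.
have eqE r f w (g h : R -> 'rV[R]_N -> R) t x : (g t x = heat_semigroup t f x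
          + \int[lebesgue_measure]_(s in `[0, t])
              heat_semigroup (t - s) (fun y => `|h s y| `^ r) x
          + \int[lebesgue_measure]_(s in `[0, t])
              (s `^ sigma * heat_semigroup (t - s) w x)) <->
    g t x = mild_map r (free_part f w) h t x.
  rewrite /mild_map /free_part addrAC.
  rewrite (_ : \int[_]_(s in _) heat_semigroup _ _ x = duhamel 0 (pow_path r h) t x)//.
  by apply: eq_Rintegral => s _; rewrite powRr0 mul1r.
split=> [[CC cu cv Eu Ev]|[uT vT E]].
  split.
  - apply/C0_pathP => //; split=> [t tT|]; first by have [] := CC t tT.
    exact/continuous_uniformP.
  - apply/C0_pathP => //; split=> [t tT|]; first by have [] := CC t tT.
    exact/continuous_uniformP.
  - move=> t tT x; split; first exact/eqE/Eu.
    exact/eqE/Ev.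
have /(C0_pathP _ T0)[Cu cu] := uT; have /(C0_pathP _ T0)[Cv cv] := vT.
split.
- by move=> t tT; split; [exact: Cu|exact: Cv].
- exact/continuous_uniformP.
- exact/continuous_uniformP.
- by move=> t tT x; apply/eqE; have [] := E t tT x.
- by move=> t tT x; apply/eqE; have [] := E t tT x.
Qed.

Lemma exists_bound_free_part T : 0 <= T -> exists2 K : R, 0 < K & 
  forall t, 0 <= t <= T -> forall x,
    `|free_part u0 w1 t x| <= K /\ `|free_part v0 w2 t x| <= K.
Proof.
move=> T0; have [K1 K10 H1] := C0_path_bounded T0 (free_part_C0_path T0 Cu0 Cw1).
have [K2 K20 H2] := C0_path_bounded T0 (free_part_C0_path T0 Cv0 Cw2).
exists (K1 + K2); first by rewrite addr_gt0.
move=> t tT x; split.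
  by rewrite (le_trans (H1 t tT x))// lerDl ltW.
by rewrite (le_trans (H2 t tT x))// lerDr ltW.
Qed.

(** The step d is the one allowed by mild_continuation, whose constants are fixed
    by the horizon T and the bound A. *)
Lemma mild_extension (T A : R) : 0 <= T -> exists2 d : R, 0 < d &
  forall T1 u v, 0 <= T1 <= T -> mild T1 u v ->
    (forall t, 0 <= t <= T1 -> forall x, `|u t x| <= A /\ `|v t x| <= A) ->
    exists u' v', mild (T1 + d) u' v'.
Proof.
move=> T0; have T10 : 0 <= T + 1 by rewrite addr_ge0.
have [K K0 FK] := exists_bound_free_part T10.
(* room for the free parts, for the Duhamel integral over [0, T1], and for one
   more unit over [T1, T1 + d] *)
pose M' := K + T * (A `^ p + A `^ q) + 1 + `|A|.
have TA : 0 <= T * (A `^ p + A `^ q) by rewrite mulr_ge0 ?addr_ge0 ?powR_ge0.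
have M'0 : 0 < M' by rewrite /M'; have := normr_ge0 A; lra.
have D0 : 0 < M' `^ p + M' `^ q by rewrite addr_gt0 ?powR_gt0.
exists (Num.min 1 (M' `^ p + M' `^ q)^-1); first by rewrite lt_min invr_gt0 D0 ltr01.
set d := Num.min _ _; have d1 : d <= 1 by rewrite ge_min lexx.
have d0 : 0 < d by rewrite lt_min invr_gt0 D0 ltr01.
move=> T1 u v /andP[T10' T1T] uv uvA.
have Td : T1 + d <= T + 1 by rewrite lerD.
have Td0 : 0 <= T1 + d by rewrite addr_ge0// ltW.
apply: (@mild_continuation _ _ T1 (T1 + d) p q _ _ u v K A M') => //.
- by rewrite lerDl ltW.
- exact: free_part_C0_path.
- exact: free_part_C0_path.
- move=> t /andP[t0 tT] x; apply: FK; by rewrite t0 (le_trans tT).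
- rewrite /M'; have : T1 * (A `^ p + A `^ q) <= T * (A `^ p + A `^ q).
    by rewrite ler_wpM2r// addr_ge0 ?powR_ge0.
  by have := normr_ge0 A; lra.
- by rewrite /M'; have := ler_norm A; lra.
- rewrite (_ : T1 + d - T1 = d); last by ring.
  by rewrite -ler_pdivlMr// mul1r ge_min lexx orbT.
Qed.

Local Notation Tm := (Tmax p q sigma u0 v0 w1 w2).

Lemma le_Tmax T u v : 0 < T -> mild T u v -> (T%:E <= Tm)%E.
Proof.
move=> T0 uv; apply: ereal_sup_ubound; exists T => //; split => //.
by exists u, v; apply/is_mild_solutionP => //; exact: ltW.
Qed.

Lemma lt_Tmax (t : R) : (t%:E < Tm)%E -> exists T u v, [/\ 0 < T, t < T & mild T u v].
Proof.
move=> /ereal_sup_gt[_ [T [T0 [u [v uv]]] <-]]; rewrite lte_fin => tT.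
by exists T, u, v; split => //; apply/is_mild_solutionP => //; exact: ltW.
Qed.

Lemma Tmax_gt0 : (0 < Tm)%E.
Proof.
have [A A0 FA] := exists_bound_free_part (lexx 0).
have m0 : mild 0 (free_part u0 w1) (free_part v0 w2).
  split; [exact: free_part_C0_path|exact: free_part_C0_path|].
  by move=> t; rewrite -eq_le => /eqP <- x; rewrite !mild_map0.
have [d d0 H] := mild_extension A (lexx 0).
have [|u' [v' uv']] := H 0 _ _ _ m0 FA; first by rewrite !lexx.
rewrite add0r in uv'; apply: (@lt_le_trans _ _ d%:E); first by rewrite lte_fin.
exact: le_Tmax uv'.
Qed.

(** By uniqueness the value at time t can be read off any solution that lives
    beyond t. *)
Theorem exists_maximal_solution : exists u v,
  is_maximal_mild_solution p q sigma u0 v0 w1 w2 u v.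
Proof.
have H : forall t : R, exists uv : (R -> 'rV[R]_N -> R) * (R -> 'rV[R]_N -> R),
    (0 <= t -> (t%:E < Tm)%E -> exists2 T, 0 < T /\ t < T & mild T uv.1 uv.2).
  move=> t; have [tT|tT] := pselect (t%:E < Tm)%E; last by exists (fun _ _ => 0, fun _ _ => 0).
  by have [T [u [v [T0 tT' uv]]]] := lt_Tmax tT; exists (u, v) => _ _; exists T.
have [f Hf] := choice H.
exists (fun t => (f t).1 t), (fun t => (f t).2 t); split; first exact: Tmax_gt0.
move=> tau tau0 tauT; apply/is_mild_solutionP; first exact: ltW.
have [T [u [v [T0 tT uv]]]] := lt_Tmax tauT.
apply: (@eq_mild_solution_on _ _ _ _ _ _ _ u v); last first.
  by apply: mild_solution_on_le uv; exact: ltW.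
move=> t /andP[t0 ttau].
have [|T' [T'0 tT'] uv'] := Hf t t0.
  by apply: le_lt_trans tauT; rewrite lee_fin.
have tm : 0 <= t <= Num.min T T'.
  by rewrite t0 le_min (le_trans ttau (ltW tT)) ltW.
have m0 : 0 <= Num.min T T' by rewrite le_min !ltW.
have mT : Num.min T T' <= T by rewrite ge_min lexx.
have mT' : Num.min T T' <= T' by rewrite ge_min lexx orbT.
have U := mild_solution_unique m0 p1 q1 (mild_solution_on_le mT uv)
  (mild_solution_on_le mT' uv') tm.
by split; apply/funext => x; have [] := U x.
Qed.

(** Blow-up alternative: were the norms bounded along a sequence t -> Tmax, the
    solution could be continued past Tmax by mild_extension. *)
Theorem maximal_solution_blow_up u v : (Tm < +oo)%E ->
  is_maximal_mild_solution p q sigma u0 v0 w1 w2 u v ->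
  blows_up_in_finite_time p q sigma u0 v0 w1 w2 u v.
Proof.
move=> Toof [T0 max]; split => //.
have Tfin : Tm \is a fin_num by rewrite ge0_fin_numE// ltW.
set T := fine Tm; have TE : Tm = T%:E by rewrite fineK.
have Tp : 0 < T by rewrite -lte_fin -TE.
have uvT tau : 0 < tau < T -> mild tau u v.
  move=> /andP[tau0 tauT]; apply/is_mild_solutionP; first exact: ltW.
  by apply: max => //; rewrite TE lte_fin.
apply/cvgeyPger => A _; apply: contrapT => nA.
have [K K0 FK] := exists_bound_free_part (ltW Tp).
have key t : 0 < t < T -> (Linfty_norm t u + Linfty_norm t v < A%:E)%E ->
    forall s x, 0 < s < t -> `|u s x| <= A /\ `|v s x| <= A.
  move=> /andP[t0 tT] uvA s x st.
  have nu : (0 <= Linfty_norm t u)%E by exact: Lnorm_ge0.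
  have nv : (0 <= Linfty_norm t v)%E by exact: Lnorm_ge0.
  split.
    apply: (@Linfty_norm_ub _ _ u T t A (ltW tT)) => //.
      by move=> t' /uvT[].
    apply: le_trans (ltW uvA); exact: leeDl.
  apply: (@Linfty_norm_ub _ _ v T t A (ltW tT)) => //.
    by move=> t' /uvT[].
  apply: le_trans (ltW uvA); exact: leeDr.
have bnd s x : 0 < s < T -> `|u s x| <= A /\ `|v s x| <= A.
  move=> /andP[s0 sT]; apply: contrapT => nsx; apply: nA.
  exists (T - s) => /=; first by rewrite subr_gt0.
  move=> t /= tT' tT; rewrite leNgt; apply/negP => uvA; apply: nsx.
  have st : s < t by move: tT'; rewrite ger0_norm ?subr_ge0 ?(ltW tT)//; lra.
  by apply: (key t) => //; [rewrite (lt_trans s0)|rewrite s0].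
have [d d0 H] := mild_extension (Num.max A K) (ltW Tp).
pose T1 := Num.max (T / 2) (T - d / 2).
have T1T : 0 < T1 < T by rewrite lt_max gt_max divr_gt0//= -ltrBrDl; lra.
have [||u' [v' uv']] := H T1 u v _ (uvT T1 T1T).
- by have /andP[h1 h2] := T1T; rewrite !ltW.
- move=> t /andP[t0 tT1] x; have tT : t < T by apply: (le_lt_trans tT1); case/andP: T1T.
  have [t00|tn0] := eqVneq t 0; last first.
    have [|h1 h2] := bnd t x; first by rewrite lt_neqAle eq_sym tn0 t0.
    by rewrite !le_max h1 h2.
  have [_ _ E] := uvT T1 T1T.
  have tT1' : 0 <= t <= T1 by rewrite t0.
  have tT' : 0 <= t <= T by rewrite t0 ltW.
  have [-> ->] := E t tT1' x; have [h1 h2] := FK t tT' x.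
  have e1 : mild_map p (free_part u0 w1) v t x = free_part u0 w1 t x.
    by rewrite t00; exact: mild_map0.
  have e2 : mild_map q (free_part v0 w2) u t x = free_part v0 w2 t x.
    by rewrite t00; exact: mild_map0.
  have KA : K <= Num.max A K by rewrite le_max lexx orbT.
  by rewrite e1 e2; split; [exact: le_trans h1 KA|exact: le_trans h2 KA].
have : (T1 + d <= T)%R.
  rewrite -lee_fin -TE; apply: le_Tmax uv'.
  by rewrite addr_gt0//; case/andP: T1T.
have : T - d / 2 <= T1 by rewrite /T1 le_max lexx orbT.
lra.
Qed.

End maximal_solution.

(** * Growth of two functions that feed each other *)

Section growth.
Context {R : realType}.
Variables (p q T : R).
Hypotheses (p1 : 1 < p) (q1 : 1 < q).

(** A nondecreasing f that grows by 2 L over the middle third is at least L on the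
    last third or at most - L on the first. *)
Lemma third_large (f : R -> R) (s l L : R) : 0 <= l ->
  (forall r r', s <= r -> r <= r' -> r' <= s + l -> f r <= f r') ->
  2 * L <= f (s + l * (2 / 3)) - f (s + l / 3) ->
  exists2 s', s <= s' /\ s' + l / 3 <= s + l &
    forall r, s' <= r <= s' + l / 3 -> L <= `|f r|.
Proof.
move=> l0 mf fL.
have [h|h] := leP L (f (s + l * (2 / 3))).
  exists (s + l * (2 / 3)); first by split; lra.
  move=> r /andP[r1 r2]; apply: le_trans (ler_norm _); apply: (le_trans h).
  by apply: mf; lra.
exists s; first by split; lra.
move=> r /andP[r1 r2]; rewrite -normrN; apply: le_trans (ler_norm _).
have : f r <= f (s + l / 3) by apply: mf; lra.
lra.
Qed.

Variables (Y Z : R -> R).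
Hypothesis HY : forall s t L : R, 0 <= s -> s <= t -> t <= T -> 0 <= L ->
  (forall r, s <= r <= t -> L <= `|Z r|) -> L `^ p * (t - s) <= Y t - Y s.
Hypothesis HZ : forall s t L : R, 0 <= s -> s <= t -> t <= T -> 0 <= L ->
  (forall r, s <= r <= t -> L <= `|Y r|) -> L `^ q * (t - s) <= Z t - Z s.

Let monoY s t : 0 <= s -> s <= t -> t <= T -> Y s <= Y t.
Proof.
move=> s0 st tT; rewrite -subr_ge0; apply: le_trans (HY s0 st tT (lexx 0) _) => //.
by rewrite mulr_ge0 ?powR_ge0 ?subr_ge0.
Qed.

Let monoZ s t : 0 <= s -> s <= t -> t <= T -> Z s <= Z t.
Proof.
move=> s0 st tT; rewrite -subr_ge0; apply: le_trans (HZ s0 st tT (lexx 0) _) => //.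
by rewrite mulr_ge0 ?powR_ge0 ?subr_ge0.
Qed.

(** If |Y| >= L on an interval, Z grows there at rate at least L ^ q, so
    third_large makes |Z| large on a third of it; the same step from Z to Y leaves
    a ninth. *)
Lemma feedback_step (s l L : R) : 0 <= s -> 0 <= l -> s + l <= T -> 0 <= L ->
  (forall r, s <= r <= s + l -> L <= `|Y r|) ->
  exists2 s', 0 <= s' /\ s' + l / 9 <= T &
    forall r, s' <= r <= s' + l / 9 -> (L `^ q * l / 6) `^ p * l / 18 <= `|Y r|.
Proof.
move=> s0 l0 slT L0 YL.
have [||s1 [ss1 s1l] Z1] := @third_large Z s l (L `^ q * l / 6) l0.
- by move=> r r' sr rr' r'l; apply: monoZ => //; lra.
- have := @HZ (s + l / 3) (s + l * (2 / 3)) L.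
  have -> : s + l * (2 / 3) - (s + l / 3) = l / 3 by field.
  rewrite (_ : 2 * (L `^ q * l / 6) = L `^ q * (l / 3)); last by field.
  apply => //; [lra|lra|lra|].
  by move=> r /andP[r1 r2]; apply: YL; apply/andP; split; lra.
set L1 := L `^ q * l / 6 in Z1 *.
have L10 : 0 <= L1 by rewrite divr_ge0// mulr_ge0// powR_ge0.
have l30 : 0 <= l / 3 by lra.
have [||s2 [s12 s2l] Y2] := @third_large Y s1 (l / 3) (L1 `^ p * l / 18) l30.
- by move=> r r' sr rr' r'l; apply: monoY => //; lra.
- have := @HY (s1 + l / 3 / 3) (s1 + l / 3 * (2 / 3)) L1.
  have -> : s1 + l / 3 * (2 / 3) - (s1 + l / 3 / 3) = l / 9 by field.
  rewrite (_ : 2 * (L1 `^ p * l / 18) = L1 `^ p * (l / 9)); last by field.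
  apply => //; [lra|lra|lra|].
  by move=> r /andP[r1 r2]; apply: Z1; apply/andP; split; lra.
have l9 : l / 9 = l / 3 / 3 by field.
by exists s2; [split; lra|move=> r; rewrite l9; exact: Y2].
Qed.

Variable B : R.
Hypothesis YB : forall t, 0 <= t <= T -> `|Y t| <= B.

(** The exponent a for which L l ^ a, with L a lower bound of |Y| and l the length
    of the interval where it holds, obeys the closed recursion
    M' = M ^ (p q) / constant under feedback_step. *)
Definition feedback_exponent : R := (p + 1) / (p * q - 1).
Definition feedback_constant : R := 6 `^ p * 18 * 9 `^ feedback_exponent.

Let pq1 : 0 < p * q - 1 := mulB1_gt0 p1 q1.

(** If L l ^ a were above the threshold, every round of feedback would at least
    double the lower bound L of |Y|, against the bound B. *)
Theorem feedback_bounded (s l L : R) : 0 <= s -> 0 < l -> s + l <= T -> 0 < L ->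
  (forall r, s <= r <= s + l -> L <= `|Y r|) ->
  (L * l `^ feedback_exponent) `^ (p * q - 1) < 2 * feedback_constant.
Proof.
move=> s0 l0 slT L0 YL; rewrite ltNge; apply/negP => big.
set a := feedback_exponent in big; set c := feedback_constant in big.
have a0 : 0 < a by apply: divr_gt0; [rewrite addr_gt0// (lt_trans _ p1)|exact: pq1].
have c0 : 0 < c by rewrite !mulr_gt0 ?powR_gt0.
have aE : p + 1 + a = a * (p * q) by rewrite /a /feedback_exponent; field; rewrite gt_eqF.
have main n : forall (s l L : R), 0 <= s -> 0 < l -> s + l <= T -> 0 < L ->
    (forall r, s <= r <= s + l -> L <= `|Y r|) ->
    2 * c <= (L * l `^ a) `^ (p * q - 1) -> 2 ^+ n * L <= B.
  elim: n => [|n IH] {}s {}l {}L {}s0 {}l0 {}slT {}L0 {}YL {}big.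
    rewrite expr0 mul1r; apply: le_trans (YL s _) (YB _); rewrite ?lexx//=; lra.
  have [s' [s'0 s'T] Y'] := feedback_step s0 (ltW l0) slT (ltW L0) YL.
  set L' := (L `^ q * l / 6) `^ p * l / 18 in Y'.
  have L'0 : 0 < L' by rewrite !mulr_gt0 ?powR_gt0// !mulr_gt0 ?powR_gt0.
  have l90 : 0 < l / 9 by rewrite divr_gt0.
  have E : L' * (l / 9) `^ a = (L * l `^ a) * ((L * l `^ a) `^ (p * q - 1) / c).
    have M0 : 0 <= L * l `^ a by rewrite mulr_ge0 ?powR_ge0// ltW.
    rewrite mulrA mulr_powRB1//; last by move: pq1; lra.
    have l00 := ltW l0.
    have -> : (L * l `^ a) `^ (p * q) = L `^ (q * p) * (l `^ p * l * l `^ a).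
      rewrite powRM ?powR_ge0 ?(ltW L0)// -powRrM -aE (mulrC q p); congr (_ * _).
      by rewrite !(powRD_gt0 _ _ l0) powRr1.
    have e2 : (L `^ q * l / 6) `^ p = L `^ (q * p) * (l `^ p / 6 `^ p).
      by rewrite -mulrA powRM ?powR_ge0 ?divr_ge0// -powRrM powRM ?invr_ge0// powRV.
    have e3 : (l / 9) `^ a = l `^ a / 9 `^ a by rewrite powRM ?invr_ge0// powRV.
    rewrite /L' e2 e3 /c /feedback_constant -/a.
    by field; rewrite !gt_eqF ?powR_gt0.
  have M0 : 0 < L * l `^ a by rewrite mulr_gt0 ?powR_gt0.
  have double : 2 * (L * l `^ a) <= L' * (l / 9) `^ a.
    by rewrite E mulrC ler_pM2l// ler_pdivlMr.
  have LL : 2 * L <= L'.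
    have la0 : 0 < l `^ a by rewrite powR_gt0.
    rewrite -(ler_pM2r la0) -mulrA; apply: (le_trans double).
    rewrite ler_pM2l// ge0_ler_powR ?nnegrE ?(ltW a0) ?(ltW l0) ?(ltW l90)//; lra.
  apply: (@le_trans _ _ (2 ^+ n * L')).
    by rewrite exprSr -mulrA ler_pM2l// exprn_gt0.
  clearbody L'; apply: (IH s' (l / 9) L' s'0 l90 s'T L'0 Y').
  apply: (le_trans big); rewrite ge0_ler_powR ?nnegrE ?(ltW pq1) ?(ltW M0)//.
    by apply: le_trans double; rewrite mulr_ge0// ltW.
  by apply: le_trans double; rewrite ler_peMl ?(ltW M0)// ler1n.
have [n Bn] : exists n : nat, B / L < n%:R.
  by exists (Num.truncn (B / L)).+1; exact: truncnS_gt.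
have := main n s l L s0 l0 slT L0 YL big; rewrite leNgt => /negP; apply.
rewrite -ltr_pdivrMr//; apply: (lt_le_trans Bn).
by rewrite -natrX ler_nat ltnW// ltn_expl.
Qed.

End growth.

(** * The semigroup law and its commutation with Duhamel integrals *)

Section semigroup.
Context {R : realType} {N : nat}.
Implicit Types (f g : 'rV[R]_N -> R) (t s : R) (x : 'rV[R]_N).
Local Notation lam := (lebesgue_rV R N).

Lemma ge0_heat_semigroupE t f x M : 0 < t -> measurable_fun setT f ->
  (forall y, 0 <= f y <= M) ->
  ((heat_semigroup t f x)%:E = \int[lam]_y (heat_kernel t (x - y) * f y)%:E)%E.
Proof.
move=> t0 mf fM; rewrite /heat_semigroup (gt_eqF t0) /Rintegral fineK//.
have M0 : 0 <= M by have /andP[] := fM 0; exact: le_trans.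
have mk : measurable_fun setT (fun y : 'rV[R]_N => heat_kernel t (x - y)).
  by apply: measurableT_comp (measurable_rV_sub x); exact: measurable_heat_kernel.
rewrite ge0_fin_numE.
  apply: (@le_lt_trans _ _ (\int[lam]_y (M%:E * (heat_kernel t (x - y))%:E))%E).
    apply: ge0_le_integral => //.
    - by move=> y _; rewrite lee_fin mulr_ge0 ?heat_kernel_ge0//; case/andP: (fM y).
    - by apply/measurable_EFinP; exact: measurable_funM.
    - by apply: emeasurable_funM => //; exact/measurable_EFinP.
    - move=> y _; rewrite -EFinM lee_fin mulrC ler_wpM2r ?heat_kernel_ge0//.
      by case/andP: (fM y).
  rewrite ge0_integralZl//.
  - by rewrite integral_heat_kernel// mule1 ltry.
  - exact/measurable_EFinP.
  - by move=> y _; rewrite lee_fin heat_kernel_ge0.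
by apply: integral_ge0 => y _; rewrite lee_fin mulr_ge0 ?heat_kernel_ge0//; case/andP: (fM y).
Qed.

Lemma heat_semigroup_cst t (c : R) x : 0 <= t -> heat_semigroup t (fun=> c) x = c.
Proof. by move=> t0; rewrite heat_semigroup_avg// gauss_avg_cst. Qed.

Let heat_semigroup_comp_ge0 t s f x M : 0 < t -> 0 < s -> measurable_fun setT f ->
  measurable_fun setT (heat_semigroup s f) ->
  (forall y, 0 <= f y <= M) ->
  heat_semigroup t (heat_semigroup s f) x = heat_semigroup (t + s) f x.
Proof.
move=> t0 s0 mf mSf fM; have ts0 : 0 < t + s by rewrite addr_gt0.
have fM' y : `|f y| <= M by have /andP[h1 h2] := fM y; rewrite ger0_norm.
apply: EFin_inj; rewrite (ge0_heat_semigroupE _ ts0 mf fM).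
rewrite (@ge0_heat_semigroupE _ _ _ M)//; last first.
  move=> y; apply/andP; split.
    by apply: heat_semigroup_ge0 => //; [exact: ltW|move=> z; case/andP: (fM z)].
  by apply: (le_trans (ler_norm _)); apply: heat_semigroup_bound => //; exact: ltW.
have mk := @measurable_heat_kernel_sub R N.
have mkx r : measurable_fun setT (fun y : 'rV[R]_N => heat_kernel r (x - y)).
  by apply: measurableT_comp (measurable_rV_sub x); exact: measurable_heat_kernel.
pose F (z : 'rV[R]_N * 'rV[R]_N) :=
  (heat_kernel t (x - z.1) * (heat_kernel s (z.1 - z.2) * f z.2))%:E.
transitivity (\int[lam]_y \int[lam]_z F (y, z))%E.
  apply: eq_integral => y _; rewrite EFinM (ge0_heat_semigroupE _ s0 mf fM) -ge0_integralZl//.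
  - apply/measurable_EFinP; apply: measurable_funM => //.
    exact: (measurableT_comp (mk s) (measurable_pair1 y)).
  - move=> z _; rewrite lee_fin mulr_ge0 ?heat_kernel_ge0//; by case/andP: (fM z).
  - by rewrite lee_fin heat_kernel_ge0.
rewrite fubini_tonelli//; last first.
- move=> z; rewrite /F lee_fin mulr_ge0 ?heat_kernel_ge0//.
  by rewrite mulr_ge0 ?heat_kernel_ge0//; case/andP: (fM z.2).
- apply/measurable_EFinP; apply: measurable_funM.
    exact: (measurableT_comp (mkx t) measurable_fst).
  apply: measurable_funM => //; exact: (measurableT_comp mf measurable_snd).
apply: eq_integral => z _.
under eq_integral do rewrite /F/= mulrA EFinM.
rewrite ge0_integralZr//.
- by rewrite chapman_kolmogorov// EFinM.
- apply/measurable_EFinP; apply: measurable_funM => //.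
  exact: (measurableT_comp (mk s) (measurable_pair2 z)).
- by move=> y _; rewrite lee_fin mulr_ge0 ?heat_kernel_ge0.
- by rewrite lee_fin; case/andP: (fM z).
Qed.

(** Adding a constant makes f nonnegative, and then Tonelli reduces the law to
    chapman_kolmogorov. *)
Theorem heat_semigroup_comp t s f x M : 0 <= t -> 0 <= s -> C0 f ->
  (forall y, `|f y| <= M) ->
  heat_semigroup t (heat_semigroup s f) x = heat_semigroup (t + s) f x.
Proof.
move=> t0 s0 Cf fM.
have [->|tn0] := eqVneq t 0; first by rewrite /heat_semigroup eqxx add0r.
have [->|sn0] := eqVneq s 0.
  rewrite addr0; congr heat_semigroup; apply/funext => y.
  by rewrite /heat_semigroup eqxx.
have {tn0}tp : 0 < t by rewrite lt_neqAle eq_sym tn0.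
have {sn0}sp : 0 < s by rewrite lt_neqAle eq_sym sn0.
have T0 : 0 <= s <= s by rewrite s0 lexx.
have mf : measurable_fun setT f := C0_path_measurable (C0_path_cst s0 Cf) T0.
have mSf : measurable_fun setT (heat_semigroup s f).
  exact: (C0_path_measurable (heat_semigroup_C0_path s0 Cf) T0).
have M0 : 0 <= M by exact: le_trans (normr_ge0 _) (fM 0).
have mM : measurable_fun setT (fun y : 'rV[R]_N => f y + M) by exact: measurable_funD.
have fM0 y : 0 <= f y + M <= 2 * M.
  by have := fM y; rewrite ler_norml => /andP[h1 h2]; apply/andP; split; lra.
have split_const r y : 0 <= r ->
    heat_semigroup r (fun y => f y + M) y = heat_semigroup r f y + M.
  move=> r0; rewrite -[X in _ = _ + X](heat_semigroup_cst M y r0).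
  apply/eqP; rewrite -subr_eq; apply/eqP.
  rewrite (@heat_semigroupB _ _ _ _ _ (2 * M))//.
  - by congr heat_semigroup; apply/funext => z; rewrite addrK.
  - by move=> z; have /andP[h1 h2] := fM0 z; rewrite ger0_norm.
  - by move=> z; rewrite ger0_norm//; lra.
have := @heat_semigroup_comp_ge0 t s (fun y => f y + M) x (2 * M) tp sp mM.
rewrite split_const ?addr_ge0//.
have -> : heat_semigroup s (fun y => f y + M) = (fun y => heat_semigroup s f y + M).
  by apply/funext => y; rewrite split_const.
have -> : heat_semigroup t (fun y => heat_semigroup s f y + M) x =
    heat_semigroup t (heat_semigroup s f) x + M.
  rewrite -[X in _ = _ + X](heat_semigroup_cst M x t0).
  have SM y : `|heat_semigroup s f y| <= M by apply: heat_semigroup_bound.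
  apply/eqP; rewrite -subr_eq; apply/eqP.
  rewrite (@heat_semigroupB _ _ _ _ _ (2 * M))//.
  - by congr heat_semigroup; apply/funext => z; rewrite addrK.
  - exact: measurable_funD.
  - by move=> z; have := SM z; rewrite ler_norml => /andP[h1 h2];
      rewrite ger0_norm; lra.
  - by move=> z; rewrite ger0_norm//; lra.
move=> H; apply: (@addIr _ M); apply: H => //.
exact: measurable_funD.
Qed.

Lemma segment_integralZl (a b c : R) (f : R -> R) :
  lebesgue_measure.-integrable `[a, b] (fun s => (f s)%:E) ->
  (\int[lebesgue_measure]_(s in `[a, b]) (c * f s)%:E =
   c%:E * \int[lebesgue_measure]_(s in `[a, b]) (f s)%:E)%E.
Proof. by move=> fi; exact: (integralZl (measurable_segment a b) fi c). Qed.

(** Fubini in the form of Gaussian averages: the integrand is dominated by M s ^ k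
    times the Gaussian density. *)
Theorem heat_semigroup_duhamel (k T t tau : R) (g : R -> 'rV[R]_N -> R) x :
  -1 < k <= 0 -> 0 <= t <= T -> 0 <= tau -> C0_path T g ->
  heat_semigroup tau (duhamel k g t) x =
  \int[lebesgue_measure]_(s in `[0, t]) (s `^ k * heat_semigroup (tau + t - s) (g s) x).
Proof.
under [RHS]eq_Rintegral do rewrite -addrA.
move=> k10 tT tau0 gT; have /andP[k1 k0] := k10; have /andP[t0 tT'] := tT.
have T0 : 0 <= T by exact: le_trans tT'.
have [M M0 gM] := C0_path_bounded T0 gT.
have DT := duhamel_C0_path k10 T0 gT.
rewrite heat_semigroup_avg//; last exact: (C0_path_measurable DT).
pose G (s : R) z := heat_semigroup (t - clamp t s) (g (clamp t s)) (x + Num.sqrt tau *: z).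
have GM s z : `|G s z| <= M.
  have /andP[c0 ct] := clamp_itv s t0.
  apply: (heat_path_bound _ gT) => //; first by rewrite c0 (le_trans ct).
  by rewrite subr_ge0.
pose F (w : measurableTypeR R * 'rV[R]_N) :=
  (((fun s => s `^ k) \_ `[0, t]) w.1 * (heat_kernel 1 w.2 * G w.1 w.2))%:E.
have mG : measurable_fun setT (fun w : measurableTypeR R * 'rV[R]_N => G w.1 w.2).
  pose phi (w : measurableTypeR R * 'rV[R]_N) : measurableTypeR R * 'rV[R]_N :=
    (w.1, x + Num.sqrt tau *: w.2).
  have mphi : measurable_fun setT phi.
    apply: measurable_fun_pair => //=.
    exact: (measurableT_comp (measurable_rV_affine _ _) measurable_snd).
  exact: (measurableT_comp (heat_path_measurable2 gT tT (lexx t)) mphi).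
have mr : measurable_fun setT ((fun s : measurableTypeR R => s `^ k) \_ `[0, t]).
  apply/(measurable_restrictT _ _).1; first exact: measurable_segment.
  by apply: measurable_funTS; exact: measurable_powR.
have mF : measurable_fun setT F.
  apply/measurable_EFinP; apply: measurable_funM; first exact: (measurableT_comp mr measurable_fst).
  apply: measurable_funM => //.
  exact: (measurableT_comp (@measurable_heat_kernel R N 1) measurable_snd).
have maF : measurable_fun setT (fun w => `|F w|%E) by exact: measurableT_comp.
have iF : (@lebesgue_measure R \x lam)%E.-integrable setT F.
  apply/integrable12ltyP => //.
  apply: (@le_lt_trans _ _ (\int[lebesgue_measure]_s (((fun s => M * s `^ k) \_ `[0, t]) s)%:E)%E).
    apply: ge0_le_integral => //.
    - by move=> s _; apply: integral_ge0.
    - apply: (@measurable_fun_fubini_tonelli_F _ _ (measurableTypeR R) _ _ lam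
        (fun w => `|F w|%E)) => //; exact: measurableT_comp.
    - apply/measurable_EFinP/(measurable_restrictT _ _).1; first exact: measurable_segment.
      apply: measurable_funM => //.
      by apply: measurable_funTS; exact: measurable_powR.
    - move=> s _; rewrite !patchE; case: ifPn => sI; last first.
        rewrite (_ : integral _ _ _ = 0%E) ?lexx//.
        by apply: integral0_eq => z _; rewrite /F/= patchE (negbTE sI) mul0r normr0.
      apply: (@le_trans _ _ (\int[lam]_z ((M * s `^ k)%:E * (heat_kernel 1 z)%:E))%E).
        apply: ge0_le_integral => //.
        + exact: (measurableT_comp maF (measurable_pair1 s)).
        + by apply: emeasurable_funM => //; apply/measurable_EFinP; exact: measurable_heat_kernel.
        + move=> z _; rewrite /F/= patchE sI -EFinM lee_fin.
          have := heat_kernel_ge0 1 z; move: (heat_kernel 1 z) (GM s z) => k1z Gz k1z0.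
          rewrite 2!normrM (ger0_norm (powR_ge0 _ _)) (ger0_norm k1z0).
          rewrite (mulrC M) -mulrA ler_wpM2l ?powR_ge0// (mulrC M) ler_wpM2l//.
      rewrite ge0_integralZl//.
      + by rewrite integral_heat_kernel0// mule1.
      + by apply/measurable_EFinP; exact: measurable_heat_kernel.
      + by move=> z _; rewrite lee_fin heat_kernel_ge0.
      + by rewrite lee_fin mulr_ge0 ?powR_ge0// ltW.
  have ik := segment_integrableZl M (integrable_powR k1 t0).
  rewrite (_ : integral _ _ _ = (\int[lebesgue_measure]_(s in `[0%R, t]) (M * s `^ k)%:E)%E); last first.
    by rewrite [RHS]integral_mkcond; apply: eq_integral => s _; rewrite !patchE; case: ifP.
  have := integrable_fin_num (measurable_segment 0 t) ik; rewrite ge0_fin_numE//.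
  by apply: integral_ge0 => s _; rewrite lee_fin mulr_ge0 ?powR_ge0// ltW.
rewrite /gauss_avg /Rintegral.
transitivity (fine (\int[lam]_z \int[lebesgue_measure]_s F (s, z))%E).
  congr fine; apply: eq_integral => z _.
  have id_ := integrable_duhamel (x + Num.sqrt tau *: z) k1 gT tT (lexx t).
  rewrite /duhamel EFinM fineK; last exact: (integrable_fin_num (measurable_segment 0 t) id_).
  rewrite -(segment_integralZl _ id_) integral_mkcond; apply: eq_integral => s _.
  rewrite /F/= !patchE; case: ifPn; last by rewrite mul0r.
  rewrite inE/= in_itv/= => st; rewrite /G clamp_id//.
  by congr EFin; ring.
rewrite -(Fubini iF) [in RHS]integral_mkcond; congr fine; apply: eq_integral => s _.
rewrite patchE; case: ifPn => sI; last first.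
  by apply: integral0_eq => z _; rewrite /F/= patchE (negbTE sI) mul0r.
have : s \in `[0, t]%classic by [].
rewrite inE/= in_itv/= => /andP[s0 st].
have sT : 0 <= s <= T by rewrite s0 (le_trans st).
have Cg : C0 (g s) by have [+ _] := (C0_pathP g T0).1 gT; exact.
under eq_integral => z _ do rewrite /F/= patchE sI EFinM.
have sub_ts : 0 <= t - s by rewrite subr_ge0.
have Sm : measurable_fun setT (heat_semigroup (t - s) (g s)).
  have h : 0 <= t - s <= t - s by rewrite sub_ts lexx.
  exact: (C0_path_measurable (heat_semigroup_C0_path sub_ts Cg) h).
have GE z : G s z = heat_semigroup (t - s) (g s) (x + Num.sqrt tau *: z).
  by rewrite /G clamp_id// s0.
have SM y : `|heat_semigroup (t - s) (g s) y| <= M by exact: (heat_path_bound _ gT).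
have gi := gauss_integrable_shift x (Num.sqrt tau) Sm SM.
under eq_integral => z _ do rewrite GE.
rewrite integralZl// EFinM; congr (_ * _)%E.
rewrite -(@heat_semigroup_comp tau (t - s) (g s) x M)//; last by move=> y; exact: gM.
rewrite heat_semigroup_avg// /gauss_avg /Rintegral fineK//.
exact: integrable_fin_num gi.
Qed.

Lemma heat_semigroup_norm_le t f x M : 0 <= t -> measurable_fun setT f ->
  (forall y, `|f y| <= M) ->
  `|heat_semigroup t f x| <= heat_semigroup t (fun y => `|f y|) x.
Proof.
move=> t0 mf fM.
have mn : measurable_fun setT (fun y => `|f y|) by exact: measurableT_comp.
have nM y : `|(`|f y|)| <= M by rewrite normr_id.
rewrite !heat_semigroup_avg//.
have i2 := gauss_integrable_shift x (Num.sqrt t) mn nM.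
have i0 := gauss_integrable_shift x (Num.sqrt t) mf fM.
rewrite ler_norml; apply/andP; split; last first.
  by apply: gauss_avg_le => // z; exact: ler_norm.
rewrite -[leRHS]opprK lerN2 -sub0r -[X in X - _](gauss_avg_cst N) gauss_avgB//.
  apply: gauss_avg_le => //; last by move=> z; rewrite sub0r -normrN ler_norm.
  apply: (@gauss_integrable_bounded _ _ _ M).
    by apply: measurable_funB => //; exact: measurable_gauss_shift.
  by move=> z; rewrite sub0r normrN.
by apply: (@gauss_integrable_bounded _ _ _ 0) => // z; rewrite normr0.
Qed.

(** The tangent line of y ^ p at y = |S f|, integrated against the Gaussian; the
    average of |f| is at least |S f|. *)
Lemma heat_semigroup_jensen t p f x M : 1 < p -> 0 <= t -> measurable_fun setT f ->
  (forall y, `|f y| <= M) ->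
  `|heat_semigroup t f x| `^ p <= heat_semigroup t (fun y => `|f y| `^ p) x.
Proof.
move=> p1 t0 mf fM; have p0 : 0 <= p by lra.
have M0 : 0 <= M by exact: le_trans (normr_ge0 _) (fM 0).
set a := `|_|; have a0 : 0 <= a by exact: normr_ge0.
pose c := p * a `^ (p - 1).
have c0 : 0 <= c by rewrite mulr_ge0 ?powR_ge0.
have mn : measurable_fun setT (fun y => `|f y|) by exact: measurableT_comp.
have mp : measurable_fun setT (fun y => `|f y| `^ p).
  exact: (measurableT_comp (measurable_powR p) mn).
have nM y : `|(`|f y|)| <= M by rewrite normr_id.
have pM y : `|(`|f y| `^ p)| <= M `^ p.
  by rewrite ger0_norm ?powR_ge0// ge0_ler_powR ?nnegrE.
rewrite !heat_semigroup_avg//.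
have i1 := gauss_integrable_shift x (Num.sqrt t) mp pM.
have i2 := gauss_integrable_shift x (Num.sqrt t) mn nM.
have aS : a <= gauss_avg (fun z => `|f (x + Num.sqrt t *: z)|).
  by have := heat_semigroup_norm_le x t0 mf fM; rewrite [leRHS]heat_semigroup_avg.
pose h (z : 'rV[R]_N) := a `^ p - c * a + c * `|f (x + Num.sqrt t *: z)|.
have mh : measurable_fun setT h.
  apply: measurable_funD => //; apply: measurable_funM => //.
  exact: (measurable_gauss_shift x (Num.sqrt t) mn).
have ih : gauss_integrable h.
  apply: (@gauss_integrable_bounded _ _ _ (`|a `^ p - c * a| + c * M)) => // z.
  rewrite (le_trans (ler_normD _ _))// lerD// normrM normr_id (ger0_norm c0).
  by rewrite ler_wpM2l.
apply: (@le_trans _ _ (gauss_avg h)); last first.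
  apply: gauss_avg_le => // z; rewrite /h.
  have := powR_tangent p1 a0 (normr_ge0 (f (x + Num.sqrt t *: z))).
  by rewrite -/c mulrBr addrA addrAC.
have ic : gauss_integrable (fun _ : 'rV[R]_N => a `^ p - c * a).
  exact: (@gauss_integrable_bounded _ _ _ `|a `^ p - c * a|).
have icn : gauss_integrable (fun z : 'rV[R]_N => c * `|f (x + Num.sqrt t *: z)|).
  apply: (@gauss_integrable_bounded _ _ _ (c * M)).
    by apply: measurable_funM => //; exact: (measurable_gauss_shift x (Num.sqrt t) mn).
  by move=> z; rewrite normrM normr_id (ger0_norm c0) ler_wpM2l.
rewrite /h -gauss_avgD// gauss_avg_cst.
have -> : gauss_avg (fun z : 'rV[R]_N => c * `|f (x + Num.sqrt t *: z)|) =
    c * gauss_avg (fun z : 'rV[R]_N => `|f (x + Num.sqrt t *: z)|).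
  rewrite /gauss_avg -RintegralZl//.
  by apply: eq_Rintegral => z _; rewrite mulrCA.
have : c * a <= c * gauss_avg (fun z : 'rV[R]_N => `|f (x + Num.sqrt t *: z)|).
  by rewrite ler_wpM2l.
lra.
Qed.

End semigroup.

(** * Finite lifespan below the critical dimension *)

Section finite_time.
Context {R : realType} {N : nat}.
Implicit Types (T t : R) (u v : R -> 'rV[R]_N -> R) (w : 'rV[R]_N -> R).
Local Notation mu := (@lebesgue_measure R).
Local Notation lam := (lebesgue_rV R N).

(** For large t the Gaussian weight in S(t) w is nearly constant on the bulk of
    the mass of w, so that S(t) w at the origin is of order t^(-N/2) times the
    integral of w. *)
Lemma heat_semigroup_origin_lower w : lam.-integrable setT (EFin \o w) ->
  0 < \int[lam]_x w x ->
  exists2 t0 : R, 0 < t0 & forall t, t0 <= t ->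
    (4 * pi * t) `^ (- (N%:R / 2)) * ((\int[lam]_x w x) / 2) <= heat_semigroup t w 0.
Proof.
move=> iw; set I := \int[lam]_x w x => I0.
have mw : measurable_fun setT w by apply/measurable_EFinP; exact: measurable_int iw.
have inw : lam.-integrable setT (fun y => (`|w y|)%:E) by exact: (integrable_norm iw).
pose e t (y : 'rV[R]_N) := expR (- sqnorm y / (4 * t)).
have e1 t y : 0 <= t -> e t y <= 1.
  move=> t0; rewrite /e -expR0 ler_expR mulNr oppr_le0 divr_ge0 ?sqnorm_ge0//.
  by rewrite mulr_ge0.
have e0 t y : 0 <= e t y by exact: expR_ge0.
have me t : measurable_fun setT (e t).
  apply: measurableT_comp => //; apply: measurable_funM => //.
  by apply: measurableT_comp => //; exact: measurable_sqnorm.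
have bdd t (g : 'rV[R]_N -> R) : measurable_fun setT g -> 
    (forall y, `|g y| <= 1) -> lam.-integrable setT (EFin \o (fun y => g y * w y)).
  move=> mg g1; apply: le_integrable iw => //.
    by apply/measurable_EFinP; exact: measurable_funM.
  by move=> y _; rewrite /= lee_fin normrM ler_piMl.
have ie t : 0 <= t -> lam.-integrable setT (EFin \o (fun y => e t y * w y)).
  by move=> t0; apply: (bdd t) => // y; rewrite ger0_norm// e1.
pose h n (y : 'rV[R]_N) : R := (1 - e n.+1%:R y) * `|w y|.
have h0 n y : 0 <= h n y by rewrite mulr_ge0// subr_ge0 e1.
have mh n : measurable_fun setT (h n).
  apply: measurable_funM; first exact: measurable_funB.
  exact: measurableT_comp.
have hw n y : h n y <= `|w y| by rewrite ler_piMl// gerBl.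
have ih n : lam.-integrable setT (EFin \o h n).
  apply: le_integrable inw => //; first exact/measurable_EFinP.
  by move=> y _; rewrite /= lee_fin (ger0_norm (h0 n y)) normr_id.
have cvh : (fun n => \int[lam]_y (h n y)%:E)%E @ \oo --> (0%E : \bar R).
  rewrite -(integral0 lam setT).
  apply: (dominated_cvg measurableT (f := fun=> 0%E) _ _ _ inw) => //.
  - by move=> n; apply/measurable_EFinP.
  - move=> y _; apply: cvg_EFin; first exact: nearW.
    have cb : (sqnorm y * `|w y|) * harmonic n @[n --> \oo] --> (0 : R).
      by rewrite -[X in _ --> X](mulr0 (sqnorm y * `|w y|)); apply: cvgMr; exact: cvg_harmonic.
    apply: (squeeze_cvgr _ (cvg_cst 0) cb); apply: nearW => n.
    rewrite /= h0/= /h -mulrA (mulrC `|_|) mulrA ler_wpM2r//.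
    have n1 : 0 < n.+1%:R :> R by rewrite ltr0n.
    have := expR_ge1Dx (- sqnorm y / (4 * n.+1%:R)); rewrite -/(e _ _) /harmonic.
    have : sqnorm y / (4 * n.+1%:R) <= sqnorm y * n.+1%:R^-1.
      by rewrite ler_wpM2l ?sqnorm_ge0// lef_pV2 ?posrE ?mulr_gt0// ler_peMl// ?ler1n// ltW.
    rewrite mulNr; move: (sqnorm y / _) (sqnorm y / _) (e _ _) => a b c; lra.
  - by move=> n y _; rewrite /= lee_fin ger0_norm.
have [n hn] : exists n, \int[lam]_y h n y < I / 2.
  have I2 : 0 < I / 2 by rewrite divr_gt0.
  move: cvh => /fine_cvg/cvgrPdist_lt/(_ _ I2)[n _ /(_ n (leqnn n))] /=.
  rewrite sub0r normrN => hn; exists n; apply: le_lt_trans hn; exact: ler_norm.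
exists n.+1%:R => // t nt; have n0 : 0 < n.+1%:R :> R by rewrite ltr0n.
have t0 : 0 < t by exact: lt_le_trans nt.
have -> : heat_semigroup t w 0 = (4 * pi * t) `^ (- (N%:R / 2)) * \int[lam]_y (e t y * w y).
  rewrite /heat_semigroup gt_eqF// -RintegralZl//; last by apply: ie; exact: ltW.
  by apply: eq_Rintegral => y _; rewrite sub0r heat_kernelN /heat_kernel mulrA.
rewrite ler_wpM2l ?powR_ge0//.
suff : I - \int[lam]_y (e t y * w y) <= \int[lam]_y h n y by move: hn; lra.
have it := ie t (ltW t0).
rewrite -RintegralB//; apply: le_Rintegral => //.
  by have := integrableB measurableT iw it.
move=> y _; rewrite -[X in X - _]mul1r -mulrBl /h.
apply: (@le_trans _ _ ((1 - e t y) * `|w y|)).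
  by rewrite ler_wpM2l ?ler_norm// subr_ge0 e1// ltW.
rewrite ler_wpM2r// lerD2l lerN2 ler_expR !mulNr lerN2.
by rewrite ler_wpM2l ?sqnorm_ge0// lef_pV2 ?posrE ?mulr_gt0// ler_pM2l.
Qed.

Lemma heat_semigroupD T (g h : R -> 'rV[R]_N -> R) t tau x : C0_path T g -> C0_path T h -> 0 <= t <= T -> 0 <= tau ->
  heat_semigroup tau (fun y => g t y + h t y) x =
  heat_semigroup tau (g t) x + heat_semigroup tau (h t) x :> R.
Proof.
move=> gT hT tT tau0; have T0 : 0 <= T by case/andP: tT; exact: le_trans.
have [M M0 gM] := C0_path_bounded T0 gT; have [M' M'0 hM] := C0_path_bounded T0 hT.
have mg := C0_path_measurable gT tT; have mh := C0_path_measurable hT tT.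
apply/eqP; rewrite addrC -subr_eq; apply/eqP.
rewrite (@heat_semigroupB _ _ _ _ _ (M + M'))//.
- by congr heat_semigroup; apply/funext => y; rewrite addrC addKr.
- exact: measurable_funD.
- by move=> y; rewrite (le_trans (ler_normD _ _))// lerD ?gM ?hM.
- by move=> y; rewrite (le_trans (gM t tT y))// lerDl ltW.
Qed.

(** The bound on f is asked off the left end point because the convention
    0 ^ sigma = 0 breaks it at time 0 for f = s ^ sigma. *)
Lemma Rintegral_ge_cst (s t c : R) (f : R -> R) : 0 <= s -> s <= t ->
  mu.-integrable `[s, t] (fun r => (f r)%:E) ->
  (forall r, s < r <= t -> c <= f r) -> c * (t - s) <= \int[mu]_(r in `[s, t]) f r.
Proof.
move=> s0 st fi fc.
have muE : mu `]s, t]%classic = (t - s)%:E.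
  rewrite lebesgue_measure_itv/= lte_fin; case: ltP => // ts.
  by rewrite (_ : t - s = 0)//; lra.
have io : mu.-integrable `]s, t] (fun r => (f r)%:E).
  apply: integrableS fi => // r; rewrite /= !in_itv/= => /andP[/ltW -> ->] //.
have ic : mu.-integrable `]s, t] (fun=> c%:E).
  have z1 : -1 < (0:R) by lra.
  have := segment_integrableZl c (integrable_powR z1 (le_trans s0 st)).
  rewrite (_ : (fun r => (c * r `^ 0)%:E) = fun=> c%:E); last first.
    by apply/funext => r; rewrite powRr0 mulr1.
  by apply: integrableS => // r; rewrite /= !in_itv/= => /andP[/ltW/(le_trans s0) -> ->].
rewrite -(@Rintegral_itv_obnd_cbnd _ s (BRight t))//.
apply: (@le_trans _ _ (\int[mu]_(r in `]s, t]) c)).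
  have := @Rintegral_cst _ _ _ mu _ (measurable_itv `]s, t]) c.
  move=> ->; apply: (eq_ind _ (fun z => c * (t - s) <= c * z) (lexx _)).
  exact/esym/(congr1 fine muE).
apply: le_Rintegral => // r; rewrite /= in_itv/=; exact: fc.
Qed.

Variables (sigma : R).
Hypothesis (sigma0 : -1 < sigma < 0).

(** Applying S(2 T - t) to u t removes the semigroup from the Duhamel terms: the
    integrands no longer depend on t, so increments in t are integrals over
    [s, t]. *)
Lemma backward_average_increment T (p : R) u v (u0 w : 'rV[R]_N -> R) (s : R) t :
  1 < p -> C0 u0 -> C0 w -> C0_path T v ->
  (forall t, 0 <= t <= T -> u t = mild_map p (free_part sigma u0 w) v t) ->
  0 <= s -> s <= t -> t <= T ->
  heat_semigroup (2 * T - t) (u t) 0 - heat_semigroup (2 * T - s) (u s) 0 =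
  \int[mu]_(r in `[s, t]) (r `^ sigma * heat_semigroup (2 * T - r) w 0) +
  \int[mu]_(r in `[s, t]) (r `^ 0 * heat_semigroup (2 * T - r) (pow_path p v r) 0).
Proof.
move=> p1 Cu0 Cw vT uE s0 st tT; have /andP[sg1 sg0] := sigma0.
have T0 : 0 <= T by rewrite (le_trans s0)// (le_trans st).
have z1 : -1 < (0:R) by lra.
have z10 : -1 < (0:R) <= 0 by apply/andP; split; lra.
have sg10 : -1 < sigma <= 0 by apply/andP; split; lra.
have wT : C0_path T (fun=> w) by exact: C0_path_cst.
have pT := C0_path_pow T0 p1 vT.
have main r : 0 <= r <= T -> heat_semigroup (2 * T - r) (u r) 0 =
    heat_semigroup (2 * T) u0 0 +
    \int[mu]_(a in `[0, r]) (a `^ sigma * heat_semigroup (2 * T - a) w 0) +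
    \int[mu]_(a in `[0, r]) (a `^ 0 * heat_semigroup (2 * T - a) (pow_path p v a) 0).
  move=> rT; have /andP[r0 rT'] := rT.
  have tau0 : 0 <= 2 * T - r by lra.
  have D1 := heat_semigroup_C0_path T0 Cu0; have D2 := duhamel_C0_path sg10 T0 wT.
  have D3 := duhamel_C0_path z10 T0 pT.
  rewrite (uE r rT) /mild_map /free_part.
  rewrite (@heat_semigroupD T _ (duhamel 0 (pow_path p v)) r _ _ (C0_pathD D1 D2) D3 rT tau0).
  rewrite (@heat_semigroupD T _ _ r _ _ D1 D2 rT tau0).
  have [M M0 uM] := C0_path_bounded T0 (C0_path_cst T0 Cu0).
  rewrite (@heat_semigroup_comp _ _ _ _ _ _ M)//; last first.
    by move=> y; apply: (uM 0); apply/andP; split.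
  rewrite subrK (heat_semigroup_duhamel _ sg10 rT tau0 wT) (heat_semigroup_duhamel _ z10 rT tau0 pT) subrK//.
have tT2 : 0 <= t <= T by rewrite (le_trans s0).
have sT2 : 0 <= s <= T by rewrite s0 (le_trans st).
have t2T : t <= 2 * T by lra.
rewrite !main//.
rewrite (Rintegral_itv_split s0 st (integrable_duhamel 0 sg1 wT tT2 t2T)).
rewrite (Rintegral_itv_split s0 st (integrable_duhamel 0 z1 pT tT2 t2T)).
have cancel (a b1 b2 c1 c2 : R) :
  a + (b1 + b2) + (c1 + c2) - (a + b1 + c1) = b2 + c2 by ring.
exact: cancel.
Qed.

(** Jensen pulls the power out of the average of |v| ^ p, which yields the
    differential inequality Y' >= |Z| ^ p + c T ^ sigma in integrated form. *)
Lemma backward_average_feedback T (p : R) u v (u0 w : 'rV[R]_N -> R) (c s : R) t (L : R) :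
  1 < p -> C0 u0 -> C0 w -> C0_path T v ->
  (forall t, 0 <= t <= T -> u t = mild_map p (free_part sigma u0 w) v t) ->
  0 <= c -> (forall r, 0 <= r <= T -> c <= heat_semigroup (2 * T - r) w 0) ->
  0 <= s -> s <= t -> t <= T -> 0 <= L ->
  (forall r, s <= r <= t -> L <= `|heat_semigroup (2 * T - r) (v r) 0|) ->
  (c * T `^ sigma + L `^ p) * (t - s) <=
  heat_semigroup (2 * T - t) (u t) 0 - heat_semigroup (2 * T - s) (u s) 0.
Proof.
move=> p1 Cu0 Cw vT uE c0 cw s0 st tT L0 vL; have /andP[sg1 sg0] := sigma0.
rewrite (backward_average_increment p1 Cu0 Cw vT uE)// mulrDl.
have T0 : 0 <= T by rewrite (le_trans s0)// (le_trans st).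
have tT2 : 0 <= t <= T by rewrite (le_trans s0).
have t2T : t <= 2 * T by lra.
have z1 : -1 < (0:R) by lra.
have wT : C0_path T (fun=> w) by exact: C0_path_cst.
have pT := C0_path_pow T0 p1 vT.
have sub (h : R -> R) : mu.-integrable `[0, t] (fun r => (h r)%:E) ->
    mu.-integrable `[s, t] (fun r => (h r)%:E).
  by apply: integrableS => // r; rewrite /= !in_itv/= => /andP[/(le_trans s0) -> ->].
have i1 := sub _ (integrable_duhamel 0 sg1 wT tT2 t2T).
have i2 := sub _ (integrable_duhamel 0 z1 pT tT2 t2T).
apply: lerD; apply: Rintegral_ge_cst => // r /andP[sr rt].
- have r0 : 0 < r by exact: le_lt_trans sr.
  have rT : r <= T by exact: le_trans tT.
  rewrite mulrC; apply: ler_pM => //; rewrite ?powR_ge0//.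
    rewrite -(opprK sigma) !(powRN _ (- sigma)) lef_pV2 ?posrE ?powR_gt0//; last first.
      exact: lt_le_trans rT.
    by rewrite ge0_ler_powR ?nnegrE ?oppr_ge0 ?(ltW sg0)// ltW.
  by apply: cw; rewrite ltW.
- have rT : 0 <= r <= T by rewrite (le_trans s0 (ltW sr)) (le_trans rt).
  have [M M0 vM] := C0_path_bounded T0 vT.
  rewrite powRr0 mul1r.
  have h0 : 0 <= 2 * T - r by case/andP: rT; lra.
  apply: le_trans (heat_semigroup_jensen (M := M) 0 p1 h0 (C0_path_measurable vT rT) (vM r rT)).
  by rewrite ge0_ler_powR ?nnegrE//; [lra|apply: vL; rewrite ltW].
Qed.

Let lifespan_scaling (a n s I T : R) : 0 < T ->
  (8 * pi * T) `^ (- n) * (I / 2) * T `^ s * T / 6 * (T / 3) `^ a =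
  (8 * pi) `^ (- n) * (I / 2) / 6 * (3 `^ a)^-1 * T `^ (1 + s + a - n).
Proof.
move=> T0; have P0 : 0 <= 8 * (pi : R) by rewrite mulr_ge0// pi_ge0.
move: (8 * (pi : R)) P0 => P P0.
rewrite (powRM _ P0 (ltW T0)) (powRM _ (ltW T0)) ?invr_ge0// (powRV a (ler0n _ 3)).
by rewrite !(powRD_gt0 _ _ T0) (powRr1 (ltW T0)); ring.
Qed.

(** On [0, T] the forcing makes |Y| at least of order T ^ (1 + sigma - N / 2) on an
    interval of length T / 3; feedback_bounded then bounds
    T ^ (1 + sigma - N / 2 + a), whose exponent is positive. *)
Theorem mild_solution_lifespan p q (w1 w2 : 'rV[R]_N -> R) : 1 < p -> 1 < q ->
  C0 w1 -> C0 w2 ->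
  lam.-integrable setT (EFin \o w1) -> lam.-integrable setT (EFin \o w2) ->
  0 < \int[lam]_x w1 x -> 0 < \int[lam]_x w2 x ->
  N%:R / 2 < 1 + sigma + feedback_exponent p q ->
  exists2 T0 : R, 0 < T0 & forall T (u0 v0 : 'rV[R]_N -> R) u v, T0 <= T -> C0 u0 -> C0 v0 ->
    ~ mild_solution_on p q (free_part sigma u0 w1) (free_part sigma v0 w2) T u v.
Proof.
move=> p1 q1 Cw1 Cw2 iw1 iw2 I1 I2 expo.
have [t1 t10 H1] := heat_semigroup_origin_lower iw1 I1.
have [t2 t20 H2] := heat_semigroup_origin_lower iw2 I2.
set I := \int[lam]_x w1 x in I1 H1.
have pq1 := mulB1_gt0 p1 q1.
set a := feedback_exponent p q in expo.
pose g := 1 + sigma + a - N%:R / 2; have g0 : 0 < g by rewrite /g; lra.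
pose C := (8 * pi) `^ (- (N%:R / 2)) * (I / 2) / 6 * (3 `^ a)^-1.
have C0' : 0 < C.
  by rewrite !mulr_gt0 ?invr_gt0 ?powR_gt0// mulr_gt0// pi_gt0.
pose K := 2 * feedback_constant p q.
have K0 : 0 < K by rewrite !mulr_gt0 ?powR_gt0.
(* from this time on, (C T ^ g) ^ (p q - 1) is at least the bound K of
   feedback_bounded *)
pose t3 := (K `^ (p * q - 1)^-1 / C) `^ g^-1.
have t30 : 0 < t3 by rewrite powR_gt0// divr_gt0// powR_gt0.
exists (t1 + t2 + t3); first by rewrite !addr_gt0.
move=> T u0 v0 u v T0T Cu0 Cv0 [uT vT E].
have [T1 [T2 T3]] : t1 <= T /\ t2 <= T /\ t3 <= T by split; [|split]; lra.
have T0 : 0 < T by exact: lt_le_trans T1.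
pose c := (8 * pi * T) `^ (- (N%:R / 2)) * (I / 2).
have kern r : 0 <= r <= T -> (8 * pi * T) `^ (- (N%:R / 2)) <= (4 * pi * (2 * T - r)) `^ (- (N%:R / 2)).
  move=> /andP[r0 rT]; have pi0 := pi_gt0 R.
  have h : 0 < 2 * T - r by lra.
  rewrite !powRN lef_pV2 ?posrE ?powR_gt0 ?mulr_gt0// ge0_ler_powR ?nnegrE ?divr_ge0//;
    rewrite ?mulr_ge0 ?(ltW pi0) ?(ltW h) ?(ltW T0)//.
  rewrite (_ : 8 * pi * T = 4 * pi * (2 * T)); last by ring.
  by rewrite ler_pM2l ?mulr_gt0//; lra.
have c0 : 0 <= c by rewrite mulr_ge0 ?powR_ge0// divr_ge0// ltW.
have w1c r : 0 <= r <= T -> c <= heat_semigroup (2 * T - r) w1 0.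
  move=> rT; apply: (le_trans _ (H1 _ _)); last by case/andP: rT; lra.
  by rewrite ler_wpM2r ?divr_ge0 ?(ltW I1)// kern.
have w2c r : 0 <= r <= T -> 0 <= heat_semigroup (2 * T - r) w2 0.
  move=> rT; apply: (le_trans _ (H2 _ _)); last by case/andP: rT; lra.
  by rewrite mulr_ge0 ?powR_ge0// divr_ge0// ltW.
have uE t : 0 <= t <= T -> u t = mild_map p (free_part sigma u0 w1) v t.
  by move=> tT; apply/funext => x; have [] := E t tT x.
have vE t : 0 <= t <= T -> v t = mild_map q (free_part sigma v0 w2) u t.
  by move=> tT; apply/funext => x; have [] := E t tT x.
pose Y t := heat_semigroup (2 * T - t) (u t) 0; pose Z t := heat_semigroup (2 * T - t) (v t) 0.
have HY s t L : 0 <= s -> s <= t -> t <= T -> 0 <= L ->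
    (forall r, s <= r <= t -> L <= `|Z r|) -> L `^ p * (t - s) <= Y t - Y s.
  move=> s0 st tT L0 ZL.
  apply: le_trans (backward_average_feedback p1 Cu0 Cw1 vT uE c0 w1c s0 st tT L0 ZL).
  by rewrite ler_wpM2r ?subr_ge0// lerDr mulr_ge0 ?powR_ge0.
have HZ s t L : 0 <= s -> s <= t -> t <= T -> 0 <= L ->
    (forall r, s <= r <= t -> L <= `|Y r|) -> L `^ q * (t - s) <= Z t - Z s.
  move=> s0 st tT L0 YL.
  apply: le_trans (backward_average_feedback q1 Cv0 Cw2 uT vE (lexx 0) w2c s0 st tT L0 YL).
  by rewrite mul0r add0r.
have HY0 s t : 0 <= s -> s <= t -> t <= T -> c * T `^ sigma * (t - s) <= Y t - Y s.
  move=> s0 st tT.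
  apply: le_trans (backward_average_feedback p1 Cu0 Cw1 vT uE c0 w1c s0 st tT (lexx 0) _) => //.
  by rewrite ler_wpM2r ?subr_ge0// lerDl powR_ge0.
have [B B0 uB] := C0_path_bounded (ltW T0) uT.
have YB t : 0 <= t <= T -> `|Y t| <= B.
  move=> tT; apply: heat_semigroup_bound; first by case/andP: tT; lra.
    exact: (C0_path_measurable uT).
  by move=> y; exact: uB.
pose L := c * T `^ sigma * T / 6.
have L0 : 0 < L.
  by rewrite divr_gt0// !mulr_gt0 ?powR_gt0 ?invr_gt0// !mulr_gt0// pi_gt0.
have [||s [s0 sT] YL] := @third_large R Y 0 T L (ltW T0).
- move=> r r' r0 rr'; rewrite add0r => r'T; rewrite -subr_ge0.
  apply: le_trans (HY r r' 0 r0 rr' r'T (lexx 0) _) => //.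
  by rewrite mulr_ge0 ?powR_ge0 ?subr_ge0.
- rewrite !add0r.
  have := @HY0 (T / 3) (T * (2 / 3)).
  rewrite (_ : c * T `^ sigma * (T * (2 / 3) - T / 3) = 2 * L); last by rewrite /L; field.
  by apply; lra.
rewrite add0r in sT.
have T30 : 0 < T / 3 by rewrite divr_gt0.
have := feedback_bounded p1 q1 HY HZ YB s0 T30 sT L0 YL.
rewrite -/a -/K ltNge => /negP; apply.
have -> : L * (T / 3) `^ a = C * T `^ g by exact: lifespan_scaling.
have pq0 : 0 <= p * q - 1 by exact: ltW.
have Kr : 0 <= K `^ (p * q - 1)^-1 by exact: powR_ge0.
have -> : K = (K `^ (p * q - 1)^-1) `^ (p * q - 1).
  by rewrite -powRrM mulVf ?gt_eqF// powRr1// ltW.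
rewrite ge0_ler_powR ?nnegrE ?mulr_ge0 ?powR_ge0 ?(ltW C0') ?(ltW I1)//.
rewrite [leRHS]mulrC -ler_pdivrMr//.
have -> : K `^ (p * q - 1)^-1 / C = t3 `^ g.
  rewrite /t3 -powRrM mulVf; last by rewrite gt_eqF.
  by rewrite powRr1//; apply: divr_ge0 => //; exact: ltW.
by rewrite ge0_ler_powR ?nnegrE ?(ltW g0) ?(ltW t30) ?(ltW T0).
Qed.

End finite_time.

(** * Jensen's inequality and singular time weights *)

Section weighted_jensen.
Context d (T : measurableType d) (R : realType) (mu : {measure set T -> \bar R}).

(** Jensen's inequality for the measure with density m, of mass at most H: the
    tangent line of y ^ r at the mean y = I / H. *)
Lemma weighted_jensen (D : set T) (m phi : T -> R) (r H I : R) :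
  measurable D -> 1 < r -> 0 < H -> 0 <= I ->
  measurable_fun D m -> measurable_fun D phi ->
  (forall s, D s -> 0 <= m s) -> (forall s, D s -> 0 <= phi s) ->
  (\int[mu]_(s in D) (m s)%:E <= H%:E)%E ->
  (I%:E <= \int[mu]_(s in D) (m s * phi s)%:E)%E ->
  ((I `^ r)%:E <= (H `^ (r - 1))%:E * \int[mu]_(s in D) (m s * phi s `^ r)%:E)%E.
Proof.
move=> mD r1 H0 I0 mm mphi m0 phi0 mH Iphi.
pose a := I / H; have a0 : 0 <= a by rewrite divr_ge0// ltW.
have IE : I = a * H by rewrite /a divfK// gt_eqF.
clearbody a.
pose c := r * a `^ (r - 1); have c0 : 0 <= c by rewrite mulr_ge0 ?powR_ge0//; lra.
pose b := (r - 1) * a `^ r; have b0 : 0 <= b by rewrite mulr_ge0 ?powR_ge0//; lra.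
have mr : measurable_fun D (fun s => phi s `^ r) by exact: (measurableT_comp (measurable_powR r) mphi).
have tangent : (c%:E * \int[mu]_(s in D) (m s * phi s)%:E <=
    \int[mu]_(s in D) (m s * phi s `^ r)%:E + b%:E * \int[mu]_(s in D) (m s)%:E)%E.
  rewrite -!ge0_integralZl//; first last.
  - by move=> s Ds; rewrite lee_fin mulr_ge0 ?m0 ?phi0.
  - by apply/measurable_EFinP; exact: measurable_funM.
  - exact/measurable_EFinP.
  rewrite -ge0_integralD//; first last.
  - by apply/measurable_EFinP; exact: measurable_funM.
  - by move=> s Ds; rewrite lee_fin mulr_ge0 ?m0.
  - by apply/measurable_EFinP; exact: measurable_funM.
  - by move=> s Ds; rewrite lee_fin mulr_ge0 ?m0 ?powR_ge0.
  apply: ge0_le_integral => //.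
  - by move=> s Ds; rewrite -EFinM lee_fin; apply: mulr_ge0 => //; rewrite mulr_ge0 ?m0 ?phi0.
  - by apply/measurable_EFinP; apply: measurable_funM => //; exact: measurable_funM.
  - apply/measurable_EFinP; apply: measurable_funD; exact: measurable_funM.
  - move=> s Ds; rewrite -!EFinM -EFinD lee_fin.
    have := powR_tangent r1 a0 (phi0 s Ds); rewrite -/c.
    have := mulr_powRB1 a0 (lt_trans ltr01 r1).
    move=> aE h; rewrite mulrCA (mulrC b) -mulrDr ler_wpM2l ?m0// /b.
    move: h; rewrite /c -aE; move: (a `^ (r - 1)) (phi s `^ r) => A B; lra.
have cI : ((c * I)%:E <= \int[mu]_(s in D) (m s * phi s `^ r)%:E + (b * H)%:E)%E.
  rewrite !EFinM; apply: (le_trans (lee_wpmul2l _ Iphi)); first by rewrite lee_fin.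
  by apply: (le_trans tangent); rewrite leeD2l// lee_wpmul2l.
have aI : ((a `^ r * H)%:E <= \int[mu]_(s in D) (m s * phi s `^ r)%:E)%E.
  move: cI; rewrite -leeBlDr// -EFinB => /(le_trans _); apply; rewrite lee_fin.
  rewrite /c /b IE -(mulr_powRB1 a0 (lt_trans ltr01 r1)).
  by rewrite le_eqVlt; apply/orP; left; apply/eqP; ring.
rewrite (_ : I `^ r = H `^ (r - 1) * (a `^ r * H)).
  by rewrite EFinM lee_wpmul2l// lee_fin powR_ge0.
have h0 := ltW H0; rewrite IE powRM//; rewrite -(mulr_powRB1 h0 (lt_trans ltr01 r1)).
by ring.
Qed.

End weighted_jensen.

Section singular_weight.
Context {R : realType}.
Local Notation mu := (@lebesgue_measure R).

Definition weight_constant (k th : R) : R :=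
  2^-1 `^ (- th) / (k + 1) + 2^-1 `^ k / (1 - th).

Lemma weight_constant_gt0 k th : -1 < k -> th < 1 -> 0 < weight_constant k th.
Proof.
by move=> k1 th1; rewrite addr_gt0// divr_gt0 ?powR_gt0//; lra.
Qed.

Lemma measurable_weight k th (t : R) :
  measurable_fun setT (fun s : measurableTypeR R => s `^ k * (t - s) `^ (- th)).
Proof.
apply: measurable_funM; first exact: measurable_powR.
apply: (measurableT_comp (measurable_powR (- th))).
by apply: measurable_funB.
Qed.

(** Beta-type integral: each singularity is integrated on the half of [0, t]
    that contains it. *)
Lemma integral_weight_le (k th t : R) : -1 < k <= 0 -> 0 <= th < 1 -> 0 < t ->
  (\int[mu]_(s in `]0%R, t[) (s `^ k * (t - s) `^ (- th))%:E <=
   (weight_constant k th * t `^ (k + 1 - th))%:E)%E.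
Proof.
move=> /andP[k1 k0] /andP[th0 th1] t0; have t00 := ltW t0.
pose A := (t / 2) `^ (- th); pose B := (t / 2) `^ k.
have t2 : 0 < t / 2 by rewrite divr_gt0.
have mth : measurable_fun setT (fun s : measurableTypeR R => (t - s) `^ (- th)).
  apply: (measurableT_comp (measurable_powR (- th))); exact: measurable_funB.
have anti (e x y : R) : 0 <= e -> 0 < x -> x <= y -> y `^ (- e) <= x `^ (- e).
  move=> e0 x0 xy; have y0 := lt_le_trans x0 xy.
  by rewrite !powRN lef_pV2 ?posrE ?powR_gt0//; apply: ge0_ler_powR => //; rewrite nnegrE ltW.
apply: (@le_trans _ _ (\int[mu]_(s in `[0%R, t]) (A * s `^ k + B * (t - s) `^ (- th))%:E)%E).
  rewrite [leRHS]integral_itv_bndoo; last first.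
    apply/measurable_EFinP; apply: measurable_funTS.
    by apply: measurable_funD; apply: measurable_funM => //; exact: measurable_powR.
  apply: ge0_le_integral => //.
  - by move=> s _; rewrite lee_fin mulr_ge0 ?powR_ge0.
  - by apply/measurable_EFinP; apply: measurable_funTS; exact: measurable_weight.
  - apply/measurable_EFinP; apply: measurable_funTS.
    by apply: measurable_funD; apply: measurable_funM => //; exact: measurable_powR.
  - move=> s; rewrite /= in_itv/= => /andP[s0 st]; rewrite lee_fin.
    have [h|h] := leP s (t / 2).
      rewrite ler_wpDr ?mulr_ge0 ?powR_ge0// mulrC ler_wpM2r ?powR_ge0// anti//; lra.
    rewrite ler_wpDl ?mulr_ge0 ?powR_ge0// ler_wpM2r ?powR_ge0//.
    by rewrite /B -(opprK k) anti ?oppr_ge0// ltW.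
under eq_integral do rewrite EFinD.
rewrite ge0_integralD//; first last.
- by apply/measurable_EFinP; apply: measurable_funTS; apply: measurable_funM.
- by move=> s _; rewrite lee_fin mulr_ge0 ?powR_ge0.
- by apply/measurable_EFinP; apply: measurable_funTS; apply: measurable_funM => //; exact: measurable_powR.
- by move=> s _; rewrite lee_fin mulr_ge0 ?powR_ge0.
under eq_integral do rewrite EFinM.
under [X in (_ + X)%E]eq_integral do rewrite EFinM.
rewrite !ge0_integralZl//; try by rewrite lee_fin powR_ge0.
rewrite (@ge0_integral_itv_reverse _ t (fun s => s `^ (- th)))//; last by move=> s; exact: powR_ge0.
- have h1 := integral_powR_le k1 t00.
  have mth1 : -1 < - th by lra.
  have h2 := integral_powR_le mth1 t00.
  apply: (@le_trans _ _ (A%:E * (t `^ (k + 1) / (k + 1))%:E + B%:E * (t `^ (- th + 1) / (- th + 1))%:E)%E).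
    by rewrite leeD// lee_wpmul2l// lee_fin powR_ge0.
  rewrite -!EFinM -EFinD lee_fin le_eqVlt; apply/orP; left; apply/eqP.
  rewrite /A /B /weight_constant !powRM ?invr_ge0// !(powRD_gt0 _ _ t0) powRr1// (addrC (- th) 1).
  by ring.
- by apply/measurable_EFinP; exact: measurable_funTS.
- by move=> s _; rewrite lee_fin powR_ge0.
- by apply: measurable_funTS; exact: measurable_powRn.
- by move=> s _; rewrite lee_fin powR_ge0.
Qed.

End singular_weight.

(** * Smoothing of the heat semigroup in Lebesgue norms *)

Section mass.
Context {R : realType} {N : nat}.
Implicit Types (f g : 'rV[R]_N -> R) (t s : R) (x : 'rV[R]_N).
Local Notation lam := (lebesgue_rV R N).
Local Notation n := (N%:R / 2 : R).

(** The k-th power of the L^k norm, which is easier to integrate in time than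
    the norm itself. *)
Definition mass (k : R) f : \bar R := (\int[lam]_x (`|f x| `^ k)%:E)%E.

(** Tonelli, the kernel having mass one in each of its variables. *)
Lemma integral_heat_semigroup t f M : 0 < t -> measurable_fun setT f ->
  (forall y, 0 <= f y <= M) ->
  (\int[lam]_x (heat_semigroup t f x)%:E = \int[lam]_x (f x)%:E)%E.
Proof.
move=> t0 mf fM; have f0 y : 0 <= f y by case/andP: (fM y).
have mk := @measurable_heat_kernel_sub R N t.
pose F (z : 'rV[R]_N * 'rV[R]_N) := (heat_kernel t (z.1 - z.2) * f z.2)%:E.
transitivity (\int[lam]_x \int[lam]_y F (x, y))%E.
  by apply: eq_integral => x _; rewrite (ge0_heat_semigroupE x t0 mf fM).
rewrite fubini_tonelli//; last first.
- by move=> z; rewrite /F lee_fin mulr_ge0 ?heat_kernel_ge0.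
- apply/measurable_EFinP; apply: measurable_funM => //.
  exact: (measurableT_comp mf measurable_snd).
apply: eq_integral => y _; rewrite /F /=.
under eq_integral do rewrite EFinM.
rewrite ge0_integralZr//.
- under eq_integral => x _ do rewrite -heat_kernelN opprB.
  by rewrite integral_heat_kernel// mul1e.
- apply/measurable_EFinP; exact: (measurableT_comp mk (measurable_pair2 y)).
- by move=> x _; rewrite lee_fin heat_kernel_ge0.
- by rewrite lee_fin.
Qed.

Lemma heat_semigroup_le_integral t f x M : 0 < t -> measurable_fun setT f ->
  (forall y, 0 <= f y <= M) ->
  ((heat_semigroup t f x)%:E <= ((4 * pi * t) `^ (- n))%:E * \int[lam]_y (f y)%:E)%E.
Proof.
move=> t0 mf fM; have f0 y : 0 <= f y by case/andP: (fM y).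
rewrite (ge0_heat_semigroupE x t0 mf fM) -ge0_integralZl//.
- apply: ge0_le_integral => //.
  + by move=> y _; rewrite lee_fin mulr_ge0 ?heat_kernel_ge0.
  + apply/measurable_EFinP; apply: measurable_funM => //.
    by apply: measurableT_comp (measurable_rV_sub x); exact: measurable_heat_kernel.
  + by apply/measurable_EFinP; exact: measurable_funM.
  + move=> y _; rewrite -EFinM lee_fin ler_wpM2r// heat_kernel_le// ltW//.
- exact/measurable_EFinP.
- by move=> y _; rewrite lee_fin.
- by rewrite lee_fin powR_ge0.
Qed.

Lemma measurable_ge0_heat_semigroup t f M : 0 < t -> measurable_fun setT f ->
  (forall y, 0 <= f y <= M) -> measurable_fun setT (heat_semigroup t f).
Proof.
move=> t0 mf fM; have f0 y : 0 <= f y by case/andP: (fM y).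
apply/measurable_EFinP.
pose F (z : 'rV[R]_N * 'rV[R]_N) := (heat_kernel t (z.1 - z.2) * f z.2)%:E.
rewrite (_ : _ \o _ = fun x => \int[lam]_y F (x, y))%E; last first.
  by apply/funext => x; exact: ge0_heat_semigroupE t0 mf fM.
apply: measurable_fun_fubini_tonelli_F.
- apply/measurable_EFinP; apply: measurable_funM; first exact: measurable_heat_kernel_sub.
  exact: (measurableT_comp mf measurable_snd).
- by move=> z; rewrite /F lee_fin mulr_ge0 ?heat_kernel_ge0.
Qed.

Lemma heat_semigroup_jensen1 t k f x M : 1 <= k -> 0 <= t -> measurable_fun setT f ->
  (forall y, `|f y| <= M) ->
  `|heat_semigroup t f x| `^ k <= heat_semigroup t (fun y => `|f y| `^ k) x.
Proof.
rewrite le_eqVlt => /orP[/eqP<-|k1] t0 mf fM; last exact: heat_semigroup_jensen fM.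
rewrite powRr1// (_ : (fun y => _) = (fun y => `|f y|)); last first.
  by apply/funext => y; rewrite powRr1.
exact: heat_semigroup_norm_le fM.
Qed.

(** L^k - L^r smoothing: by Jensen |S f|^k is dominated by S (|f|^k), whose
    integral and supremum are both controlled by the mass of f. *)
Theorem heat_semigroup_smoothing t f M k r B : 0 < t -> C0 f ->
  (forall y, `|f y| <= M) -> 1 <= k -> k <= r -> 0 < B ->
  (mass k f <= (B `^ k)%:E)%E ->
  (mass r (heat_semigroup t f) <=
    (((4 * pi * t) `^ (- (n * (k^-1 - r^-1))) * B) `^ r)%:E)%E.
Proof.
move=> t0 Cf fM k1 kr B0 fB; have t0' := ltW t0.
have T0 : 0 <= t <= t by rewrite t0' lexx.
have mf : measurable_fun setT f := C0_path_measurable (C0_path_cst t0' Cf) T0.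
have mSf : measurable_fun setT (heat_semigroup t f).
  exact: (C0_path_measurable (heat_semigroup_C0_path t0' Cf) T0).
have k0 : 0 < k by lra.
have r0 : 0 < r by lra.
have M0 : 0 <= M by exact: le_trans (normr_ge0 _) (fM 0).
have P0 : 0 < 4 * pi * t by rewrite !mulr_gt0// pi_gt0.
have mfk : measurable_fun setT (fun y => `|f y| `^ k).
  by apply: (measurableT_comp (measurable_powR k)); exact: measurableT_comp.
have fk y : 0 <= `|f y| `^ k <= M `^ k.
  by rewrite powR_ge0/= ge0_ler_powR ?nnegrE// ltW.
have fk0 y : 0 <= `|f y| `^ k by exact: powR_ge0.
set J := heat_semigroup t (fun y => `|f y| `^ k).
have J0 x : 0 <= J x by apply: heat_semigroup_ge0 => //; exact: ltW.
pose D := (4 * pi * t) `^ (- n) * B `^ k.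
have D0 : 0 < D by rewrite mulr_gt0 ?powR_gt0.
have JD x : J x <= D.
  rewrite -lee_fin; apply: (le_trans (heat_semigroup_le_integral x t0 mfk fk)).
  by rewrite /D EFinM lee_wpmul2l// lee_fin powR_ge0.
have e0 : 0 <= r / k - 1 by rewrite subr_ge0 ler_pdivlMr// mul1r.
have mJ : measurable_fun setT J := measurable_ge0_heat_semigroup t0 mfk fk.
have pt x : `|heat_semigroup t f x| `^ r <= J x * D `^ (r / k - 1).
  have -> : `|heat_semigroup t f x| `^ r = (`|heat_semigroup t f x| `^ k) `^ (r / k).
    by rewrite -powRrM mulrC divfK// gt_eqF.
  have rk : 0 < r / k by rewrite divr_gt0.
  have SJ := heat_semigroup_jensen1 x k1 t0' mf fM.
  apply: (@le_trans _ _ (J x `^ (r / k))).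
    by rewrite ge0_ler_powR ?nnegrE ?powR_ge0 ?(ltW rk).
  by rewrite -(mulr_powRB1 (J0 x) rk) ler_wpM2l// ge0_ler_powR ?nnegrE ?(ltW D0).
apply: (@le_trans _ _ (\int[lam]_x ((D `^ (r / k - 1))%:E * (J x)%:E))%E).
  apply: ge0_le_integral => //.
  - apply/measurable_EFinP; apply: (measurableT_comp (measurable_powR r)).
    exact: measurableT_comp.
  - by apply/measurable_EFinP; exact: measurable_funM.
  - by move=> x _; rewrite -EFinM lee_fin mulrC.
rewrite ge0_integralZl//; first last.
- by rewrite lee_fin powR_ge0.
- by move=> x _; rewrite lee_fin.
- exact/measurable_EFinP.
rewrite (integral_heat_semigroup t0 mfk fk).
apply: (@le_trans _ _ ((D `^ (r / k - 1))%:E * (B `^ k)%:E)%E).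
  by rewrite lee_wpmul2l// lee_fin powR_ge0.
rewrite -EFinM lee_fin le_eqVlt; apply/orP; left; apply/eqP.
have PD : 0 <= (4 * pi * t) `^ (- n) by exact: powR_ge0.
rewrite /D; move: (4 * pi * t) P0 PD => P P0 PD.
rewrite powRM ?powR_ge0// [RHS]powRM ?powR_ge0 ?(ltW B0)// -!powRrM -mulrA -powRD; last first.
  by rewrite (gt_eqF B0) implybT.
by congr (_ `^ _ * _ `^ _); field; rewrite !gt_eqF.
Qed.

(** A crude substitute for Minkowski's inequality; the constant 4 is absorbed by
    the smallness of the data. *)
Lemma massD k f g A B : 1 <= k -> measurable_fun setT f -> measurable_fun setT g ->
  0 < A -> 0 < B -> (mass k f <= (A `^ k)%:E)%E -> (mass k g <= (B `^ k)%:E)%E ->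
  (mass k (fun x => f x + g x)%R <= ((4 * (A + B)) `^ k)%:E)%E.
Proof.
move=> k1 mf mg A0 B0 fA gB; have k0 : 0 < k by lra.
have AB : 0 < A + B by rewrite addr_gt0.
have mnk (h : 'rV[R]_N -> R) : measurable_fun setT h ->
    measurable_fun setT (fun x => (`|h x| `^ k)%:E).
  move=> mh; apply/measurable_EFinP; apply: (measurableT_comp (measurable_powR k)).
  exact: measurableT_comp.
have c0 : (0 <= (2 `^ k)%:E)%E by rewrite lee_fin powR_ge0.
apply: (@le_trans _ _ ((2 `^ k)%:E * (mass k f + mass k g))%E).
  rewrite /mass -ge0_integralD//; [|exact: mnk|exact: mnk].
  rewrite -ge0_integralZl//; last first.
    by move=> x _; rewrite -EFinD lee_fin addr_ge0 ?powR_ge0.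
    by apply: emeasurable_funD; exact: mnk.
  apply: ge0_le_integral => //.
  - by apply: mnk; exact: measurable_funD.
  - by apply: emeasurable_funM => //; apply: emeasurable_funD; exact: mnk.
  move=> x _; rewrite -EFinD -EFinM lee_fin.
  have kk := ltW k0.
  wlog fg : f g {mf mg fA gB A B A0 B0 AB} / `|f x| <= `|g x| => [H|].
    have [h|/ltW h] := leP `|f x| `|g x|; first exact: H.
    by rewrite addrC (addrC (_ `^ _)); exact: H.
  apply: (@le_trans _ _ ((2 * `|g x|) `^ k)).
    rewrite ge0_ler_powR ?nnegrE ?mulr_ge0//; apply: (le_trans (ler_normD _ _)); lra.
  by rewrite powRM// ler_wpM2l ?powR_ge0// lerDr powR_ge0.
apply: (@le_trans _ _ ((2 `^ k)%:E * ((A `^ k)%:E + (B `^ k)%:E))%E).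
  by rewrite lee_wpmul2l// leeD.
rewrite -EFinD -EFinM lee_fin.
have -> : 4 * (A + B) = 2 * (2 * (A + B)) by ring.
rewrite powRM ?mulr_ge0 ?(ltW AB)// ler_wpM2l ?powR_ge0//.
have h0 (X : R) : 0 < X -> X <= A + B -> X `^ k <= (A + B) `^ k.
  by move=> X0 XAB; rewrite ge0_ler_powR ?nnegrE ?(ltW k0) ?(ltW X0) ?(ltW AB).
apply: (@le_trans _ _ (2 * (A + B) `^ k)).
  have hA : A `^ k <= (A + B) `^ k by apply: h0 => //; rewrite lerDl ltW.
  have hB : B `^ k <= (A + B) `^ k by apply: h0 => //; rewrite lerDr ltW.
  by lra.
rewrite powRM ?(ltW AB)// ler_wpM2r ?powR_ge0//.
by rewrite -[leLHS]powRr1// ler_powR// ler1n.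
Qed.

End mass.

(** * Duhamel integrals in Lebesgue norms *)

Section singular_duhamel.
Context {R : realType} {N : nat}.
Implicit Types (g : R -> 'rV[R]_N -> R) (t s : R) (x : 'rV[R]_N).
Local Notation lam := (lebesgue_rV R N).
Local Notation mu := (@lebesgue_measure R).
Local Notation n := (N%:R / 2 : R).

Lemma duhamel_norm_le T (k t : R) g x : -1 < k -> 0 < t <= T -> C0_path T g ->
  ((`|duhamel k g t x|)%:E <=
   \int[mu]_(s in `]0%R, t[) (s `^ k * `|heat_semigroup (t - s) (g s) x|)%:E)%E.
Proof.
move=> k1 /andP[t0 tT] gT; have t00 := ltW t0.
have tT2 : 0 <= t <= T by rewrite t00.
have id_ := integrable_duhamel x k1 gT tT2 (lexx t).
have h1 := le_normr_Rintegral (measurable_segment 0 t) id_.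
rewrite -lee_fin in h1; apply: (le_trans h1); rewrite /Rintegral fineK; last first.
  exact: (integrable_fin_num (measurable_segment 0 t) (integrable_norm id_)).
rewrite integral_itv_bndoo; last first.
  apply/measurable_EFinP; apply: measurableT_comp => //.
  have := measurable_int _ id_; move/measurable_EFinP; apply: measurable_funS => //.
  by move=> s; rewrite /= !in_itv/= => /andP[/ltW -> /ltW ->].
rewrite le_eqVlt; apply/orP; left; apply/eqP; apply: eq_integral => s _.
by rewrite normrM ger0_norm ?powR_ge0.
Qed.

(** The L^r norm of s ^ k S(t - s) (g s) is at most a constant times the weight
    s ^ sigma (t - s) ^ (- th).  Jensen's inequality for this weight lets the
    L^r norm pass under the time integral, which leaves integral_weight_le. *)
Lemma duhamel_mass T (k sigma t r l th A : R) g :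
  -1 < k <= 0 -> -1 < sigma <= 0 -> 0 < t <= T -> C0_path T g ->
  1 <= l -> l < r -> th = n * (l^-1 - r^-1) -> th < 1 -> 0 < A ->
  (forall s, 0 < s < t -> (mass l (g s) <= ((A * s `^ (sigma - k)) `^ l)%:E)%E) ->
  (mass r (duhamel k g t) <=
    (((4 * pi) `^ (- th) * A * (weight_constant sigma th * t `^ (sigma + 1 - th))) `^ r)%:E)%E.
Proof.
move=> k10 sg10 tT gT l1 lr thE th1 A0 gA.
have /andP[k1 k0] := k10; have /andP[sg1 sg0] := sg10; have /andP[t0 tT'] := tT.
have t00 := ltW t0; have T0 : 0 <= T by exact: le_trans tT'.
have tT2 : 0 <= t <= T by rewrite t00.
have r1 : 1 < r by exact: le_lt_trans lr.
have l0 : 0 < l by lra.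
have r0 : 0 < r by lra.
have th0 : 0 <= th.
  rewrite thE mulr_ge0 ?divr_ge0// subr_ge0 lef_pV2 ?posrE//; exact: ltW.
have [M M0 gM] := C0_path_bounded T0 gT.
pose D : set (measurableTypeR R) := `]0, t[%classic.
have mD : measurable D by exact: measurable_itv.
pose m s := s `^ sigma * (t - s) `^ (- th).
pose w s := s `^ k / m s.
pose G s x := heat_semigroup (t - clamp t s) (g (clamp t s)) x.
have m0 s : 0 <= m s by rewrite mulr_ge0 ?powR_ge0.
have w0 s : 0 <= w s by rewrite mulr_ge0 ?powR_ge0// invr_ge0.
have mm : measurable_fun setT (m : measurableTypeR R -> R) by exact: measurable_weight.
have mw : measurable_fun setT (w : measurableTypeR R -> R).
  apply: measurable_funM; first exact: measurable_powR.
  rewrite (_ : (fun s => (m s)^-1) = fun s => (m s) `^ (-1)); last first.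
    by apply/funext => s; rewrite powR_inv1.
  exact: (measurableT_comp (measurable_powR (-1)) mm).
have mG : measurable_fun setT (fun z : measurableTypeR R * 'rV[R]_N => G z.1 z.2).
  exact: (heat_path_measurable2 gT tT2 (lexx t)).
have mnG : measurable_fun setT (fun z : measurableTypeR R * 'rV[R]_N => `|G z.1 z.2| `^ r).
  by apply: (measurableT_comp (measurable_powR r)); exact: measurableT_comp.
pose H := weight_constant sigma th * t `^ (sigma + 1 - th).
have H0 : 0 < H by rewrite mulr_gt0 ?powR_gt0// weight_constant_gt0.
have mH : (\int[mu]_(s in D) (m s)%:E <= H%:E)%E.
  by apply: integral_weight_le => //; rewrite th0.
have DE s : D s -> [/\ 0 < s, s < t & G s = heat_semigroup (t - s) (g s)].
  rewrite /D/= in_itv/= => /andP[s0 st]; split => //.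
  by rewrite /G clamp_id// !ltW.
have mpos s : D s -> 0 < m s.
  by move=> /DE[s0 st _]; rewrite mulr_gt0 ?powR_gt0// subr_gt0.
pose F (z : measurableTypeR R * 'rV[R]_N) :=
  (((fun s => m s * w s `^ r) \_ D) z.1 * `|G z.1 z.2| `^ r)%:E.
have mF : measurable_fun setT F.
  apply/measurable_EFinP; apply: measurable_funM => //.
  have mr : measurable_fun setT ((fun s => m s * w s `^ r) \_ D).
    apply/(measurable_restrictT _ _).1 => //; apply: measurable_funTS.
    by apply: measurable_funM => //; exact: (measurableT_comp (measurable_powR r) mw).
  exact: (measurableT_comp mr measurable_fst).
have F0 z : (0 <= F z)%E.
  rewrite lee_fin mulr_ge0 ?powR_ge0// patchE; case: ifP => // _.
  by rewrite mulr_ge0 ?powR_ge0.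
have jensen x : ((`|duhamel k g t x| `^ r)%:E <= (H `^ (r - 1))%:E * \int[mu]_s F (s, x))%E.
  have mGx : measurable_fun setT (fun s : measurableTypeR R => G s x).
    exact: (measurableT_comp mG (measurable_pair2 x)).
  have mphi : measurable_fun setT (fun s : measurableTypeR R => w s * `|G s x|).
    by apply: measurable_funM => //; exact: measurableT_comp.
  have -> : (\int[mu]_s F (s, x) = \int[mu]_(s in D) (m s * (w s * `|G s x|) `^ r)%:E)%E.
    rewrite [RHS]integral_mkcond; apply: eq_integral => s _; rewrite /F/= !patchE.
    by case: ifP => // _; rewrite ?mul0r// powRM// mulrA.
  apply: (@weighted_jensen _ _ _ mu D m (fun s => w s * `|G s x|) r H) => //.
  - exact: measurable_funTS.
  - exact: measurable_funTS.
  - by move=> s _; rewrite mulr_ge0.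
  apply: (le_trans (duhamel_norm_le x k1 tT gT)).
  rewrite le_eqVlt; apply/orP; left; apply/eqP; apply: eq_integral => s.
  rewrite inE => Ds; have [_ _ ->] := DE s Ds.
  by rewrite /w mulrA (mulrC (m s)) divfK// gt_eqF// mpos.
have slice s : D s -> (\int[lam]_x F (s, x) <= (m s * ((4 * pi) `^ (- th) * A) `^ r)%:E)%E.
  move=> Ds; have [s0 st GE] := DE s Ds; have ts0 : 0 < t - s by rewrite subr_gt0.
  have sT : 0 <= s <= T by rewrite (ltW s0)/= (le_trans (ltW st)).
  have Cg : C0 (g s) by have [+ _] := (C0_pathP g T0).1 gT; exact.
  rewrite /F/= patchE mem_set// GE.
  under eq_integral do rewrite EFinM.
  rewrite ge0_integralZl//; first last.
  - by rewrite lee_fin mulr_ge0 ?powR_ge0.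
  - apply/measurable_EFinP; apply: (measurableT_comp (measurable_powR r)).
    apply: measurableT_comp => //.
    have h : 0 <= t - s <= t - s by rewrite (ltW ts0) lexx.
    exact: (C0_path_measurable (heat_semigroup_C0_path (ltW ts0) Cg) h).
  have B0 : 0 < A * s `^ (sigma - k) by rewrite mulr_gt0 ?powR_gt0.
  have sm := heat_semigroup_smoothing ts0 Cg (gM s sT) l1 (ltW lr) B0 (gA s (introT andP (conj s0 st))).
  apply: (le_trans (lee_wpmul2l _ sm)); first by rewrite lee_fin mulr_ge0 ?powR_ge0.
  have E : (4 * pi) `^ (- th) * A =
      w s * ((4 * pi * (t - s)) `^ (- th) * (A * s `^ (sigma - k))).
    have p0 : 0 <= 4 * (pi : R) by rewrite mulr_ge0// pi_ge0.
    rewrite (powRM _ p0 (ltW ts0)) /w /m; move: (4 * (pi : R)) p0 => P P0.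
    have -> : s `^ (sigma - k) = s `^ sigma / s `^ k.
      by rewrite powRD ?(gt_eqF s0) ?implybT// powRN.
    by field; rewrite !gt_eqF ?powR_gt0.
  rewrite -EFinM lee_fin -thE E [X in _ <= _ * X]powRM ?mulrA//.
  by rewrite !mulr_ge0 ?powR_ge0// ltW.
apply: (@le_trans _ _ (\int[lam]_x ((H `^ (r - 1))%:E * \int[mu]_s F (s, x)))%E).
  apply: ge0_le_integral => //.
  - apply/measurable_EFinP; apply: (measurableT_comp (measurable_powR r)).
    apply: measurableT_comp => //; exact: (C0_path_measurable (duhamel_C0_path k10 T0 gT) tT2).
  - apply: emeasurable_funM => //; exact: measurable_fun_fubini_tonelli_G.
rewrite ge0_integralZl//; first last.
- by rewrite lee_fin powR_ge0.
- by move=> x _; apply: integral_ge0.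
- exact: measurable_fun_fubini_tonelli_G.
rewrite -(fubini_tonelli _ mF F0).
apply: (@le_trans _ _ ((H `^ (r - 1))%:E * ((((4 * pi) `^ (- th) * A) `^ r)%:E * H%:E))%E).
  apply: lee_wpmul2l; first by rewrite lee_fin powR_ge0.
  apply: le_trans (lee_wpmul2l _ mH); last by rewrite lee_fin powR_ge0.
  rewrite -ge0_integralZl//; first last.
  - by rewrite lee_fin powR_ge0.
  - by move=> s _; rewrite lee_fin.
  - by apply/measurable_EFinP; exact: measurable_funTS.
  rewrite [leRHS]integral_mkcond; apply: ge0_le_integral => //.
  - by move=> s _; apply: integral_ge0.
  - exact: measurable_fun_fubini_tonelli_F.
  - apply/(measurable_restrictT _ _).1 => //; apply: emeasurable_funM => //.
    by apply/measurable_EFinP; exact: measurable_funTS.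
  - move=> s _; rewrite patchE; case: ifPn => [|/negP sD].
      by rewrite inE => Ds; rewrite -EFinM mulrC; exact: slice.
    rewrite (_ : integral _ _ _ = 0%E) ?lexx//; apply: integral0_eq => x _.
    by rewrite /F/= patchE ifF ?mul0r//; apply/negP.
have p0 : 0 <= (4 * pi) `^ (- th) * A by rewrite mulr_ge0 ?powR_ge0// ltW.
rewrite -!EFinM lee_fin -/H [leRHS]powRM ?(ltW H0)//.
by rewrite -(mulr_powRB1 (ltW H0) r0) le_eqVlt; apply/orP; left; apply/eqP; ring.
Qed.

(** The counterpart of duhamel_mass for the sup norm. *)
Lemma duhamel_singular_bound T (k th t B : R) g x :
  -1 < k <= 0 -> 0 <= th < 1 -> 0 < t <= T -> C0_path T g -> 0 <= B ->
  (forall s, 0 < s < t -> `|heat_semigroup (t - s) (g s) x| <= B * (s `^ k * (t - s) `^ (- th))) ->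
  `|duhamel 0 g t x| <= B * (weight_constant k th * t `^ (k + 1 - th)).
Proof.
move=> k10 th01 tT gT B0 gB; have /andP[t0 tT'] := tT.
have z1 : -1 < (0:R) by lra.
have tT2 : 0 <= t <= T by rewrite (ltW t0).
rewrite -lee_fin; apply: (le_trans (duhamel_norm_le x z1 tT gT)).
rewrite EFinM; apply: le_trans (lee_wpmul2l _ (integral_weight_le k10 th01 t0)); last first.
  by rewrite lee_fin.
rewrite -ge0_integralZl//; first last.
- by move=> s _; rewrite lee_fin mulr_ge0 ?powR_ge0.
- by apply/measurable_EFinP; apply: measurable_funTS; exact: measurable_weight.
apply: ge0_le_integral => //.
- by move=> s _; rewrite lee_fin mulr_ge0 ?powR_ge0.
- apply/measurable_EFinP; apply: measurable_funM.
    by apply: measurable_funTS; exact: measurable_powR.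
  apply: measurableT_comp => //.
  apply: measurable_funS (heat_path_measurable x gT tT2 (lexx t)) => //.
  by move=> s; rewrite /= !in_itv/= => /andP[/ltW -> /ltW ->].
- by apply: emeasurable_funM => //; apply/measurable_EFinP; apply: measurable_funTS; exact: measurable_weight.
- move=> s; rewrite /= in_itv/= => st; rewrite -EFinM lee_fin powRr0 mul1r; exact: gB.
Qed.

End singular_duhamel.

(** * Global existence for small data *)

Section global_existence.
Context {R : realType} {N : nat}.
Implicit Types (t s : R) (x : 'rV[R]_N).
Local Notation lam := (lebesgue_rV R N).
Local Notation mu := (@lebesgue_measure R).
Local Notation n := (N%:R / 2 : R).

(** The limit case r = +oo of heat_semigroup_smoothing. *)
Lemma heat_semigroup_sup_smoothing t (f : 'rV[R]_N -> R) M k B x : 0 < t ->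
  measurable_fun setT f -> (forall y, `|f y| <= M) -> 1 <= k -> 0 < B ->
  (mass k f <= (B `^ k)%:E)%E ->
  `|heat_semigroup t f x| <= (4 * pi * t) `^ (- (n / k)) * B.
Proof.
move=> t0 mf fM k1 B0 fB; have k0 : 0 < k by lra.
have M0 : 0 <= M by exact: le_trans (normr_ge0 _) (fM 0).
have mfk : measurable_fun setT (fun y => `|f y| `^ k).
  by apply: (measurableT_comp (measurable_powR k)); exact: measurableT_comp.
have fk y : 0 <= `|f y| `^ k <= M `^ k.
  by rewrite powR_ge0/= ge0_ler_powR ?nnegrE// ltW.
have h : `|heat_semigroup t f x| `^ k <= (4 * pi * t) `^ (- n) * B `^ k.
  apply: (le_trans (heat_semigroup_jensen1 x k1 (ltW t0) mf fM)); rewrite -lee_fin.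
  apply: (le_trans (heat_semigroup_le_integral x t0 mfk fk)).
  by rewrite EFinM lee_wpmul2l// lee_fin powR_ge0.
have P0 : 0 <= 4 * pi * t by rewrite !mulr_ge0 ?pi_ge0// ltW.
move: (4 * pi * t) P0 h => P P0 h.
rewrite leNgt; apply/negP => lt; move: h; rewrite leNgt => /negP; apply.
rewrite (_ : _ * _ = (P `^ (- (n / k)) * B) `^ k); last first.
  rewrite powRM ?powR_ge0 ?(ltW B0)// -powRrM; congr (_ `^ _ * _).
  by field; rewrite gt_eqF.
by rewrite gt0_ltr_powR// nnegrE// mulr_ge0 ?powR_ge0// ltW.
Qed.

Lemma mass_pow p l (f : 'rV[R]_N -> R) : mass l (fun y => `|f y| `^ p) = mass (p * l) f.
Proof.
by apply: eq_integral => x _; rewrite ger0_norm ?powR_ge0// -powRrM.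
Qed.

(** One step of the Picard iteration preserves the self-similar decay of the
    norms: all three terms scale like t ^ rho. *)
Lemma mild_map_mass (p sigma rho r l d : R) : 1 < p -> -1 < sigma < 0 ->
  sigma < rho -> 1 <= l -> l < r -> 1 <= d -> d <= r ->
  n * (l^-1 - r^-1) = 1 + sigma - rho -> n * (d^-1 - r^-1) = - rho ->
  exists2 C : R, 0 < C & forall (u0 w : 'rV[R]_N -> R) v (E e t : R),
    0 < t -> C0 u0 -> C0 w -> C0_path t v -> 0 < E -> 0 < e ->
    (mass d u0 <= (e `^ d)%:E)%E -> (mass l w <= (e `^ l)%:E)%E ->
    (forall s, 0 < s < t -> (mass (p * l) (v s) <= ((E * s `^ (sigma / p)) `^ (p * l))%:E)%E) ->
    (mass r (mild_map p (free_part sigma u0 w) v t) <= ((C * (e + E `^ p) * t `^ rho) `^ r)%:E)%E.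
Proof.
move=> p1 sg10 sgr l1 lr d1 dr thE deE; have /andP[sg1 sg0] := sg10.
pose th := 1 + sigma - rho.
have th1 : th < 1 by rewrite /th; lra.
pose c1 := (4 * pi : R) `^ (- th) * weight_constant sigma th.
pose c0 := (4 * pi : R) `^ rho.
have pi4 : 0 < 4 * (pi : R) by rewrite mulr_gt0// pi_gt0.
have c10 : 0 < c1 by rewrite mulr_gt0 ?powR_gt0// weight_constant_gt0.
have c00 : 0 < c0 by exact: powR_gt0.
exists (16 * (c0 + c1)); first by rewrite mulr_gt0// addr_gt0.
move=> u0 w v E e t t0 Cu0 Cw vT E0 e0 mu0 mw mv.
have t00 := ltW t0; have tt : 0 < t <= t by rewrite t0 lexx.
have tt2 : 0 <= t <= t by rewrite t00 lexx.
have p0 : 0 < p by lra.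
have r1 : 1 < r by exact: le_lt_trans lr.
have r0 : 0 < r by lra.
have l0 : 0 < l by lra.
have tr0 : 0 < t `^ rho by exact: powR_gt0.
have wT : C0_path t (fun=> w) by exact: C0_path_cst.
have pT := C0_path_pow t00 p1 vT.
have z10 : -1 < (0:R) <= 0 by apply/andP; split; lra.
have sg10' : -1 < sigma <= 0 by rewrite sg1 ltW.
have Ep0 : 0 < E `^ p by exact: powR_gt0.
have rE : sigma + 1 - th = rho by rewrite /th; ring.
have [M M0 uM] := C0_path_bounded t00 (C0_path_cst t00 Cu0).
have A1 : (mass r (heat_semigroup t u0) <= ((c0 * e * t `^ rho) `^ r)%:E)%E.
  have := heat_semigroup_smoothing t0 Cu0 (uM t tt2) d1 dr e0 mu0.
  by rewrite deE opprK (powRM _ (ltW pi4) t00) -/c0 mulrAC.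
have A2 : (mass r (duhamel sigma (fun=> w) t) <= ((c1 * e * t `^ rho) `^ r)%:E)%E.
  have := @duhamel_mass R N t sigma sigma t r l th e (fun=> w) sg10' sg10' tt wT l1 lr
    (esym thE) th1 e0.
  rewrite rE (_ : _ * e * (_ * _) = c1 * e * t `^ rho); last by rewrite /c1; ring.
  by apply => s _; rewrite subrr powRr0 mulr1.
have A3 : (mass r (duhamel 0 (pow_path p v) t) <= ((c1 * E `^ p * t `^ rho) `^ r)%:E)%E.
  have := @duhamel_mass R N t 0 sigma t r l th (E `^ p) (pow_path p v) z10 sg10' tt pT l1 lr
    (esym thE) th1 Ep0.
  rewrite rE (_ : _ * E `^ p * (_ * _) = c1 * E `^ p * t `^ rho); last by rewrite /c1; ring.
  apply => s st; rewrite /pow_path mass_pow; apply: (le_trans (mv s st)).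
  have -> : (E * s `^ (sigma / p)) `^ (p * l) = (E `^ p * s `^ (sigma - 0)) `^ l.
    rewrite powRrM (powRM p (ltW E0) (powR_ge0 _ _)) -(powRrM s) subr0.
    by rewrite divfK// gt_eqF.
  exact: lexx.
clearbody c0 c1.
have m1 := C0_path_measurable (heat_semigroup_C0_path t00 Cu0) tt2.
have m2 := C0_path_measurable (duhamel_C0_path sg10' t00 wT) tt2.
have m3 := C0_path_measurable (duhamel_C0_path z10 t00 pT) tt2.
have r1' := ltW r1.
have A12 := massD r1' m1 m2 (mulr_gt0 (mulr_gt0 c00 e0) tr0) (mulr_gt0 (mulr_gt0 c10 e0) tr0) A1 A2.
have B12 : 0 < 4 * (c0 * e * t `^ rho + c1 * e * t `^ rho).
  by rewrite mulr_gt0// addr_gt0// !mulr_gt0.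
have A123 := massD r1' (measurable_funD m1 m2) m3 B12 (mulr_gt0 (mulr_gt0 c10 Ep0) tr0) A12 A3.
apply: (le_trans A123); rewrite lee_fin ge0_ler_powR ?nnegrE ?(ltW r0)//.
- by rewrite mulr_ge0// addr_ge0 ?(ltW B12)// !mulr_ge0// ltW.
- by rewrite !mulr_ge0 ?addr_ge0 ?powR_ge0 ?(ltW c00) ?(ltW c10) ?(ltW e0).
move: (E `^ p) Ep0 (t `^ rho) tr0 {A1 A2 A3 A12 A123 B12} => F F0 s s0.
have h1 : 0 <= c0 * F * s by rewrite !mulr_ge0// ltW.
have h2 : 0 <= c1 * F * s by rewrite !mulr_ge0// ltW.
lra.
Qed.

(** Interpolating the norm estimate with the sup bound M ^ b, the nonlinear
    term grows like M ^ ((a + 1) (1 - lambda)), which is below M ^ a once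
    lambda (a + 1) > 1; the time singularity stays integrable as long as
    lambda (1 + a + sigma) < 1. *)
Lemma duhamel_pow_sup (p sigma a b l la E M t : R) v x : 1 < p -> -1 < sigma < 0 ->
  0 < a -> p * b = a + 1 -> 1 <= l -> n = l * (1 + sigma + a) ->
  0 < la < 1 -> la * (1 + a + sigma) < 1 -> 0 < t -> C0_path t v -> 0 < E -> 0 < M ->
  (forall s, 0 < s < t -> (mass (p * l) (v s) <= ((E * s `^ (sigma / p)) `^ (p * l))%:E)%E) ->
  (forall s, 0 <= s <= t -> forall x, `|v s x| <= M `^ b) ->
  `|duhamel 0 (pow_path p v) t x| <=
    (4 * pi) `^ (- (la * (1 + a + sigma))) * E `^ (p * la) * M `^ ((a + 1) * (1 - la)) *
    (weight_constant (la * sigma) (la * (1 + a + sigma)) * t `^ (1 - la * (1 + a))).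
Proof.
move=> p1 sg10 a0 pb l1 nE /andP[la0 la1] th1 t0 vT E0 M0 mv vM.
have /andP[sg1 sg0] := sg10; have t00 := ltW t0.
have tt : 0 < t <= t by rewrite t0 lexx.
have p0 : 0 < p by lra.
have l0 : 0 < l by lra.
have pT := C0_path_pow t00 p1 vT.
set th := la * (1 + a + sigma) in th1 *.
have th0 : 0 <= th by rewrite /th mulr_ge0 ?(ltW la0)//; lra.
have k10 : -1 < la * sigma <= 0.
  apply/andP; split; last by rewrite nmulr_lle0// ltW.
  have : la * (- sigma) < 1 * 1 by apply: ltr_pM; lra.
  lra.
have -> : 1 - la * (1 + a) = la * sigma + 1 - th by rewrite /th; ring.
apply: (duhamel_singular_bound k10 _ tt pT) => //.
- by rewrite th0.
- by rewrite !mulr_ge0 ?powR_ge0.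
move=> s st; have /andP[s0 st'] := st.
have sT : 0 <= s <= t by rewrite !ltW.
have ts0 : 0 < t - s by rewrite subr_gt0.
have k1 : 1 <= l / la by rewrite ler_pdivlMr// mul1r; lra.
pose B := M `^ ((a + 1) * (1 - la)) * (E `^ p * s `^ sigma) `^ la.
have B0 : 0 < B by rewrite !mulr_gt0 ?powR_gt0// mulr_gt0 ?powR_gt0.
have Mb0 : 0 <= M `^ b by exact: powR_ge0.
have mB : (mass (l / la) (pow_path p v s) <= (B `^ (l / la))%:E)%E.
  rewrite /pow_path mass_pow.
  apply: (@le_trans _ _ (((M `^ b) `^ (p * l * (la^-1 - 1)))%:E * mass (p * l) (v s))%E).
    rewrite -ge0_integralZl//; first last.
    - by rewrite lee_fin powR_ge0.
    - apply/measurable_EFinP; apply: (measurableT_comp (measurable_powR _)).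
      by apply: measurableT_comp => //; exact: (C0_path_measurable vT).
    apply: ge0_le_integral => //.
    - apply/measurable_EFinP; apply: (measurableT_comp (measurable_powR _)).
      by apply: measurableT_comp => //; exact: (C0_path_measurable vT).
    - apply: emeasurable_funM => //.
      apply/measurable_EFinP; apply: (measurableT_comp (measurable_powR _)).
      by apply: measurableT_comp => //; exact: (C0_path_measurable vT).
    - move=> y _; rewrite -EFinM lee_fin [leRHS]mulrC.
      have e0 : 0 <= p * l * (la^-1 - 1).
        by rewrite !mulr_ge0 ?(ltW p0) ?(ltW l0)// subr_ge0 invf_ge1// ltW.
      have e1 : 0 < p * l by rewrite mulr_gt0.
      have -> : p * (l / la) = p * l + p * l * (la^-1 - 1) by ring.
      have [->|vn0] := eqVneq `|v s y| 0.
        rewrite powR0; last by rewrite gt_eqF// ltr_wpDr.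
        by rewrite mulr_ge0 ?powR_ge0.
      rewrite powRD ?vn0 ?implybT// ler_wpM2l ?powR_ge0//.
      by rewrite ge0_ler_powR ?nnegrE// vM.
  apply: (le_trans (lee_wpmul2l _ (mv s st))); first by rewrite lee_fin powR_ge0.
  rewrite -EFinM lee_fin le_eqVlt; apply/orP; left; apply/eqP.
  have s00 := ltW s0; have E00 := ltW E0; have M00 := ltW M0.
  rewrite /B (powRM _ E00) ?powR_ge0// [RHS]powRM ?powR_ge0// [in RHS]powRM ?powR_ge0//.
  rewrite -!powRrM [in RHS]powRM ?powR_ge0// -!powRrM.
  congr (_ `^ _ * (_ `^ _ * _ `^ _)).
  - rewrite [LHS](_ : _ = (p * b) * (l * (la^-1 - 1))); last by ring.
    by rewrite pb; field; rewrite gt_eqF.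
  - by field; rewrite gt_eqF.
  - by field; rewrite !gt_eqF.
have [M' M'0 pM] := C0_path_bounded t00 pT.
apply: (le_trans (heat_semigroup_sup_smoothing x ts0 (C0_path_measurable pT sT) (pM s sT) k1 B0 mB)).
have -> : n / (l / la) = th by rewrite nE /th; field; rewrite !gt_eqF.
have P0 : 0 <= 4 * (pi : R) by rewrite mulr_ge0// pi_ge0.
rewrite (powRM _ P0 (ltW ts0)) /B (powRM _ (powR_ge0 _ _) (powR_ge0 _ _)) -!powRrM.
by rewrite le_eqVlt; apply/orP; left; apply/eqP; rewrite (mulrC sigma); ring.
Qed.

Lemma powR_dominates (K C e a : R) : 0 <= K -> 0 <= C -> 0 <= e -> e < a ->
  exists2 M0 : R, 1 <= M0 & forall M, M0 <= M -> K + C * M `^ e <= M `^ a.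
Proof.
move=> K0 C0 e0 ea; have d0 : 0 < a - e by rewrite subr_gt0.
exists (1 + (K + C) `^ (a - e)^-1); first by rewrite lerDl powR_ge0.
move=> M hM; have KC : 0 <= (K + C) `^ (a - e)^-1 by exact: powR_ge0.
have M1 : 1 <= M by lra.
have M0 : 0 < M by lra.
have Me1 : 1 <= M `^ e by rewrite -(powRr0 M) ler_powR.
have h : K + C <= M `^ (a - e).
  rewrite -[leLHS](@powRr1 _ (K + C)) ?addr_ge0// -[X in _ `^ X](@mulVf _ (a - e)) ?gt_eqF//.
  by rewrite powRrM ge0_ler_powR ?nnegrE ?(ltW d0) ?(ltW M0)//; lra.
have -> : M `^ a = M `^ (a - e) * M `^ e.
  by rewrite -powRD ?subrK// (gt_eqF M0) implybT.
have : (K + C) * M `^ e <= M `^ (a - e) * M `^ e by rewrite ler_wpM2r ?powR_ge0.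
have : K * 1 <= K * M `^ e by rewrite ler_wpM2l.
lra.
Qed.

Lemma powR_small (C r : R) : 0 < C -> 1 < r ->
  exists2 E0 : R, 0 < E0 & forall E : R, 0 < E <= E0 -> C * E `^ r <= E / 2.
Proof.
move=> C0' r1; have d0 : 0 < r - 1 by lra.
have iC : 0 < (2 * C)^-1 by rewrite invr_gt0 mulr_gt0.
exists ((2 * C)^-1 `^ (r - 1)^-1); first exact: powR_gt0.
move=> E /andP[E0 EE]; have r0 : 0 < r by lra.
rewrite -(mulr_powRB1 (ltW E0) r0).
have : E `^ (r - 1) <= (2 * C)^-1.
  have <- : ((2 * C)^-1 `^ (r - 1)^-1) `^ (r - 1) = (2 * C)^-1.
    by rewrite -powRrM mulVf ?gt_eqF// powRr1// ltW.
  by rewrite ge0_ler_powR ?nnegrE ?powR_ge0 ?(ltW d0) ?(ltW E0).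
rewrite -(ler_pM2l (mulr_gt0 C0' E0)) mulrA => /le_trans; apply.
by rewrite le_eqVlt; apply/orP; left; apply/eqP; field; rewrite gt_eqF.
Qed.

Lemma exists_interpolation (a sigma : R) : 0 < a -> -1 < sigma < 0 ->
  exists2 la : R, 0 < la < 1 & 1 < la * (1 + a) /\ la * (1 + a + sigma) < 1.
Proof.
move=> a0 /andP[sg1 sg0]; pose m := Num.max 1 (1 + a + sigma).
have m1 : 1 <= m by rewrite le_max lexx.
have m2 : 1 + a + sigma <= m by rewrite le_max lexx orbT.
have m3 : m < 1 + a by rewrite gt_max; apply/andP; split; lra.
clearbody m; have D0 : 0 < 1 + a + m by lra.
(* any value strictly between 1 / (1 + a) and 1 / m would do *)
exists (2 / (1 + a + m)).
  by rewrite divr_gt0//= ltr_pdivrMr// mul1r; lra.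
split; first by rewrite mulrAC ltr_pdivlMr// mul1r; lra.
by rewrite mulrAC ltr_pdivrMr// mul1r; lra.
Qed.

(** The factor t ^ (1 - lambda (1 + a)) of duhamel_pow_sup has a negative exponent,
    so it is bounded after time t0, uniformly in t. *)
Lemma duhamel_pow_sublinear (p sigma a b l E t0 : R) : 1 < p -> -1 < sigma < 0 ->
  0 < a -> p * b = a + 1 -> 1 <= l -> n = l * (1 + sigma + a) -> 0 < E -> 0 < t0 ->
  exists e C : R, [/\ 0 <= e, e < a, 0 <= C & forall (M t : R) v x,
    t0 <= t -> 0 < M -> C0_path t v ->
    (forall s, 0 < s < t -> (mass (p * l) (v s) <= ((E * s `^ (sigma / p)) `^ (p * l))%:E)%E) ->
    (forall s, 0 <= s <= t -> forall x, `|v s x| <= M `^ b) ->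
    `|duhamel 0 (pow_path p v) t x| <= C * M `^ e].
Proof.
move=> p1 sg10 a0 pb l1 nE E0 t00.
have [la la01 [la1 la2]] := exists_interpolation a0 sg10.
exists ((a + 1) * (1 - la)), ((4 * pi) `^ (- (la * (1 + a + sigma))) * E `^ (p * la) *
  (weight_constant (la * sigma) (la * (1 + a + sigma)) * t0 `^ (1 - la * (1 + a)))).
have /andP[lap lalt] := la01; have /andP[sg1 sg0] := sg10.
have W0 : 0 <= weight_constant (la * sigma) (la * (1 + a + sigma)).
  apply/ltW/weight_constant_gt0 => //.
  have : la * (- sigma) < 1 * 1 by apply: ltr_pM; lra.
  by lra.
split.
- by rewrite mulr_ge0//; lra.
- by lra.
- by rewrite !mulr_ge0 ?powR_ge0.
move=> M t v x t0t M0 vT mv vM; have tp : 0 < t by exact: lt_le_trans t0t.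
apply: (le_trans (duhamel_pow_sup x p1 sg10 a0 pb l1 nE la01 la2 tp vT E0 M0 mv vM)).
have tt0 : t `^ (1 - la * (1 + a)) <= t0 `^ (1 - la * (1 + a)).
  have -> : 1 - la * (1 + a) = - (la * (1 + a) - 1) by ring.
  rewrite !powRN lef_pV2 ?posrE ?powR_gt0// ge0_ler_powR ?nnegrE ?(ltW tp) ?(ltW t00)//.
  by rewrite subr_ge0 ltW.
rewrite [leRHS]mulrAC ler_wpM2l ?mulr_ge0 ?powR_ge0//.
by rewrite ler_wpM2l.
Qed.

Lemma exists_sup_level (K Ka Kb ea eb a b M0 : R) : 0 <= K -> 0 <= Ka -> 0 <= Kb ->
  0 <= ea -> ea < a -> 0 <= eb -> eb < b -> 0 <= M0 ->
  exists2 M : R, 0 < M & [/\ K + Ka * M `^ ea <= M `^ a, K + Kb * M `^ eb <= M `^ b,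
    M0 <= M `^ a & M0 <= M `^ b].
Proof.
move=> K0 Ka0 Kb0 ea0 eaa eb0 ebb M00.
have a0 : 0 < a by exact: le_lt_trans eaa.
have b0 : 0 < b by exact: le_lt_trans ebb.
have [Ma Ma1 HMa] := powR_dominates K0 Ka0 ea0 eaa.
have [Mb Mb1 HMb] := powR_dominates K0 Kb0 eb0 ebb.
have [Mc Mc1 HMc] := powR_dominates M00 (lexx 0) (lexx 0) a0.
have [Md Md1 HMd] := powR_dominates M00 (lexx 0) (lexx 0) b0.
exists (Ma + Mb + Mc + Md); first by lra.
split; [apply: HMa; lra|apply: HMb; lra| |].
  by have := HMc (Ma + Mb + Mc + Md); rewrite mul0r addr0; apply; lra.
by have := HMd (Ma + Mb + Mc + Md); rewrite mul0r addr0; apply; lra.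
Qed.

(** The exponents d = n / a, l = n / (1 + sigma + a) and
    r = q n / (1 + sigma + b) = n / (a + sigma / q) are the ones for which
    mild_map_mass applies with rho = sigma / q. *)
Lemma mild_map_exponents (p q sigma a b : R) : 1 < p -> 1 < q -> -1 < sigma < 0 ->
  0 < a -> 0 < b -> q * a = b + 1 -> 1 + sigma + a <= n ->
  exists2 C : R, 0 < C & forall (u0 w : 'rV[R]_N -> R) v (E e t : R),
    0 < t -> C0 u0 -> C0 w -> C0_path t v -> 0 < E -> 0 < e ->
    (mass (n / a) u0 <= (e `^ (n / a))%:E)%E ->
    (mass (n / (1 + sigma + a)) w <= (e `^ (n / (1 + sigma + a)))%:E)%E ->
    (forall s, 0 < s < t -> (mass (p * (n / (1 + sigma + a))) (v s) <=
      ((E * s `^ (sigma / p)) `^ (p * (n / (1 + sigma + a))))%:E)%E) ->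
    (mass (q * (n / (1 + sigma + b))) (mild_map p (free_part sigma u0 w) v t) <=
      ((C * (e + E `^ p) * t `^ (sigma / q)) `^ (q * (n / (1 + sigma + b))))%:E)%E.
Proof.
move=> p1 q1 sg10 a0 b0 qa na; have /andP[sg1 sg0] := sg10.
have q0 : 0 < q by lra.
have n0 : 0 < n by lra.
have X0 : 0 < 1 + sigma + a by lra.
have bE : b = q * a - 1 by lra.
have Y0 : 0 < a + sigma / q.
  have : 0 < q * a + sigma by lra.
  rewrite (_ : a + sigma / q = (q * a + sigma) / q); last by field; rewrite gt_eqF.
  by move=> h; rewrite divr_gt0.
have sq0 : sigma / q < 0 by rewrite pmulr_llt0// invr_gt0.
have sq1 : sigma < sigma / q by rewrite ltr_pdivlMr// gtr_nMr.
have -> : q * (n / (1 + sigma + b)) = n / (a + sigma / q).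
  have h : 1 + sigma + b != 0 by rewrite gt_eqF//; lra.
  have h' : a + sigma / q != 0 by rewrite gt_eqF.
  move: h h'; rewrite bE (_ : 1 + sigma + (q * a - 1) = q * (a + sigma / q)); last first.
    by field; rewrite gt_eqF.
  move: (a + sigma / q) => Y _ h'; field; by rewrite h' gt_eqF.
have anti (A B : R) : 0 < B -> B < A -> n / A < n / B.
  by move=> B0 BA; rewrite ltr_pM2l// ltf_pV2 ?posrE//; exact: lt_trans BA.
have le1 (A : R) : 0 < A -> A <= n -> 1 <= n / A by move=> A0 An; rewrite ler_pdivlMr// mul1r.
have expo (m A B : R) : 0 < m -> m * ((m / A)^-1 - (m / B)^-1) = A - B.
  by move=> m0; rewrite !invf_div mulrBr !(mulrC m) !divfK// gt_eqF.
apply: mild_map_mass => //.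
- exact: le1.
- by apply: anti => //; lra.
- by apply: le1 => //; lra.
- by apply/ltW/anti => //; lra.
- by rewrite expo//; ring.
- by rewrite expo//; ring.
Qed.

Variables (p q sigma : R).
Hypotheses (p1 : 1 < p) (q1 : 1 < q) (sigma0 : -1 < sigma < 0).

Let a := feedback_exponent p q.
Let b := feedback_exponent q p.
Let d1 := n / a.
Let d2 := n / b.
Let k1 := n / (1 + sigma + a).
Let k2 := n / (1 + sigma + b).

(** From a zero initial guess the Picard iterates satisfy, at every time t > 0,
    |u_n|_(q k2) <= E t ^ (sigma / q) and |v_n|_(p k1) <= E t ^ (sigma / p).
    This turns into bounds |u_n| <= M ^ a and |v_n| <= M ^ b on [0, T], with M
    independent of n, and picard_limit applies on every [0, T] to the same
    sequence. *)
Theorem global_existence : 1 + sigma + a <= n -> 1 + sigma + b <= n ->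
  exists2 e : R, 0 < e & forall u0 v0 w1 w2 : 'rV[R]_N -> R,
    C0 u0 -> C0 v0 -> C0 w1 -> C0 w2 ->
    (mass d1 u0 <= (e `^ d1)%:E)%E -> (mass d2 v0 <= (e `^ d2)%:E)%E ->
    (mass k1 w1 <= (e `^ k1)%:E)%E -> (mass k2 w2 <= (e `^ k2)%:E)%E ->
    exists u v, forall T, 0 <= T ->
      mild_solution_on p q (free_part sigma u0 w1) (free_part sigma v0 w2) T u v.
Proof.
move=> na nb; have /andP[sg1 sg0] := sigma0.
have pp : 0 < p by move: p1; lra.
have qp : 0 < q by move: q1; lra.
have pq1 := mulB1_gt0 p1 q1.
have qp1 := mulB1_gt0 q1 p1.
have a0 : 0 < a by apply: divr_gt0 => //; rewrite addr_gt0.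
have b0 : 0 < b by apply: divr_gt0 => //; rewrite addr_gt0.
have pb : p * b = a + 1.
  rewrite /a /b /feedback_exponent [q * p]mulrC; field; by rewrite gt_eqF.
have qa : q * a = b + 1.
  rewrite /a /b /feedback_exponent [q * p]mulrC; field; by rewrite gt_eqF.
clearbody a b.
have n0 : 0 < n by lra.
have sa0 : 0 < 1 + sigma + a by lra.
have sb0 : 0 < 1 + sigma + b by lra.
have k10 : 0 < k1 by rewrite divr_gt0.
have k20 : 0 < k2 by rewrite divr_gt0.
have [C1 C10 H1] : exists2 C : R, 0 < C & forall (u0 w : 'rV[R]_N -> R) v (E e t : R),
    0 < t -> C0 u0 -> C0 w -> C0_path t v -> 0 < E -> 0 < e ->
    (mass d1 u0 <= (e `^ d1)%:E)%E -> (mass k1 w <= (e `^ k1)%:E)%E ->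
    (forall s, 0 < s < t -> (mass (p * k1) (v s) <= ((E * s `^ (sigma / p)) `^ (p * k1))%:E)%E) ->
    (mass (q * k2) (mild_map p (free_part sigma u0 w) v t) <=
      ((C * (e + E `^ p) * t `^ (sigma / q)) `^ (q * k2))%:E)%E.
  exact: mild_map_exponents p1 q1 sigma0 a0 b0 qa na.
have [C2 C20 H2] : exists2 C : R, 0 < C & forall (u0 w : 'rV[R]_N -> R) v (E e t : R),
    0 < t -> C0 u0 -> C0 w -> C0_path t v -> 0 < E -> 0 < e ->
    (mass d2 u0 <= (e `^ d2)%:E)%E -> (mass k2 w <= (e `^ k2)%:E)%E ->
    (forall s, 0 < s < t -> (mass (q * k2) (v s) <= ((E * s `^ (sigma / q)) `^ (q * k2))%:E)%E) ->
    (mass (p * k1) (mild_map q (free_part sigma u0 w) v t) <=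
      ((C * (e + E `^ q) * t `^ (sigma / p)) `^ (p * k1))%:E)%E.
  exact: mild_map_exponents q1 p1 sigma0 b0 a0 pb nb.
have [Ea Ea0 HEa] := powR_small C10 p1; have [Eb Eb0 HEb] := powR_small C20 q1.
(* E absorbs the superlinear terms, after which e absorbs the data *)
pose E := Num.min Ea Eb.
have E0 : 0 < E by rewrite lt_min Ea0.
have EEa : C1 * E `^ p <= E / 2 by apply: HEa; rewrite E0 ge_min lexx.
have EEb : C2 * E `^ q <= E / 2 by apply: HEb; rewrite E0 ge_min lexx orbT.
clearbody E.
pose e := Num.min (E / 2 / C1) (E / 2 / C2).
have e0 : 0 < e by rewrite lt_min !divr_gt0.
have eC1 : C1 * (e + E `^ p) <= E.
  have : C1 * e <= E / 2 by rewrite mulrC -ler_pdivlMr// ge_min lexx.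
  by rewrite mulrDr; lra.
have eC2 : C2 * (e + E `^ q) <= E.
  have : C2 * e <= E / 2 by rewrite mulrC -ler_pdivlMr// ge_min lexx orbT.
  by rewrite mulrDr; lra.
clearbody e; exists e => // u0 v0 w1 w2 Cu0 Cv0 Cw1 Cw2 mu0 mv0 mw1 mw2.
set F1 := free_part sigma u0 w1; set F2 := free_part sigma v0 w2.
have F1T T : 0 <= T -> C0_path T F1 by move=> T0; exact: free_part_C0_path.
have F2T T : 0 <= T -> C0_path T F2 by move=> T0; exact: free_part_C0_path.
pose z (_ : R) (_ : 'rV[R]_N) : R := 0.
have zT T : C0_path T z by exact: C0_path0.
have [P PD] : exists P, P = picard p q F1 F2 z z by eexists.
have PT n T : 0 <= T -> C0_path T (P n).1 /\ C0_path T (P n).2.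
  by move=> T0; rewrite PD; apply: picard_C0_path => //; [exact: F1T|exact: F2T].
have PS n : P n.+1 = (mild_map p F1 (P n).2, mild_map q F2 (P n).1) by rewrite PD.
have P0 : P 0%N = (z, z) by rewrite PD.
have mz (r B : R) : 0 < r -> 0 <= B -> (mass r (z 0%R) <= (B `^ r)%:E)%E.
  move=> r0 B0; rewrite /mass integral0_eq ?lee_fin ?powR_ge0// => x _.
  by rewrite normr0 powR0// gt_eqF.
have mono C (r B s : R) : 0 < r -> 0 <= C -> C <= B -> 0 <= s -> (((C * s) `^ r)%:E <= ((B * s) `^ r)%:E)%E.
  move=> r0 C0' CB s0; rewrite lee_fin ge0_ler_powR ?nnegrE ?mulr_ge0 ?(ltW r0)//.
    exact: le_trans CB.
  by rewrite ler_wpM2r.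
have qk0 : 0 < q * k2 by exact: mulr_gt0.
have pk0 : 0 < p * k1 by exact: mulr_gt0.
have masses n : forall t, 0 < t ->
    (mass (q * k2) ((P n).1 t) <= ((E * t `^ (sigma / q)) `^ (q * k2))%:E)%E /\
    (mass (p * k1) ((P n).2 t) <= ((E * t `^ (sigma / p)) `^ (p * k1))%:E)%E.
  elim: n => [|n IH] t t0.
    by rewrite P0; split; apply: mz => //; apply: mulr_ge0; rewrite ?powR_ge0// ltW.
  have [Pu Pv] := PT n t (ltW t0).
  rewrite PS; split => /=.
    apply: (le_trans (H1 u0 w1 _ E e t t0 Cu0 Cw1 Pv E0 e0 mu0 mw1 _)).
      by move=> s /andP[s0 _]; have [_] := IH s s0.
    by apply: mono; rewrite ?powR_ge0//; apply: mulr_ge0; [exact: ltW|rewrite addr_ge0 ?powR_ge0 ?(ltW e0)].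
  apply: (le_trans (H2 v0 w2 _ E e t t0 Cv0 Cw2 Pu E0 e0 mv0 mw2 _)).
    by move=> s /andP[s0 _]; have [h _] := IH s s0; exact: h.
  by apply: mono; rewrite ?powR_ge0//; apply: mulr_ge0; [exact: ltW|rewrite addr_ge0 ?powR_ge0 ?(ltW e0)].
suff bounded T : 0 <= T -> exists M, forall n t, 0 <= t <= T -> forall x,
    `|(P n).1 t x| <= M /\ `|(P n).2 t x| <= M.
  eexists; eexists => T T0; have [M PM] := bounded T T0; rewrite PD in PM.
  by apply: (picard_limit T0 p1 q1 (F1T T T0) (F2T T T0) (zT T) (zT T) PM).
move=> T0; have [K K0 FK] := exists_bound_free_part sigma0 Cu0 Cv0 Cw1 Cw2 T0.
have z10 : -1 < (0:R) by lra.
(* on [0, t0] the nonlinear terms add at most 1 to the bound K of the free parts *)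
pose M0 := K + 1; have M00 : 0 < M0 by rewrite addr_gt0.
have D0 : 0 < M0 `^ p + M0 `^ q by rewrite addr_gt0 ?powR_gt0.
pose t0 := (M0 `^ p + M0 `^ q)^-1; have t00 : 0 < t0 by rewrite invr_gt0.
have local m : forall t, 0 <= t <= T -> t <= t0 -> forall x,
    `|(P m).1 t x| <= M0 /\ `|(P m).2 t x| <= M0.
  elim: m => [|m IH] t tT tt0 x; first by rewrite P0 /z normr0 ltW.
  have /andP[t0' tT'] := tT; have [h1 h2] := FK t tT x.
  have [Pu Pv] := PT m T T0.
  have sub s : 0 <= s <= t -> 0 <= s <= T /\ s <= t0.
    by move=> /andP[-> st]; rewrite !(le_trans st).
  have step (r : R) g : 0 < r -> M0 `^ r <= M0 `^ p + M0 `^ q -> C0_path T g -> 1 < r ->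
      (forall s, 0 <= s <= t -> forall x, `|g s x| <= M0) ->
      `|duhamel 0 (pow_path r g) t x| <= 1.
    move=> r0 rD gT r1 gM.
    apply: (@le_trans _ _ (M0 `^ r * (t `^ (0 + 1) / (0 + 1)))).
      apply: (duhamel_bound x z10 (C0_path_pow T0 r1 gT) tT (powR_ge0 _ _)) => s st y.
      by apply: pow_path_bound => //; exact: gM.
    rewrite add0r divr1 powRr1//.
    apply: (@le_trans _ _ ((M0 `^ p + M0 `^ q) * t0)).
      by rewrite ler_pM ?powR_ge0.
    by rewrite /t0 divff// gt_eqF.
  rewrite PS /= /mild_map; split; apply: (le_trans (ler_normD _ _)).
    apply: (lerD h1); apply: step => //; first by rewrite lerDl powR_ge0.
    by move=> s /sub[sT st0] y; have [_] := IH s sT st0 y.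
  apply: (lerD h2); apply: step => //; first by rewrite lerDr powR_ge0.
  by move=> s /sub[sT st0] y; have [] := IH s sT st0 y.
have k11 : 1 <= k1 by rewrite ler_pdivlMr// mul1r.
have k21 : 1 <= k2 by rewrite ler_pdivlMr// mul1r.
have nk1 : n = k1 * (1 + sigma + a) by rewrite divfK// gt_eqF.
have nk2 : n = k2 * (1 + sigma + b) by rewrite divfK// gt_eqF.
have [ea [Ka [ea0 eaa Ka0 HKa]]] := duhamel_pow_sublinear p1 sigma0 a0 pb k11 nk1 E0 t00.
have [eb [Kb [eb0 ebb Kb0 HKb]]] := duhamel_pow_sublinear q1 sigma0 b0 qa k21 nk2 E0 t00.
have [M Mp [HMa HMb HMc HMd]] :=
  exists_sup_level (ltW K0) Ka0 Kb0 ea0 eaa eb0 ebb (ltW M00).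
have bnd m : forall t, 0 <= t <= T -> forall x,
    `|(P m).1 t x| <= M `^ a /\ `|(P m).2 t x| <= M `^ b.
  elim: m => [|m IH] t tT x; first by rewrite P0 /z normr0 !powR_ge0.
  have /andP[t0' tT'] := tT.
  have [tt0|/ltW t0t] := leP t t0.
    have [h1 h2] := local m.+1 t tT tt0 x.
    by split; [exact: le_trans HMc|exact: le_trans HMd].
  have [h1 h2] := FK t tT x; have [Pu Pv] := PT m t t0'.
  have sub s : 0 <= s <= t -> 0 <= s <= T by move=> /andP[-> /le_trans]; exact.
  rewrite PS /= /mild_map; split; apply: (le_trans (ler_normD _ _)).
    apply: (le_trans _ HMa); apply: (lerD h1); apply: HKa => //.
      by move=> s /andP[s0 _]; have [_] := masses m s s0.
    by move=> s /sub sT y; have [_] := IH s sT y.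
  apply: (le_trans _ HMb); apply: (lerD h2); apply: HKb => //.
    by move=> s /andP[s0 _]; have [h _] := masses m s s0; exact: h.
  by move=> s /sub sT y; have [] := IH s sT y.
exists (M `^ a + M `^ b) => m t tT x; have [h1 h2] := bnd m t tT x.
by split; [rewrite (le_trans h1)// lerDl powR_ge0|rewrite (le_trans h2)// lerDr powR_ge0].
Qed.

End global_existence.

(** * The blow-up and global existence dichotomy *)

Section assembly.
Context {R : realType} {N : nat}.
Local Notation lam := (lebesgue_rV R N).

Lemma mass_le_Lnorm (d e : R) (f : 'rV[R]_N -> R) : 0 < d -> 0 <= e ->
  ('N[lam]_(d%:E)[EFin \o f] <= e%:E)%E -> (mass d f <= (e `^ d)%:E)%E.
Proof.
move=> d0 e0 fe.
have -> : mass d f = ('N[lam]_(d%:E)[EFin \o f] `^ d)%E.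
  by rewrite poweR_Lnorm ?gt_eqF.
rewrite -poweR_EFin; apply: gt0_ler_poweR => //; first exact: ltW.
- by rewrite in_itv/= Lnorm_ge0 leey.
- by rewrite in_itv/= lee_fin e0 leey.
Qed.

Lemma mild_solution_on_swap p q (F1 F2 u v : R -> 'rV[R]_N -> R) T :
  mild_solution_on p q F1 F2 T u v -> mild_solution_on q p F2 F1 T v u.
Proof.
move=> [uT vT E]; split; [exact: vT|exact: uT|] => t tT x.
have [h1 h2] := E t tT x.
by split; [exact: h2|exact: h1].
Qed.

Lemma feedback_exponent_maxl (p q : R) : 1 < p -> 1 < q ->
  feedback_exponent p q <= (Num.max p q + 1) / (p * q - 1).
Proof.
move=> p1 q1; rewrite ler_pM2r ?invr_gt0 ?mulB1_gt0//.
by rewrite lerD2r le_max lexx.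
Qed.

End assembly.

(** Part (i) bounds every existence time by mild_solution_lifespan, applied to
    (u, v) or to (v, u) according to which of p and q is larger.  In part (ii)
    N >= N* says that both exponents k1 and k2 are at least 1. *)
Theorem corollary1p7 (R : realType) (N : nat) (sigma p q : R)
    (hN : (1 <= N)%N) (hsigma : -1 < sigma < 0) (hp : 1 < p) (hq : 1 < q) :
  let mu := lebesgue_rV R N in
  let alpha := Num.max p q in
  let Nstar := 2 * (sigma + 1 + (alpha + 1) / (p * q - 1)) in
  let d1 := N%:R * (p * q - 1) / (2 * (p + 1)) in
  let d2 := N%:R * (p * q - 1) / (2 * (q + 1)) in
  let k1 := N%:R * (p * q - 1) / (2 * ((p * q - 1) * (1 + sigma) + p + 1)) in
  let k2 := N%:R * (p * q - 1) / (2 * ((p * q - 1) * (1 + sigma) + q + 1)) in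
  (forall u0 v0 w1 w2 : 'rV[R]_N -> R,
     C0 u0 -> C0 v0 ->
     C0 w1 -> w1 \in Lfun mu 1 -> C0 w2 -> w2 \in Lfun mu 1 ->
     0 < \int[mu]_x w1 x -> 0 < \int[mu]_x w2 x ->
     N%:R < Nstar ->
     exists u v, is_maximal_mild_solution p q sigma u0 v0 w1 w2 u v /\
       blows_up_in_finite_time p q sigma u0 v0 w1 w2 u v) /\
  (Nstar <= N%:R ->
   exists2 eps : R, 0 < eps &
   forall u0 v0 w1 w2 : 'rV[R]_N -> R,
     C0 u0 -> u0 \in Lfun mu d1%:E ->
     C0 v0 -> v0 \in Lfun mu d2%:E ->
     C0 w1 -> w1 \in Lfun mu k1%:E ->
     C0 w2 -> w2 \in Lfun mu k2%:E ->
     ('N[mu]_(d1%:E)[EFin \o u0] + 'N[mu]_(d2%:E)[EFin \o v0] +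
      'N[mu]_(k1%:E)[EFin \o w1] + 'N[mu]_(k2%:E)[EFin \o w2] <= eps%:E)%E ->
     exists u v, is_maximal_mild_solution p q sigma u0 v0 w1 w2 u v /\
       exists_globally p q sigma u0 v0 w1 w2).
Proof.
move=> mu alpha Nstar d1 d2 k1 k2.
have pq0 := mulB1_gt0 hp hq.
have /andP[sg1 sg0] := hsigma.
split.
- move=> u0 v0 w1 w2 Cu0 Cv0 Cw1 Lw1 Cw2 Lw2 I1 I2 hNs.
  have iw1 := (Lfun1_integrable mu w1).1 Lw1.
  have iw2 := (Lfun1_integrable mu w2).1 Lw2.
  have [T0 T00 none] : exists2 T0 : R, 0 < T0 & forall T u v, T0 <= T ->
      ~ mild_solution_on p q (free_part sigma u0 w1) (free_part sigma v0 w2) T u v.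
    move: hNs; rewrite /Nstar /alpha; have [pq|qp] := leP p q => hNs.
      have [|T0 T00 none] := mild_solution_lifespan hsigma hq hp Cw2 Cw1 iw2 iw1 I2 I1.
        by rewrite /feedback_exponent [q * p]mulrC; move: hNs; lra.
      exists T0 => // T u v T0T uv; apply: (none T v0 u0 v u T0T Cv0 Cu0).
      exact: mild_solution_on_swap.
    have [|T0 T00 none] := mild_solution_lifespan hsigma hp hq Cw1 Cw2 iw1 iw2 I1 I2.
      by rewrite /feedback_exponent; move: hNs; lra.
    by exists T0 => // T u v T0T; exact: none.
  have Tfin : (Tmax p q sigma u0 v0 w1 w2 < +oo)%E.
    apply: (@le_lt_trans _ _ T0%:E); last exact: ltry.
    apply: ge_ereal_sup => _ [tau [tau0 [u [v uv]]] <-]; rewrite lee_fin leNgt.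
    apply/negP => T0tau; apply: (none tau u v (ltW T0tau)).
    by apply/is_mild_solutionP => //; exact: ltW.
  have [u [v uv]] := exists_maximal_solution hp hq hsigma Cu0 Cv0 Cw1 Cw2.
  by exists u, v; split => //; exact: maximal_solution_blow_up.
- move=> hNs.
  have N0 : 0 < N%:R :> R by rewrite ltr0n.
  pose a := feedback_exponent p q; pose b := feedback_exponent q p.
  have a0 : 0 < a by apply: divr_gt0 => //; lra.
  have b0 : 0 < b by rewrite /b /feedback_exponent [q * p]mulrC; apply: divr_gt0 => //; lra.
  have am : a <= (alpha + 1) / (p * q - 1) by exact: feedback_exponent_maxl.
  have bm : b <= (alpha + 1) / (p * q - 1).
    by have := feedback_exponent_maxl hq hp; rewrite maxC (mulrC q p).
  have na : 1 + sigma + a <= N%:R / 2 by move: hNs; rewrite /Nstar; lra.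
  have nb : 1 + sigma + b <= N%:R / 2 by move: hNs; rewrite /Nstar; lra.
  have [e e0 He] := global_existence hp hq hsigma na nb.
  exists e => // u0 v0 w1 w2 Cu0 Lu0 Cv0 Lv0 Cw1 Lw1 Cw2 Lw2 small.
  have p10 : p + 1 != 0 by rewrite gt_eqF//; lra.
  have q10 : q + 1 != 0 by rewrite gt_eqF//; lra.
  have d1E : d1 = N%:R / 2 / a.
    by rewrite /d1 /a /feedback_exponent; field; rewrite p10 gt_eqF.
  have d2E : d2 = N%:R / 2 / b.
    by rewrite /d2 /b /feedback_exponent [q * p]mulrC; field; rewrite q10 gt_eqF.
  have k1E : k1 = N%:R / 2 / (1 + sigma + a).
    have -> : 1 + sigma + a = ((p * q - 1) * (1 + sigma) + p + 1) / (p * q - 1).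
      by rewrite /a /feedback_exponent; field; rewrite gt_eqF.
    have h : 0 < (p * q - 1) * (1 + sigma) by rewrite mulr_gt0//; lra.
    have X0 : 0 < (p * q - 1) * (1 + sigma) + p + 1 by lra.
    rewrite /k1; move: (_ + p + 1) X0 => X X0.
    by field; rewrite !gt_eqF.
  have k2E : k2 = N%:R / 2 / (1 + sigma + b).
    have -> : 1 + sigma + b = ((p * q - 1) * (1 + sigma) + q + 1) / (p * q - 1).
      by rewrite /b /feedback_exponent [q * p]mulrC; field; rewrite gt_eqF.
    have h : 0 < (p * q - 1) * (1 + sigma) by rewrite mulr_gt0//; lra.
    have X0 : 0 < (p * q - 1) * (1 + sigma) + q + 1 by lra.
    rewrite /k2; move: (_ + q + 1) X0 => X X0.
    by field; rewrite !gt_eqF.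
  have sa0 : 0 < 1 + sigma + a by lra.
  have sb0 : 0 < 1 + sigma + b by lra.
  have n20 : 0 < N%:R / 2 :> R by rewrite divr_gt0.
  clearbody d1 d2 k1 k2; subst d1 d2 k1 k2.
  have l1 (x y : \bar R) : (0 <= y -> x + y <= e%:E -> x <= e%:E)%E.
    by move=> y0; apply: le_trans; rewrite leeDl.
  have l2 (x y : \bar R) : (0 <= x -> x + y <= e%:E -> y <= e%:E)%E.
    by move=> x0; apply: le_trans; rewrite leeDr.
  have s1 := l1 _ _ (Lnorm_ge0 _ _ _) small; have s2 := l1 _ _ (Lnorm_ge0 _ _ _) s1.
  have [||||u [v uv]] := He u0 v0 w1 w2 Cu0 Cv0 Cw1 Cw2.
  + apply: mass_le_Lnorm; [exact: divr_gt0|exact: ltW|].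
    exact: (l1 _ _ (Lnorm_ge0 _ _ _) s2).
  + apply: mass_le_Lnorm; [exact: divr_gt0|exact: ltW|].
    exact: (l2 _ _ (Lnorm_ge0 _ _ _) s2).
  + apply: mass_le_Lnorm; [exact: divr_gt0|exact: ltW|].
    exact: (l2 _ _ (adde_ge0 (Lnorm_ge0 _ _ _) (Lnorm_ge0 _ _ _)) s1).
  + apply: mass_le_Lnorm; [exact: divr_gt0|exact: ltW|].
    apply: (l2 _ _ _ small).
    exact: (adde_ge0 (adde_ge0 (Lnorm_ge0 _ _ _) (Lnorm_ge0 _ _ _)) (Lnorm_ge0 _ _ _)).
  have Tle T : 0 < T -> (T%:E <= Tmax p q sigma u0 v0 w1 w2)%E.
    by move=> T0; exact: (le_Tmax T0 (uv T (ltW T0))).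
  exists u, v; split; last by apply/eqyP => A; exact: Tle.
  split; first by apply: lt_le_trans (Tle 1 ltr01); rewrite lte_fin.
  move=> tau tau0 _; apply/is_mild_solutionP; first exact: ltW.
  exact/uv/ltW.
Qed.
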